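(* Let $L$ be a distribution function on $\mathbb{R}$ with $\int x\,dL(x)=0$ and $\int x^2\,dL(x)=1$, let $\xi$ be a random variable with distribution function $L$, and let $(X_1,\dots,X_n)$ have the joint distribution $$dP_{n,\beta}(\mathbf{x})=\frac{1}{K_n}\exp\Big(\frac{\beta(x_1+\cdots+x_n)^2}{2n}\Big)\prod_{i=1}^n dL(x_i),\qquad \mathbf{x}=(x_1,\dots,x_n)\in\mathbb{R}^n,$$ where $K_n$ is the normalizing constant. Let $S_n=X_1+\cdots+X_n$. (i) Suppose $0<\beta<1$ and there is a constant $b>\beta$ such that $Ee^{t\xi}\le e^{t^2/(2b)}$ for all $t\in\mathbb{R}$. Let $W_n=S_n/\sqrt{n}$. Then there is a constant $C$ depending only on $b$ and $\beta$ such that for all $n\ge1$ and $z\in\mathbb{R}$, $$\big|P(W_n\le z)-F_1(z)\big|\le\frac{C}{1+(1-\beta)|z|}\cdot\frac{1}{\sqrt{n}},$$ where $F_1$ is the distribution function of a normal random variable $Z_1\sim\mathcal{N}\big(0,\tfrac{1}{1-\beta}\big)$. (ii) Suppose $\beta=1$, $L$ is of type $k$ (with some strength $\lambda_\rho$) for a positive integer $k$, and there are constants $b_0>0$, $b_1>0$, $b_2>1$ such that $$Ee^{t\xi}\le\begin{cases}\exp(t^2/2-b_1t^{2k}), & |t|\le b_0,\\ \exp\big(t^2/(2b_2)\big), & |t|>b_0.\end{cases}$$ Let $W_n=S_n/n^{1-1/(2k)}$. Then there is a constant $C$ depending only on $b_0,b_1,b_2$ and $k$ such that for all $n\ge1$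 and $z\in\mathbb{R}$, $$\big|P(W_n\le z)-F_k(z)\big|\le\frac{C}{1+2kc_2|z|^{2k-1}}\cdot\frac{1}{n^{1/(2k)}},$$ where $F_k$ is the distribution function with density $p_k(y)=c_1e^{-c_2y^{2k}}$, $c_2=\dfrac{H^{(2k)}(0)}{(2k)!}$, $c_1$ is the normalizing constant, and $$H(s)=\frac{s^2}{2}-\ln\Big(\int_{-\infty}^{+\infty}e^{sx}\,dL(x)\Big),\quad s\in\mathbb{R}.$$
   Context: For a positive integer $k$ and a real number $\lambda_\rho$, $L$ is said to be of type $k$ with strength $\lambda_\rho$ if $$\int_{-\infty}^{+\infty}x^j\,d\Phi(x)-\int_{-\infty}^{+\infty}x^j\,dL(x)=\begin{cases}0, & j=1,\dots,2k-1,\\ \lambda_\rho, & j=2k,\end{cases}$$ where $\Phi$ is the standard normal distribution function. $H^{(2k)}$ denotes the $2k$-th derivative of $H$. *)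

(* Defs.v *)
From HB Require Import structures.
From mathcomp Require Import all_boot all_order all_algebra.
From mathcomp Require Import all_classical all_reals all_analysis.
Import Order.TTheory GRing.Theory Num.Theory.
Import numFieldNormedType.Exports.

Set Implicit Arguments.
Unset Strict Implicit.
Unset Printing Implicit Defensive.

Local Open Scope classical_set_scope.
Local Open Scope ring_scope.

(* The n-fold product P (x) ... (x) P on the product sigma-algebra of
   n.-tuple T, transported along T * T^n ~ T^(n+1) at each step. *)
Section product_power.
Context d (T : measurableType d) (R : realType) (P : probability T R).

Definition tuple_cons n (p : T * n.-tuple T) : n.+1.-tuple T :=
  [tuple of p.1 :: p.2].

Lemma measurable_tuple_cons n :
  measurable_fun [set: T * n.-tuple T] (@tuple_cons n).
Proof.
exact: (@measurable_cons _ _ _ _ (@fst T (n.-tuple T)) n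
  (@snd T (n.-tuple T))).
Qed.

HB.instance Definition _ n :=
  isMeasurableFun.Build _ _ _ _ (@tuple_cons n) (@measurable_tuple_cons n).

Fixpoint product_power (n : nat) : probability (n.-tuple T) R :=
  match n with
  | 0 => dirac [tuple] : probability (0.-tuple T) R
  | m.+1 => distribution (P \x product_power m)%E (@tuple_cons m)
      : probability (m.+1.-tuple T) R
  end.

Lemma product_power_rect n (A : 'I_n -> set T) :
  (forall i, measurable (A i)) ->
  product_power n [set x | forall i, A i (tnth x i)] =
    (\prod_(i < n) P (A i))%E.
Proof.
elim: n A => [|n IH] A mA /=; first by rewrite big_ord0 diracE mem_set//; case.
rewrite /distribution /pushforward big_ord_recl -IH//.
set B := [set x | _]; set C := [set x | _].
have -> : @tuple_cons n @^-1` B = A ord0 `*` C.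
  apply/seteqP; split=> -[a x]; rewrite /B /C /=.
    move=> h; split; first by have := h ord0.
    by move=> i; have := h (lift ord0 i); rewrite tnthS.
  move=> [h1 h2] i; case: (unliftP ord0 i) => [j|] ->; last exact: h1.
  by rewrite tnthS; exact: h2.
rewrite product_measure1E//.
have -> : C = \bigcap_(i in [set: 'I_n])
    ((fun x => tnth x i) @^-1` A (lift ord0 i)).
  by apply/seteqP; split=> x h i; [move=> _; exact: h | exact: (h i I)].
apply: fin_bigcap_measurable => // i _.
by rewrite -[X in measurable X]setTI; apply: measurable_tnth.
Qed.

End product_power.

Section curie_weiss.
Context {R : realType}.

(* A distribution function is a right-continuous nondecreasing function with
   limits 0 and 1 at -oo and +oo; dL is its Lebesgue-Stieltjes measure. *)
Definition distribution_function := cumulativeBounded (0 : R) (1 : R).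

Implicit Types (L : distribution_function) (n k : nat) (beta : R).

Definition dmeas L : probability (measurableTypeR R) R :=
  lebesgue_stieltjes_measure L.

Definition cw_weight n beta (x : n.-tuple (measurableTypeR R)) : R :=
  expR (beta * (\sum_(i < n) (tnth x i : R)) ^+ 2 / (2 * n%:R)).

Definition cw_norm L n beta : \bar R :=
  (\int[product_power (dmeas L) n]_x (cw_weight beta x)%:E)%E.

Definition cw_measure L n beta (A : set (n.-tuple (measurableTypeR R)))
    : \bar R :=
  ((fine (cw_norm L n beta))^-1%:E *
   \int[product_power (dmeas L) n]_(x in A) (cw_weight beta x)%:E)%E.

Definition has_cw_law L n beta d (T : measurableType d)
    (P : probability T R) (X : 'I_n -> {RV P >-> R}) : Prop :=
  forall A : set (n.-tuple (measurableTypeR R)), measurable A ->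
    P [set w | A [tuple X i w | i < n]] = cw_measure L beta A.

(* Integrals are extended-real valued: an equation with a finite right-hand
   side forces the L-moment to be finite (oo - oo is -oo in \bar R). *)
Definition is_type L k (lambda : R) : Prop :=
  (forall j, (1 <= j <= 2 * k - 1)%N ->
     (\int[normal_prob 0 1]_x ((x : R) ^+ j)%:E - \int[dmeas L]_x ((x : R) ^+ j)%:E
        = 0)%E) /\
  (\int[normal_prob 0 1]_x ((x : R) ^+ (2 * k))%:E
     - \int[dmeas L]_x ((x : R) ^+ (2 * k))%:E = lambda%:E)%E.

Definition cw_H L (s : R) : R :=
  s ^+ 2 / 2 - ln (\int[dmeas L]_x expR (s * (x : R))).

Definition cw_c2 L k : R := derive1n (2 * k) (cw_H L) 0 / ((2 * k)`!)%:R.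

Definition cw_c1 L k : R :=
  (\int[lebesgue_measure]_(y in [set: R]) expR (- (cw_c2 L k * y ^+ (2 * k))))^-1.

Definition cw_density L k (y : R) : R :=
  cw_c1 L k * expR (- (cw_c2 L k * y ^+ (2 * k))).

Definition cw_limit_cdf L k (z : R) : \bar R :=
  (\int[lebesgue_measure]_(y in `]-oo, z]%classic) (cw_density L k y)%:E)%E.

(* The second parameter of normal_prob is the standard deviation. *)
Definition normal_limit_cdf beta (z : R) : \bar R :=
  normal_prob 0 (Num.sqrt (1 / (1 - beta))) `]-oo, z]%classic.

End curie_weiss.
Arguments distribution_function : clear implicits.

(* Main.v *)
From HB Require Import structures.
Require Import Defs.
From mathcomp Require Import all_boot all_order all_algebra.
From mathcomp Require Import all_classical all_reals all_analysis.
From mathcomp Require Import measurable_realfun ring lra.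
Import Order.TTheory GRing.Theory Num.Theory.
Import numFieldNormedType.Exports.

(** Let nu be the law of the sum of n independent variables with law dL.  Under
    the Curie-Weiss law, S_n has density proportional to exp(beta s^2 / 2n)
    with respect to nu (cw_law_sum), so both parts are about integrals of a
    Gaussian weight against nu.  The bound on E exp(t xi) makes dL subgaussian,
    which keeps these integrals finite uniformly in n (sum_law_gauss_moment).

    Below the critical temperature, put W = S / sqrt n, let psi(W) be the weight
    and K >= 1 its integral against nu.  The difference of the two distribution
    functions at z is K^-1 times the nu-mean of psi(W) (1_{W <= z} - F(z)).  By
    Stein's method this function equals g'(W) - W g(W) for an explicit g, the
    product of psi and the solution of Stein's equation for N(0, 1/(1-beta)).
    By exchangeability the mean of W g(W) is sqrt n times the mean of x g(W),
    where x is a single summand (sum_law_exchange).  Expanding around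
    Y = W - x / sqrt n, the mean 0 and the variance 1 of x cancel all the
    leading terms, and what remains has order 1 / sqrt n (cw_score_large).
    Two points need care.  First, g and its derivatives grow like a Gaussian
    weight slightly larger than psi, with a factor 1/(1 + |z|)
    (stein_bounds_l); the gap between beta and b leaves room for it.  Second,
    g' jumps at z, so the probability that z lies within |x| / sqrt n of Y is
    needed, with a Gaussian decay in z that offsets the growth of g there; this
    is again proved by Stein's method (sum_law_concentration).

    At the critical temperature put a = n^(1/2k), so that W = a S / n.  The
    weight exp(s^2 / 2n) is a Gaussian mixture of exponentials (the
    Hubbard-Stratonovich identity).  Adding to W an independent centred normal
    variable of variance a^2/n, under the Curie-Weiss law, therefore gives a
    variable with an explicit density, proportional to
    (E exp(v xi / a))^n exp(- n (v/a)^2 / 2) = exp(- n H(v/a)).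
    The derivatives of H at 0 depend on the moments of L only, and H vanishes
    identically for the normal law; since L is of type k, H(u) is
    c2 u^(2k) + O(u^(2k+1)), uniformly over the admissible L (defect_expansion).
    So the density is within O(1/a) of its limit exp(- c2 v^(2k)), with light
    tails (scaled_dens_diff_le), and dividing by the total masses compares the
    distribution functions (compare_cdf).  Removing the added normal variable
    costs the mass that the density puts within a standard deviation of z
    (hs_smoothing), of order a / sqrt n <= 1/a for k >= 2.  For k = 1 the
    hypotheses are contradictory, because unit variance forces c2 = 0 whereas
    the bound on E exp(t xi) forces c2 >= b1 > 0 (no_type_one). *)

Set Implicit Arguments.
Unset Strict Implicit.
Unset Printing Implicit Defensive.

Local Open Scope classical_set_scope.
Local Open Scope ring_scope.

(** * Integration of real functions *)
Lemma measurable_fun_expR d (T : measurableType d) (R : realType) (f : T -> R) :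
  measurable_fun setT f -> measurable_fun setT (fun x => expR (f x)).
Proof. by move=> mf; apply: measurableT_comp. Qed.
Lemma measurable_fun_norm d (T : measurableType d) (R : realType) (f : T -> R) :
  measurable_fun setT f -> measurable_fun setT (fun x => `|f x|).
Proof. by move=> mf; apply: measurableT_comp. Qed.
Lemma measurable_fun_opp d (T : measurableType d) (R : realType) (f : T -> R) :
  measurable_fun setT f -> measurable_fun setT (fun x => - f x).
Proof. by move=> mf; apply: measurableT_comp. Qed.

(** Measurability of explicit expressions, by recursion on their syntax. *)
Ltac mfun := 
  lazymatch goal with
  | |- measurable_fun _ (fun x => EFin (@?f x)) => apply/measurable_EFinP; mfun
  | |- measurable_fun _ (fun x => (@?f x + @?g x)%R) =>
      apply: (@measurable_funD _ _ _ _ f g); mfun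
  | |- measurable_fun _ (fun x => (@?f x * @?g x)%R) =>
      apply: (@measurable_funM _ _ _ _ f g); mfun
  | |- measurable_fun _ (fun x => (- @?f x)%R) =>
      apply: (@measurable_fun_opp _ _ _ f); mfun
  | |- measurable_fun _ (fun x => (@?f x ^+ ?n)%R) =>
      apply: (@measurable_funX _ _ _ _ f n); mfun
  | |- measurable_fun _ (fun x => expR (@?f x)) =>
      apply: (@measurable_fun_expR _ _ _ f); mfun
  | |- measurable_fun _ (fun x => `|@?f x|%R) =>
      apply: (@measurable_fun_norm _ _ _ f); mfun
  | |- measurable_fun _ (fun x => fst x) => exact: measurable_fst
  | |- measurable_fun _ (fun x => snd x) => exact: measurable_snd
  | |- measurable_fun _ (fun x => x) => exact: measurable_id
  | |- measurable_fun _ (fun _ => ?c) => exact: measurable_cst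
  | H : measurable_fun _ ?h |- measurable_fun _ ?h => exact: H
  | H : measurable_fun _ ?h |- measurable_fun _ (fun x => ?h x) => exact: H
  | H : measurable_fun _ ?h |- measurable_fun _ (fun x => ?h (@?f x)) =>
      apply: (measurableT_comp H); mfun
  | |- _ => by []
  end.

Lemma measurable_indic_le (R : realType) (a : R) d (T : measurableType d) (f : T -> R) :
  measurable_fun setT f -> measurable_fun setT (fun x => (f x <= a)%R%:R : R).
Proof.
move=> mf.
have -> : (fun x => (f x <= a)%R%:R : R) = \1_[set x | f x <= a].
  by apply/funext => x; rewrite indicE; congr (nat_of_bool _)%:R; apply/idP/idP; rewrite inE.
apply: measurable_indic; rewrite -[X in measurable X]setTI.
exact: measurable_fun_ler.
Qed.

Section integral_tools.
Context d (T : measurableType d) (R : realType).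
Variable m : {measure set T -> \bar R}.
Implicit Types f g : T -> R.

Lemma dominated_integrable f g : measurable_fun setT f ->
  (forall x, `|f x| <= g x) -> m.-integrable setT (EFin \o g) ->
  m.-integrable setT (EFin \o f).
Proof.
move=> mf fg ig; apply: (le_integrable _ _ _ ig) => //.
  exact/measurable_EFinP.
by move=> x _ /=; rewrite lee_fin (le_trans (fg x))// ler_norm.
Qed.

Lemma eq_Rint f g : f =1 g -> \int[m]_x f x = \int[m]_x g x.
Proof. by move/funext ->. Qed.

Lemma le_Rint f g : m.-integrable setT (EFin \o f) ->
  m.-integrable setT (EFin \o g) -> (forall x, f x <= g x) ->
  \int[m]_x f x <= \int[m]_x g x.
Proof. by move=> fi gi fg; apply: le_Rintegral => // x _; exact: fg. Qed.

Lemma EFin_Rint f : m.-integrable setT (EFin \o f) ->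
  ((\int[m]_x f x)%:E = \int[m]_x (f x)%:E)%E.
Proof. by move=> fi; rewrite fineK//; exact: integrable_fin_num. Qed.

(** Every integrability proof below goes this way: bound the extended integral
    of a nonnegative function, then pass to its real integral. *)
Lemma ge0_Rint_le f c : measurable_fun setT f -> (forall x, 0 <= f x) ->
  (\int[m]_x (f x)%:E <= c%:E)%E ->
  m.-integrable setT (EFin \o f) /\ \int[m]_x f x <= c.
Proof.
move=> mf f0 fc.
have fi : m.-integrable setT (EFin \o f).
  apply/integrableP; split; first exact/measurable_EFinP.
  under eq_integral do rewrite /= ger0_norm//.
  by rewrite (le_lt_trans fc)// ltry.
by split => //; rewrite -lee_fin EFin_Rint.
Qed.

Lemma ge0_le_int f g : measurable_fun setT f -> measurable_fun setT g ->
  (forall x, 0 <= f x) -> (forall x, f x <= g x) ->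
  (\int[m]_x (f x)%:E <= \int[m]_x (g x)%:E)%E.
Proof.
move=> mf mg f0 fg; apply: ge0_le_integral => //; try exact/measurable_EFinP.
- by move=> x _; rewrite lee_fin.
- by move=> x _; rewrite lee_fin.
Qed.

Lemma ge0_intZl f c : measurable_fun setT f -> 0 <= c -> (forall x, 0 <= f x) ->
  (\int[m]_x (c * f x)%:E = c%:E * \int[m]_x (f x)%:E)%E.
Proof.
move=> mf c0 f0; under eq_integral do rewrite EFinM.
rewrite ge0_integralZl//; first exact/measurable_EFinP.
by move=> x _; rewrite lee_fin.
Qed.

Lemma norm_Rint_le f g c : measurable_fun setT f -> measurable_fun setT g ->
  (forall x, `|f x| <= g x) -> (\int[m]_x (g x)%:E <= c%:E)%E ->
  m.-integrable setT (EFin \o f) /\ `|\int[m]_x f x| <= c.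
Proof.
move=> mf mg fg gc.
have g0 x : 0 <= g x by rewrite (le_trans _ (fg x)).
have [gi gc'] := ge0_Rint_le mg g0 gc.
have fi := dominated_integrable mf fg gi.
split => //; apply: le_trans (le_normr_Rintegral measurableT fi) _.
apply: le_trans gc'; apply: le_Rint => //.
exact: (integrable_norm fi).
Qed.

End integral_tools.

Section tonelli_tools.
Context d1 d2 (T1 : measurableType d1) (T2 : measurableType d2) (R : realType).
Variables (m1 : {sigma_finite_measure set T1 -> \bar R}).
Variables (m2 : {sigma_finite_measure set T2 -> \bar R}).

Lemma ge0_int_prod (F : T1 * T2 -> R) : measurable_fun setT F ->
  (forall p, 0 <= F p) ->
  (\int[m1 \x m2]_p (F p)%:E = \int[m1]_x \int[m2]_y (F (x, y))%:E)%E.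
Proof.
move=> mF F0; by rewrite fubini_tonelli1//=; exact/measurable_EFinP.
Qed.

Lemma ge0_int_swap (F : T1 * T2 -> R) : measurable_fun setT F ->
  (forall p, 0 <= F p) ->
  (\int[m1]_x \int[m2]_y (F (x, y))%:E = \int[m2]_y \int[m1]_x (F (x, y))%:E)%E.
Proof.
move=> mF F0; by rewrite (fubini_tonelli (EFin \o F))//; exact/measurable_EFinP.
Qed.

End tonelli_tools.

Section product_tools.
Context d1 d2 (T1 : measurableType d1) (T2 : measurableType d2) (R : realType).
Variables (m1 : probability T1 R) (m2 : probability T2 R).

Lemma measurable_fst_comp (f : T1 -> R) : measurable_fun setT f ->
  measurable_fun setT (fun p : T1 * T2 => f p.1).
Proof. by move=> mf; apply: measurableT_comp. Qed.

Lemma measurable_snd_comp (f : T2 -> R) : measurable_fun setT f ->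
  measurable_fun setT (fun p : T1 * T2 => f p.2).
Proof. by move=> mf; apply: measurableT_comp. Qed.

Lemma ge0_int_prodM (f : T1 -> R) (g : T2 -> R) :
  measurable_fun setT f -> measurable_fun setT g ->
  (forall x, 0 <= f x) -> (forall x, 0 <= g x) ->
  (\int[m1 \x m2]_p (f p.1 * g p.2)%:E =
   \int[m1]_x (f x)%:E * \int[m2]_x (g x)%:E)%E.
Proof.
move=> mf mg f0 g0; rewrite fubini_tonelli1//=; last 2 first.
- apply/measurable_EFinP; apply: measurable_funM.
  + exact: measurable_fst_comp.
  + exact: measurable_snd_comp.
- by move=> x; rewrite lee_fin mulr_ge0.
transitivity (\int[m1]_x ((f x)%:E * \int[m2]_y (g y)%:E))%E.
  by apply: eq_integral => x _; rewrite /fubini_F/= ge0_intZl.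
rewrite ge0_integralZr//.
- exact/measurable_EFinP.
- by move=> x _; rewrite lee_fin.
- by apply: integral_ge0 => x _; rewrite lee_fin.
Qed.

Lemma integrable_prodM (f : T1 -> R) (g : T2 -> R) :
  m1.-integrable setT (EFin \o f) -> m2.-integrable setT (EFin \o g) ->
  (m1 \x m2)%E.-integrable setT (EFin \o (fun p => f p.1 * g p.2)).
Proof.
move=> fi gi.
have mf : measurable_fun setT f by apply/measurable_EFinP; exact: measurable_int fi.
have mg : measurable_fun setT g by apply/measurable_EFinP; exact: measurable_int gi.
apply/integrableP; split.
  apply/measurable_EFinP; apply: measurable_funM.
  + exact: measurable_fst_comp.
  + exact: measurable_snd_comp.
under eq_integral do rewrite /= normrM.
rewrite (ge0_int_prodM (f := fun x => `|f x|) (g := fun x => `|g x|))//;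
  try exact: measurableT_comp.
have /= fi' := integrable_fin_num measurableT (integrable_norm fi).
have /= gi' := integrable_fin_num measurableT (integrable_norm gi).
by rewrite -(fineK fi') -(fineK gi') -EFinM ltry.
Qed.

Lemma Rint_prodM (f : T1 -> R) (g : T2 -> R) :
  m1.-integrable setT (EFin \o f) -> m2.-integrable setT (EFin \o g) ->
  \int[(m1 \x m2)%E]_p (f p.1 * g p.2) = (\int[m1]_x f x) * \int[m2]_x g x.
Proof.
move=> fi gi; have fgi := integrable_prodM fi gi.
apply: EFin_inj; rewrite EFin_Rint// -integral12_prod_meas1//=.
transitivity (\int[m1]_x ((\int[m2]_y g y)%:E * (f x)%:E))%E.
  apply: eq_integral => x _; rewrite /fubini_F/=.
  under eq_integral do rewrite EFinM.
  by rewrite integralZl// -EFin_Rint// muleC.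
by rewrite integralZl// -EFin_Rint// EFinM muleC.
Qed.

Lemma integrable_prod1 (f : T1 -> R) :
  m1.-integrable setT (EFin \o f) ->
  (m1 \x m2)%E.-integrable setT (EFin \o (fun p => f p.1)).
Proof.
move=> fi.
have /= := integrable_prodM fi (finite_measure_integrable_cst m2 1 measurableT).
by apply: eq_integrable => //= p _; rewrite mulr1.
Qed.

End product_tools.

(** * The law of an independent sum *)
Section sum_law.
Context (R : realType).
Local Notation M := (measurableTypeR R).
Variable P : probability M R.

Definition tsum n (x : n.-tuple M) : M := \sum_(i < n) (tnth x i : R).

Lemma measurable_tsum n : measurable_fun setT (@tsum n).
Proof.
apply: (@measurable_sum _ _ _ _ _ _ (fun i (x : n.-tuple M) => (tnth x i : R))).
by move=> i; exact: measurable_tnth.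
Qed.

HB.instance Definition _ n :=
  isMeasurableFun.Build _ _ _ _ (@tsum n) (@measurable_tsum n).

Definition sum_law n : probability M R := distribution (product_power P n) (@tsum n).

Lemma tsum_cons n (p : M * n.-tuple M) :
  tsum (tuple_cons p) = (p.1 : R) + (tsum p.2 : R).
Proof.
rewrite /tsum big_ord_recl; congr (_ + _).
by apply: eq_bigr => i _; rewrite tnthS.
Qed.

Lemma ge0_int_sum_law n (f : M -> R) : measurable_fun setT f ->
  (forall x, 0 <= f x) ->
  (\int[sum_law n]_s (f s)%:E = \int[product_power P n]_x (f (tsum x))%:E)%E.
Proof.
move=> mf f0; rewrite ge0_integral_distribution//.
exact/measurable_EFinP.
Qed.

Lemma ge0_int_power_cons n (f : n.+1.-tuple M -> R) : measurable_fun setT f ->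
  (forall x, 0 <= f x) ->
  (\int[product_power P n.+1]_x (f x)%:E =
   \int[P \x product_power P n]_p (f (tuple_cons p))%:E)%E.
Proof.
move=> mf f0.
rewrite [LHS]ge0_integral_distribution//.
exact/measurable_EFinP.
Qed.

Lemma ge0_int_sum_lawS n (f : M -> R) : measurable_fun setT f ->
  (forall x, 0 <= f x) ->
  (\int[sum_law n.+1]_s (f s)%:E =
   \int[P]_x \int[sum_law n]_s (f ((x : R) + (s : R)))%:E)%E.
Proof.
move=> mf f0; rewrite ge0_int_sum_law// ge0_int_power_cons//; last first.
  by apply: measurableT_comp => //; exact: measurable_tsum.
have mg : measurable_fun setT (fun p : M * n.-tuple M => f (tsum (tuple_cons p))).
  apply: measurableT_comp => //.
  apply: (measurableT_comp (@measurable_tsum n.+1)).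
  exact: measurable_tuple_cons.
rewrite fubini_tonelli1//=; [|exact/measurable_EFinP|by move=> x; rewrite lee_fin].
apply: eq_integral => x _; rewrite /fubini_F /=.
rewrite ge0_int_sum_law//; last first.
  by apply: measurableT_comp => //; exact: measurable_funD.
by apply: eq_integral => y _; rewrite tsum_cons.
Qed.

Lemma ge0_int_sum_law0 (f : M -> R) : measurable_fun setT f ->
  (forall x, 0 <= f x) -> (\int[sum_law 0]_s (f s)%:E = (f 0)%:E)%E.
Proof.
move=> mf f0; rewrite ge0_int_sum_law//= integral_dirac//; last first.
  apply/measurable_EFinP; apply: measurableT_comp => //; exact: measurable_tsum.
by rewrite diracE mem_set// mul1e /tsum big_ord0.
Qed.

(** Independence: the generating function of the sum is a power, by induction
    on the number of summands. *)
Lemma sum_law_mgf n t :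
  (\int[sum_law n]_s (expR (t * (s : R)))%:E =
   (\int[P]_x (expR (t * (x : R)))%:E) ^+ n)%E.
Proof.
have me : measurable_fun setT (fun s : M => expR (t * (s : R))).
  by apply: measurableT_comp.
elim: n => [|n IH].
  by rewrite ge0_int_sum_law0// ?mulr0 ?expR0// => x; exact: expR_ge0.
rewrite ge0_int_sum_lawS//.
rewrite expeS -IH -ge0_integralZr//.
- apply: eq_integral => x _.
  under eq_integral do rewrite mulrDr expRD.
  by rewrite ge0_intZl// => [|y]; exact: expR_ge0.
- exact/measurable_EFinP.
- by apply: integral_ge0 => s _; rewrite lee_fin expR_ge0.
Qed.

Lemma measurable_tnth_tsum n (i : 'I_n) :
  measurable_fun setT (fun x : n.-tuple M => (tnth x i, tsum x)).
Proof.
apply: measurable_fun_pair; [exact: measurable_tnth|exact: measurable_tsum].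
Qed.

Lemma measurable_fst_add :
  measurable_fun setT (fun p : M * M => (p.1, (p.1 : R) + (p.2 : R)) : M * M).
Proof.
apply: measurable_fun_pair; first exact: measurable_fst.
by apply: measurable_funD; [exact: measurable_fst|exact: measurable_snd].
Qed.

Lemma ge0_int_pair0 n (F : M * M -> R) : measurable_fun setT F ->
  (forall x, 0 <= F x) ->
  (\int[product_power P n.+1]_x (F (tnth x ord0, tsum x))%:E =
   \int[P \x sum_law n]_p (F (p.1, (p.1 : R) + (p.2 : R)))%:E)%E.
Proof.
move=> mF F0.
rewrite ge0_int_power_cons//; last exact: (measurableT_comp mF (@measurable_tnth_tsum _ _)).
rewrite !ge0_int_prod//; last 2 first.
- exact: (measurableT_comp mF measurable_fst_add).
- apply: (measurableT_comp mF); apply: (measurableT_comp (@measurable_tnth_tsum _ _)).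
  exact: measurable_tuple_cons.
apply: eq_integral => x _; rewrite ge0_int_sum_law//; last first.
  apply: (measurableT_comp mF); apply: (measurableT_comp measurable_fst_add).
  exact: pair1_measurable.
by apply: eq_integral => y _; rewrite tsum_cons.
Qed.

(** Exchangeability: for each i the pair of x_i and the total has the law of
    (x, x + s) with s an independent sum of the other summands.  The product
    is built by adding coordinates in front, so the induction on n peels off
    the first coordinate and exchanges it with x_i by Tonelli. *)
Lemma ge0_int_pair n (F : M * M -> R) (i : 'I_n.+1) : measurable_fun setT F ->
  (forall x, 0 <= F x) ->
  (\int[product_power P n.+1]_x (F (tnth x i, tsum x))%:E =
   \int[P \x sum_law n]_p (F (p.1, (p.1 : R) + (p.2 : R)))%:E)%E.
Proof.
elim: n F i => [|n IH] F i mF F0; first by rewrite (ord1 i) ge0_int_pair0.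
case: (unliftP ord0 i) => [j|] ->; last exact: ge0_int_pair0.
have mF' y : measurable_fun setT (fun p : M * M => F (p.1, (y : R) + (p.2 : R))).
  apply: (measurableT_comp mF); apply: measurable_fun_pair => //.
  by apply: measurable_funD => //; exact: measurable_snd.
rewrite ge0_int_power_cons//; last exact: (measurableT_comp mF (@measurable_tnth_tsum _ _)).
rewrite ge0_int_prod//; last first.
  apply: (measurableT_comp mF); apply: (measurableT_comp (@measurable_tnth_tsum _ _)).
  exact: measurable_tuple_cons.
pose H (q : M * (M * M)) := F (q.2.1, (q.1 : R) + ((q.2.1 : R) + (q.2.2 : R))).
have m21 : measurable_fun setT (fun q : M * (M * M) => q.2.1).
  exact: (measurableT_comp measurable_fst measurable_snd).
have m22 : measurable_fun setT (fun q : M * (M * M) => q.2.2).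
  exact: (measurableT_comp measurable_snd measurable_snd).
have mH : measurable_fun setT H.
  apply: (measurableT_comp mF); apply: measurable_fun_pair => //.
  apply: (@measurable_funD _ _ _ _ (fun q : M * (M * M) => q.1 : R)) => //.
    exact: measurable_fst.
  exact: (@measurable_funD _ _ _ _ (fun q : M * (M * M) => q.2.1 : R)).
transitivity (\int[P]_y \int[P \x sum_law n]_p (H (y, p))%:E)%E.
  apply: eq_integral => y _.
  under eq_integral do rewrite /= tnthS tsum_cons.
  exact: (IH (fun p : M * M => F (p.1, (y : R) + (p.2 : R))) j (mF' y)).
have H0 q : 0 <= H q by exact: F0.
pose Q : probability (M * M)%type R := (P \x sum_law n)%E.
transitivity (\int[Q]_p \int[P]_y (H (y, p))%:E)%E.
  exact: (ge0_int_swap P Q mH H0).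
rewrite /Q.
rewrite [RHS]ge0_int_prod//; last exact: (measurableT_comp mF measurable_fst_add).
have mK : measurable_fun setT (fun p : M * M => (\int[P]_y (H (y, p))%:E)%E).
  have mH' : measurable_fun setT (EFin \o H) by exact/measurable_EFinP.
  have H0' p : (0 <= (EFin \o H) p)%E by rewrite /= lee_fin; exact: F0.
  exact: (measurable_fun_fubini_tonelli_G (m1 := P) (EFin \o H) mH' H0').
rewrite fubini_tonelli1//=; last first.
  by move=> p; apply: integral_ge0 => y _; exact: F0.
apply: eq_integral => a _; rewrite /fubini_F /=.
rewrite ge0_int_sum_lawS//; last exact: (measurableT_comp (mF' a) (pair1_measurable a)).
have mFa : measurable_fun setT (fun q : M * M => F (a, (a : R) + ((q.1 : R) + (q.2 : R)))).
  apply: (measurableT_comp mF); apply: measurable_fun_pair => //.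
  apply: (@measurable_funD _ _ _ _ (fun=> a : R)) => //.
  by apply: measurable_funD; [exact: measurable_fst|exact: measurable_snd].
apply: (etrans _ (esym (ge0_int_swap P (sum_law n) mFa (fun=> F0 _)))).
apply: eq_integral => s' _; apply: eq_integral => y _.
by rewrite /H /= addrCA.
Qed.

(** Writing S as the sum of its n.+1 coordinates, each of them contributes the
    same integral by exchangeability.  This is how the factor S in a Stein
    identity is traded for a single summand. *)
Lemma sum_law_exchange n (h : M -> R) : measurable_fun setT h ->
  (P \x sum_law n)%E.-integrable setT
    (EFin \o (fun p => (p.1 : R) * h ((p.1 : R) + (p.2 : R)))) ->
  (sum_law n.+1).-integrable setT (EFin \o (fun s => (s : R) * h s)) /\
  \int[sum_law n.+1]_s ((s : R) * h s) =
  n.+1%:R * \int[(P \x sum_law n)%E]_p ((p.1 : R) * h ((p.1 : R) + (p.2 : R))).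
Proof.
move=> mh hi.
have mh2 : measurable_fun setT (fun q : M * M => (q.1 : R) * h q.2).
  apply: measurable_funM; first exact: measurable_fst.
  exact: (measurableT_comp mh measurable_snd).
pose F (q : M * M) := (q.1 : R) * h q.2.
pose Q := product_power P n.+1.
have mF : measurable_fun setT F by [].
have ip : (P \x sum_law n)%E.-integrable setT
   (EFin \o (fun p => F (p.1, (p.1 : R) + (p.2 : R)))) by [].
have iF i : Q.-integrable setT (EFin \o (fun x => F (tnth x i, tsum x))).
  apply/integrableP; split.
    apply/measurable_EFinP; exact: (measurableT_comp mF (@measurable_tnth_tsum _ _)).
  move/integrableP : ip => [_]; apply: le_lt_trans.
  rewrite (ge0_int_pair (F := fun q => `|F q|) i)//; exact: measurableT_comp.
(* the exchange identity for nonnegative F is applied to F + |F| and |F| *)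
have FE (r : R) : r = (r + `|r|) - `|r| by rewrite addrK.
have F0 (r : R) : 0 <= r + `|r| by rewrite addrC -lerBlDr sub0r ler_normr lexx orbT.
have eF i : \int[Q]_x (F (tnth x i, tsum x)) =
   \int[(P \x sum_law n)%E]_p (F (p.1, (p.1 : R) + (p.2 : R))).
  have mabs : measurable_fun setT (fun q => `|F q|) by exact: measurableT_comp.
  have mD : measurable_fun setT (fun q => F q + `|F q|) by exact: measurable_funD.
  have iF' := integrable_norm (iF i).
  have ip' := integrable_norm ip.
  have E1 : \int[Q]_x (F (tnth x i, tsum x)) =
      \int[Q]_x ((F (tnth x i, tsum x) + `|F (tnth x i, tsum x)|) - `|F (tnth x i, tsum x)|).
    by apply: eq_Rint => x; rewrite -FE.
  have E2 : \int[(P \x sum_law n)%E]_p (F (p.1, (p.1 : R) + (p.2 : R))) =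
      \int[(P \x sum_law n)%E]_p ((F (p.1, (p.1 : R) + (p.2 : R)) +
        `|F (p.1, (p.1 : R) + (p.2 : R))|) - `|F (p.1, (p.1 : R) + (p.2 : R))|).
    by apply: eq_Rint => x; rewrite -FE.
  rewrite E1 E2.
  rewrite !RintegralB//; last 2 first.
  - by have := integrableD measurableT ip ip'; apply: eq_integrable.
  - by have := integrableD measurableT (iF i) iF'; apply: eq_integrable.
  congr (_ - _); rewrite /Rintegral; congr fine.
  - exact: (ge0_int_pair i mD).
  - exact: (ge0_int_pair i mabs).
have sE x : (tsum x : R) * h (tsum x) = \sum_(i < n.+1) F (tnth x i, tsum x :> M).
  by rewrite /F /= -mulr_suml.
have mts := @measurable_tsum n.+1.
have mf : measurable_fun setT (fun s : M => (s : R) * h s) by exact: measurable_funM.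
have iS : Q.-integrable setT (EFin \o (fun x => (tsum x : R) * h (tsum x))).
  have := @integrable_sum _ _ _ Q setT measurableT _ (index_enum 'I_n.+1) xpredT
    (fun i x => (F (tnth x i, tsum x))%:E) (fun i _ => iF i).
  by apply: eq_integrable => // x _ /=; rewrite sE sumEFin.
split.
  apply: integrable_pushforward => //; exact/measurable_EFinP.
apply: EFin_inj; rewrite EFinM /Rintegral.
rewrite /sum_law integral_distribution//; last exact/measurable_EFinP.
rewrite fineK; last exact: integrable_fin_num.
rewrite (eq_integral (fun x => \sum_(i < n.+1) (F (tnth x i, tsum x))%:E))%E; last first.
  by move=> x _ /=; rewrite sE sumEFin.
rewrite integral_sum//.
under eq_bigr do rewrite -EFin_Rint// eF.
by rewrite sumEFin sumr_const card_ord -EFinM mulr_natl.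
Qed.

End sum_law.

(** * Reduction of the Curie-Weiss law to the independent sum *)
Section cw_reduction.
Context (R : realType).
Local Notation M := (measurableTypeR R).

(** A distribution function determines its law: the Lebesgue-Stieltjes measure
    of L and the law of xi agree on half-open intervals, hence everywhere.  It
    turns the hypothesis on E exp(t xi) into one on the measure dL. *)
Lemma mgf_dmeas d (T : measurableType d) (P : probability T R)
    (L : distribution_function R) (xi : {RV P >-> R}) t :
  (forall x, cdf xi x = (L x)%:E) ->
  (\int[dmeas L]_x (expR (t * (x : R)))%:E = 'E_P[fun w => expR (t * xi w)])%E.
Proof.
move=> cL; rewrite unlock.
have mxi : measurable_fun setT (xi : T -> M) by exact: (measurable_funPT xi).
pose X : {mfun T >-> M} := HB.pack (xi : T -> M) (isMeasurableFun.Build _ _ _ _ _ mxi).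
have H : forall I : set R, ocitv I -> lebesgue_stieltjes_measure L I = distribution P X I.
  move=> I [[a b]]/= _ <-.
  rewrite /lebesgue_stieltjes_measure /measure_extension/=.
  rewrite measurable_mu_extE/=; last exact: is_ocitv.
  have [ab | ba] := leP a b; last first.
    by rewrite set_itv_ge ?wlength0 ?measure0// bnd_simp -leNgt ltW.
  rewrite wlength_itv_bnd// EFinB -!cL /cdf.
  have -> : `]a, b]%classic = `]-oo, b] `\` `]-oo, a] :> set R.
    by rewrite -[RHS]setCK setCD setCitvl setUC -[LHS]setCK setCitv.
  rewrite [RHS]measureD//= ?setIidr//; first exact: subset_itvl.
  by rewrite -ge0_fin_numE// fin_num_measure.
have HA := lebesgue_stieltjes_measure_unique H.
rewrite (@eq_measure_integral _ _ _ _ (distribution P X)); last first.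
  by move=> A mA _; exact: HA.
rewrite ge0_integral_distribution//.
by apply/measurable_EFinP/measurableT_comp.
Qed.

(** The Curie-Weiss weight depends on the sample only through its sum, so the
    law of S_n has the density exp(beta s^2 / 2n), up to a constant, with
    respect to the law of the independent sum. *)
Lemma cw_law_sum (L : distribution_function R) n beta d (T : measurableType d)
    (P : probability T R) (X : 'I_n -> {RV P >-> R}) :
  has_cw_law L beta X ->
  forall B : set M, measurable B ->
  (P [set w | B (\sum_(i < n) X i w)%R] =
   (fine (\int[sum_law (dmeas L) n]_s
     (expR (beta * (s : R) ^+ 2 / (2 * n%:R)))%:E))^-1%:E *
   \int[sum_law (dmeas L) n]_s
     (expR (beta * (s : R) ^+ 2 / (2 * n%:R)) * \1_B s)%:E)%E.
Proof.
move=> hX B mB.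
have mw : measurable_fun setT (fun s : M => expR (beta * (s : R) ^+ 2 / (2 * n%:R))).
  apply: measurableT_comp => //; apply: measurable_funM => //.
  apply: measurable_funM => //; exact: measurable_funX.
have := hX (@tsum R n @^-1` B) (measurable_funPTI [the {mfun _ >-> _} of @tsum R n] mB).
have E w : tsum [tuple X i w : M | i < n] = \sum_(i < n) X i w.
  by apply: eq_bigr => i _; rewrite tnth_mktuple.
have -> : [set w | (@tsum R n @^-1` B) [tuple X i w  | i < n]] =
   [set w | B (\sum_(i < n) X i w)%R].
  by apply/seteqP; split => w /=; rewrite E.
move=> ->; rewrite /cw_measure /cw_norm.
rewrite !ge0_int_sum_law//; last first.
  by apply: measurable_funM.
congr (_ * _)%E.
rewrite [LHS]integral_mkcond; apply: eq_integral => x _.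
rewrite patchE /= indicE /cw_weight -/(tsum x).
case: ifPn => xB.
  by rewrite mem_set ?mulr1//; move: xB; rewrite inE.
by rewrite memNset ?mulr0// => ?; move/negP : xB; rewrite inE.
Qed.

End cw_reduction.

(** * Gaussian integrals and subgaussian laws *)
Section gauss.
Context (R : realType).
Local Notation M := (measurableTypeR R).
Local Notation leb := (@lebesgue_measure R).

Definition gnorm (A : R) : R := Num.sqrt (2 * pi / A).

Lemma gnorm_gt0 A : 0 < A -> 0 < gnorm A.
Proof. by move=> A0; rewrite sqrtr_gt0 divr_gt0// mulr_gt0// pi_gt0. Qed.

(** Completing the square.  Read from right to left this is the
    Hubbard-Stratonovich identity: the exponential of a square is a Gaussian
    mixture of exponentials of linear functions. *)
Lemma gauss_integral (A B : R) : 0 < A ->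
  (\int[leb]_u (expR (B * u - A * u ^+ 2 / 2))%:E =
   (gnorm A * expR (B ^+ 2 / (2 * A)))%:E)%E.
Proof.
move=> A0.
have s0 : (Num.sqrt A)^-1 != 0 by rewrite invr_eq0 gt_eqF// sqrtr_gt0.
have /= := @integral_normal_pdf R (B / A) (Num.sqrt A)^-1.
have g0 := gnorm_gt0 A0.
have pE : normal_peak (Num.sqrt A)^-1 = (gnorm A)^-1.
  rewrite /normal_peak /gnorm; congr (Num.sqrt _)^-1.
  by rewrite exprVn sqr_sqrtr ?ltW// -mulr_natl; ring.
under eq_integral do rewrite (normal_pdfE _ s0) pE /normal_fun
  exprVn (sqr_sqrtr (ltW A0)).
move=> h.
have e u : expR (B * u - A * u ^+ 2 / 2) = (gnorm A * expR (B ^+ 2 / (2 * A))) *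
    ((gnorm A)^-1 * expR (- (u - B / A) ^+ 2 / (A^-1 *+ 2))).
  rewrite mulrACA divff ?gt_eqF// mul1r -expRD; congr expR.
  rewrite -mulr_natl; field; rewrite gt_eqF//.
under eq_integral do rewrite e.
rewrite ge0_intZl; first by rewrite h mule1.
- mfun.
- by rewrite mulr_ge0 ?expR_ge0// ltW.
- by move=> x; rewrite mulr_ge0 ?expR_ge0// invr_ge0 ltW.
Qed.

Definition subgaussian (v : R) (m : probability M R) :=
  forall t, (\int[m]_x (expR (t * (x : R)))%:E <= (expR (v * t ^+ 2 / 2))%:E)%E.

(** Write exp(theta x^2 / 2) as a Gaussian mixture of exp(u x) and exchange the
    integrals: the generating function bound then leaves a Gaussian integral
    in u, finite because theta < 1/v. *)
Lemma subgaussian_sq v m (theta : R) : subgaussian v m -> 0 < theta -> theta * v < 1 ->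
  (\int[m]_x (expR (theta * (x : R) ^+ 2 / 2))%:E <=
   (Num.sqrt (1 - theta * v)^-1)%:E)%E.
Proof.
move=> sg t0 tv.
have A0 : 0 < theta^-1 by rewrite invr_gt0.
have B0 : 0 < theta^-1 - v.
  by rewrite subr_gt0 -(ltr_pM2l t0) mulfV// gt_eqF.
have g0 := gnorm_gt0 A0.
have mE : measurable_fun setT (fun p : M * M =>
    (gnorm theta^-1)^-1 * expR ((p.1 : R) * (p.2 : R) - theta^-1 * (p.2 : R) ^+ 2 / 2)).
  by mfun.
rewrite (eq_integral (fun x : M => \int[leb]_u ((gnorm theta^-1)^-1 *
   expR ((x : R) * u - theta^-1 * u ^+ 2 / 2))%:E)%E); last first.
  move=> x _; rewrite ge0_intZl//; last by rewrite invr_ge0 ltW.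
    rewrite gauss_integral// -EFinM [in RHS]mulrA mulVf ?gt_eqF// mul1r.
    by congr (expR _)%:E; field; rewrite gt_eqF.
  by mfun.
rewrite (ge0_int_swap _ _ mE); last first.
  by move=> p; rewrite mulr_ge0 ?expR_ge0// invr_ge0 ltW.
apply: (@le_trans _ _ (\int[leb]_u ((gnorm theta^-1)^-1 *
   expR (0 * u - (theta^-1 - v) * u ^+ 2 / 2))%:E)%E).
  apply: ge0_le_integral => //.
  - move=> u _; apply: integral_ge0 => x _.
    by rewrite lee_fin mulr_ge0 ?expR_ge0// invr_ge0 ltW.
  - apply: (measurable_fun_fubini_tonelli_G (m1 := m) (fun p : M * M => ((gnorm theta^-1)^-1 *
   expR ((p.1 : R) * (p.2 : R) - theta^-1 * (p.2 : R) ^+ 2 / 2))%:E)); first by mfun.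
    by move=> p; rewrite lee_fin mulr_ge0 ?expR_ge0// invr_ge0 ltW.
  - by mfun.
  - move=> u _ /=.
    rewrite (eq_integral (fun x : M => (((gnorm theta^-1)^-1 * expR (- (theta^-1 * u ^+ 2 / 2))) *
      expR (u * (x : R)))%:E)); last first.
      by move=> x _ /=; rewrite -[in RHS]mulrA -expRD; congr (_ * expR _)%:E; ring.
    rewrite ge0_intZl//; last 2 first.
    + by mfun.
    + by rewrite mulr_ge0 ?expR_ge0// invr_ge0 ltW.
    apply: (@le_trans _ _ (((gnorm theta^-1)^-1 * expR (- (theta^-1 * u ^+ 2 / 2)))%:E *
       (expR (v * u ^+ 2 / 2))%:E)%E).
      by rewrite lee_pmul2l// ?lte_fin ?mulr_gt0 ?expR_gt0 ?invr_gt0.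
    rewrite -EFinM lee_fin -[leLHS]mulrA -expRD le_eqVlt; apply/orP; left; apply/eqP.
    by congr (_ * expR _); ring.
rewrite ge0_intZl//; last 2 first.
- by mfun.
- by rewrite invr_ge0 ltW.
rewrite gauss_integral// expr0n /= mul0r expR0 mulr1 -EFinM lee_fin.
have h0 : 0 <= 2 * pi / theta^-1 :> R by rewrite divr_ge0 ?mulr_ge0 ?pi_ge0// ltW.
have p0 : (pi : R) != 0 by rewrite gt_eqF// pi_gt0.
have B0' : theta^-1 - v != 0 by rewrite gt_eqF.
have t0' : theta != 0 by rewrite gt_eqF.
have tv' : 1 - theta * v != 0 by rewrite gt_eqF// subr_gt0.
rewrite /gnorm -sqrtrV// -sqrtrM ?invr_ge0// le_eqVlt; apply/orP; left; apply/eqP.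
congr (Num.sqrt _); move: (pi : R) p0 => p p0; field.
by rewrite tv' t0' p0.
Qed.

Lemma pow_le_expR (x : R) j : 0 <= x -> x ^+ j <= j`!%:R * expR x.
Proof.
move=> x0; case: j => [|j]; first by rewrite expr0 fact0 mul1r (le_trans _ (expR_ge1Dx x))// lerDl.
rewrite -ler_pdivrMl ?ltr0n ?fact_gt0// mulrC.
by apply: le_trans (expR_ge1Dxn j x0); rewrite lerDr.
Qed.

Lemma mgf_abs v m c : subgaussian v m ->
  (\int[m]_x (expR (c * `|x : R|))%:E <= (2 * expR (v * c ^+ 2 / 2))%:E)%E.
Proof.
move=> sg.
apply: (@le_trans _ _ (\int[m]_x (expR (c * (x : R)) + expR (- c * (x : R)))%:E)%E).
  apply: ge0_le_int; [by mfun|by mfun|by move=> x; exact: expR_ge0|].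
  move=> x; case: (ger0P (x : R)) => _; first by rewrite lerDl expR_ge0.
  by rewrite mulrN mulNr lerDr expR_ge0.
under eq_integral do rewrite EFinD.
rewrite ge0_integralD//; [|by mfun|by mfun].
rewrite [X in (_ <= X%:E)%E](_ : _ = expR (v * c ^+ 2 / 2) + expR (v * (- c) ^+ 2 / 2)).
  by rewrite EFinD leeD// sg.
by rewrite sqrrN; ring.
Qed.

Lemma moment_expR v m c j : 0 <= c -> subgaussian v m ->
  (\int[m]_x (`|x : R| ^+ j * expR (c * `|x : R|))%:E <=
   (j`!%:R * (2 * expR (v * (c + 1) ^+ 2 / 2)))%:E)%E.
Proof.
move=> c0 sg.
apply: (@le_trans _ _ (\int[m]_x (j`!%:R * expR ((c + 1) * `|x : R|))%:E)%E).
  apply: ge0_le_int; [by mfun|by mfun|by move=> x; rewrite mulr_ge0 ?expR_ge0// exprn_ge0|].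
  move=> x; rewrite mulrDl mul1r expRD [expR _ * _]mulrC mulrA.
  by rewrite ler_wpM2r ?expR_ge0// pow_le_expR.
rewrite ge0_intZl//; last by mfun.
by rewrite EFinM lee_pmul2l// ?lte_fin ?ltr0n ?fact_gt0//; exact: mgf_abs.
Qed.

End gauss.

(** * Functions that are smooth on both sides of a point *)
Section piecewise.
Context (R : realType).

Lemma mean_value_bound (f df : R -> R) (a b B : R) :
  (forall x : R, is_derive (x : R) (1 : R) f (df x)) ->
  (forall x, Num.min a b <= x <= Num.max a b -> `|df x| <= B) ->
  `|f b - f a| <= B * `|b - a|.
Proof.
move=> fd dB.
have cf (x y : R) : {within `[x, y], continuous f}.
  apply: derivable_within_continuous => u _; exact: ex_derive.
have [ab|ba] := leP a b.
  have [c cab ->] := MVT_segment ab (fun x _ => fd x) (cf _ _).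
  rewrite normrM ler_wpM2r//; apply: dB.
  by rewrite (min_idPl ab) (max_idPr ab); move: cab; rewrite in_itv.
rewrite distrC [`|b - a|]distrC.
have [c cab ->] := MVT_segment (ltW ba) (fun x _ => fd x) (cf _ _).
rewrite normrM ler_wpM2r//; apply: dB.
by rewrite (min_idPr (ltW ba)) (max_idPl (ltW ba)); move: cab; rewrite in_itv.
Qed.

(* The function is g1 up to z and g2 after z, with first derivatives q1, q2 and
   second derivatives d1, d2; the two branches meet at z but their derivatives
   need not. *)
Variables (z K : R) (e : R -> R) (g1 g2 q1 q2 d1 d2 : R -> R).
Hypothesis K0 : 0 <= K.
Hypothesis e_nd : forall x y, 0 <= x -> x <= y -> 0 <= e x <= e y.
Hypothesis dg1 : forall x : R, is_derive (x : R) (1 : R) g1 (q1 x).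
Hypothesis dg2 : forall x : R, is_derive (x : R) (1 : R) g2 (q2 x).
Hypothesis dq1 : forall x : R, is_derive (x : R) (1 : R) q1 (d1 x).
Hypothesis dq2 : forall x : R, is_derive (x : R) (1 : R) q2 (d2 x).
Hypothesis bq1 : forall x, x <= z -> `|q1 x| <= K * e `|x|.
Hypothesis bq2 : forall x, z <= x -> `|q2 x| <= K * e `|x|.
Hypothesis bd1 : forall x, x <= z -> `|d1 x| <= K * e `|x|.
Hypothesis bd2 : forall x, z <= x -> `|d2 x| <= K * e `|x|.
Hypothesis gz : g1 z = g2 z.

Let G w := if w <= z then g1 w else g2 w.
Let q w := if w <= z then q1 w else q2 w.

Let between (y r x : R) : Num.min y (y + r) <= x <= Num.max y (y + r) ->
  `|x| <= `|y| + `|r| /\ `|x - y| <= `|r|.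
Proof.
move=> /andP[]; rewrite ge_min le_max => /orP h1 /orP h2.
have : `|x - y| <= `|r|.
  have [r0|r0] := ger0P r; rewrite ler_norml; apply/andP; split;
  case: h1 => h1; case: h2 => h2; lra.
move=> h; split=> //; rewrite -[x in `|x|](subrK y) addrC.
by rewrite (le_trans (ler_normD _ _))// lerD2l.
Qed.

Let eB (y r x : R) : Num.min y (y + r) <= x <= Num.max y (y + r) ->
  K * e `|x| <= K * e (`|y| + `|r|).
Proof.
by move=> /between[h _]; rewrite ler_wpM2l//; have /andP[] := e_nd (normr_ge0 x) h.
Qed.

Let side (g qq dd : R -> R) (y r : R) :
  (forall x : R, is_derive (x : R) (1 : R) g (qq x)) -> (forall x : R, is_derive (x : R) (1 : R) qq (dd x)) ->
  (forall x, Num.min y (y + r) <= x <= Num.max y (y + r) -> `|dd x| <= K * e `|x|) ->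
  `|qq (y + r) - qq y| <= K * e (`|y| + `|r|) * `|r| /\
  `|g (y + r) - g y - r * qq y| <= K * e (`|y| + `|r|) * `|r| * `|r|.
Proof.
move=> dg dq bd.
have H x : Num.min y (y + r) <= x <= Num.max y (y + r) ->
    `|qq x - qq y| <= K * e (`|y| + `|r|) * `|x - y|.
  move=> hx; apply: (mean_value_bound dq) => u hu.
  have hu' : Num.min y (y + r) <= u <= Num.max y (y + r).
    move: hu hx => /andP[h1 h2] /andP[h3 h4]; apply/andP; split.
      by rewrite (le_trans _ h1)// le_min h3 ge_min lexx.
    by rewrite (le_trans h2)// ge_max h4 le_max lexx.
  by rewrite (le_trans (bd _ hu'))// eB.
have Hr : `|qq (y + r) - qq y| <= K * e (`|y| + `|r|) * `|r|.
  have := H (y + r); rewrite addrAC subrr add0r; apply.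
  by rewrite ge_min le_max !lexx !orbT.
split=> //.
have dh x : is_derive (x : R) (1 : R) (fun x => g x - x * qq y) (qq x - qq y).
  apply: is_derive_eq; rewrite /GRing.scale /=; ring.
have := @mean_value_bound _ _ y (y + r) (K * e (`|y| + `|r|) * `|r|) dh.
have -> : g (y + r) - (y + r) * qq y - (g y - y * qq y) = g (y + r) - g y - r * qq y by ring.
rewrite [y + r - y]addrAC subrr add0r; apply => x hx.
rewrite (le_trans (H x hx))// ler_wpM2l//; last by have [] := between hx.
by rewrite mulr_ge0//; have /andP[] := e_nd (addr_ge0 (normr_ge0 y) (normr_ge0 r)) (lexx _).
Qed.

(** Away from z this is Taylor's formula.  If the step from y crosses z, the
    jump of the derivative costs one order in r, and crossing is only possible
    when |y - z| <= |r|. *)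
Lemma piecewise_increment (y r : R) :
  `|q (y + r) - q y| <=
    2 * K * e (`|y| + `|r|) * (`|r| + (`|y - z| <= `|r|)%R%:R) /\
  `|G (y + r) - G y - r * q y| <=
    2 * K * e (`|y| + `|r|) * `|r| * (`|r| + (`|y - z| <= `|r|)%R%:R).
Proof.
set I : R := (_ <= _)%R%:R.
have I0 : 0 <= I by rewrite ler0n.
set E := e (`|y| + `|r|).
have yr0 : 0 <= `|y| + `|r| by rewrite addr_ge0.
have E0 : 0 <= E by have /andP[] := e_nd yr0 (lexx _).
have KE0 : 0 <= K * E by rewrite mulr_ge0.
have fin1 (a : R) : `|a| <= K * E * `|r| -> `|a| <= 2 * K * E * (`|r| + I).
  move=> /le_trans; apply; rewrite -mulrA -[2 * K * E]mulrA.
  rewrite [2 * (K * E)]mulrC -[K * E * 2 * _]mulrA [K * (E * _)]mulrA ler_wpM2l//.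
  by have := normr_ge0 r; lra.
have fin2 (a : R) : `|a| <= K * E * `|r| * `|r| -> `|a| <= 2 * K * E * `|r| * (`|r| + I).
  move=> /le_trans; apply.
  have -> : 2 * K * E * `|r| = 2 * (K * E * `|r|) by ring.
  have : 0 <= K * E * `|r| by rewrite mulr_ge0.
  move: (K * E * `|r|) (normr_ge0 r) => c; nra.
rewrite /q /G; have [yz|yz] := leP y z; have [yrz|yrz] := leP (y + r) z.
- have [h1 h2] : `|q1 (y + r) - q1 y| <= K * E * `|r| /\
      `|g1 (y + r) - g1 y - r * q1 y| <= K * E * `|r| * `|r|.
    apply: (side dg1 dq1) => x /andP[_]; rewrite le_max => /orP hx; apply: bd1.
    by case: hx => hx; lra.
  by split; [exact: fin1 | exact: fin2].
- have I1 : I = 1.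
    rewrite /I (_ : (_ <= _) = true)//; apply/idP.
    have -> : `|y - z| = - (y - z) by rewrite ler0_norm// subr_le0.
    rewrite ger0_norm; lra.
  have r0 : 0 <= r by lra.
  have hx x : y <= x -> x <= y + r -> `|x| <= `|y| + `|r|.
    move=> h1 h2; apply: (proj1 (@between y r x _)).
    by rewrite ge_min le_max h1 h2 orbT.
  have b1 x : y <= x -> x <= z -> `|q1 x| <= K * E.
    move=> h1 h2; rewrite (le_trans (bq1 h2))// ler_wpM2l//.
    by have /andP[] := e_nd (normr_ge0 x) (hx x h1 (le_trans h2 (ltW yrz))).
  have b2 x : z <= x -> x <= y + r -> `|q2 x| <= K * E.
    move=> h1 h2; rewrite (le_trans (bq2 h1))// ler_wpM2l//.
    by have /andP[] := e_nd (normr_ge0 x) (hx x (le_trans yz h1) h2).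
  have m1 : `|g1 z - g1 y| <= K * E * `|z - y|.
    by apply: (mean_value_bound dg1) => x; rewrite (min_idPl yz) (max_idPr yz) => /andP[]; exact: b1.
  have m2 : `|g2 (y + r) - g2 z| <= K * E * `|y + r - z|.
    apply: (mean_value_bound dg2) => x.
    by rewrite (min_idPl (ltW yrz)) (max_idPr (ltW yrz)) => /andP[]; exact: b2.
  have c1 := b1 y (lexx y) yz.
  have c2 := b2 (y + r) (ltW yrz) (lexx _).
  rewrite I1; split.
    apply: (le_trans (ler_normB _ _)).
    have : 0 <= K * E * `|r| by rewrite mulr_ge0.
    by lra.
  rewrite (_ : _ - _ = (g2 (y + r) - g2 z) + (g1 z - g1 y) - r * q1 y); last by rewrite gz; ring.
  apply: (le_trans (ler_normB _ _)).
  have : `|r * q1 y| <= K * E * r by rewrite normrM (ger0_norm r0) mulrC ler_wpM2r.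
  have := ler_normD (g2 (y + r) - g2 z) (g1 z - g1 y).
  rewrite (ger0_norm r0).
  have e1 : `|z - y| = z - y by rewrite ger0_norm// subr_ge0.
  have e2 : `|y + r - z| = y + r - z by rewrite ger0_norm// subr_ge0; exact: ltW.
  move: m1 m2; rewrite e1 e2.
  have : 0 <= K * E * r * r by rewrite !mulr_ge0.
  lra.
- have I1 : I = 1.
    rewrite /I (_ : (_ <= _) = true)//; apply/idP.
    have -> : `|y - z| = y - z by rewrite ger0_norm// subr_ge0; exact: ltW.
    rewrite ler0_norm; lra.
  have r0 : r <= 0 by lra.
  have hx x : y + r <= x -> x <= y -> `|x| <= `|y| + `|r|.
    move=> h1 h2; apply: (proj1 (@between y r x _)).
    by rewrite ge_min le_max h1 h2 orbT.
  have b1 x : y + r <= x -> x <= z -> `|q1 x| <= K * E.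
    move=> h1 h2; rewrite (le_trans (bq1 h2))// ler_wpM2l//.
    by have /andP[] := e_nd (normr_ge0 x) (hx x h1 (le_trans h2 (ltW yz))).
  have b2 x : z <= x -> x <= y -> `|q2 x| <= K * E.
    move=> h1 h2; rewrite (le_trans (bq2 h1))// ler_wpM2l//.
    by have /andP[] := e_nd (normr_ge0 x) (hx x (le_trans yrz h1) h2).
  have m1 : `|g1 (y + r) - g1 z| <= K * E * `|y + r - z|.
    by apply: (mean_value_bound dg1) => x; rewrite (min_idPr yrz) (max_idPl yrz) => /andP[]; exact: b1.
  have m2 : `|g2 z - g2 y| <= K * E * `|z - y|.
    apply: (mean_value_bound dg2) => x.
    by rewrite (min_idPr (ltW yz)) (max_idPl (ltW yz)) => /andP[]; exact: b2.
  have c1 := b1 (y + r) (lexx _) yrz.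
  have c2 := b2 y (ltW yz) (lexx _).
  rewrite I1; split.
    apply: (le_trans (ler_normB _ _)).
    have : 0 <= K * E * `|r| by rewrite mulr_ge0.
    by lra.
  rewrite (_ : _ - _ = (g1 (y + r) - g1 z) + (g2 z - g2 y) - r * q2 y); last by rewrite gz; ring.
  apply: (le_trans (ler_normB _ _)).
  have : `|r * q2 y| <= K * E * - r by rewrite normrM (ler0_norm r0) mulrC ler_wpM2r// oppr_ge0.
  have := ler_normD (g1 (y + r) - g1 z) (g2 z - g2 y).
  rewrite (ler0_norm r0).
  have e1 : `|z - y| = - (z - y) by rewrite ler0_norm// subr_le0; exact: ltW.
  have e2 : `|y + r - z| = - (y + r - z) by rewrite ler0_norm// subr_le0.
  move: m1 m2; rewrite e1 e2.
  have : 0 <= K * E * r * r by rewrite -mulrA mulr_ge0// -expr2 sqr_ge0.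
  lra.
- have [h1 h2] : `|q2 (y + r) - q2 y| <= K * E * `|r| /\
      `|g2 (y + r) - g2 y - r * q2 y| <= K * E * `|r| * `|r|.
    apply: (side dg2 dq2) => x /andP[]; rewrite ge_min => /orP hx _; apply: bd2.
    by case: hx => hx; lra.
  by split; [exact: fin1 | exact: fin2].
Qed.
End piecewise.

(** * Normal tails *)
Section normal_tail.
Context (R : realType) (gam : R).
Hypothesis gam0 : 0 < gam.
Local Notation leb := (@lebesgue_measure R).

Definition ndens (x : R) : R := (gnorm gam)^-1 * expR (- (gam * x ^+ 2 / 2)).

Definition ncdf (z : R) : R := \int[leb]_(x in `]-oo, z]) ndens x.

Let g0 : 0 < gnorm gam. Proof. exact: gnorm_gt0. Qed.

Lemma ndens_ge0 x : 0 <= ndens x.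
Proof. by rewrite mulr_ge0 ?expR_ge0// invr_ge0 ltW. Qed.

Lemma measurable_ndens : measurable_fun setT ndens.
Proof. by rewrite /ndens; mfun. Qed.

Lemma ereal_integral_ndens : (\int[leb]_x (ndens x)%:E = 1)%E.
Proof.
rewrite /ndens ge0_intZl//; [|by mfun|by rewrite invr_ge0 ltW].
rewrite (eq_integral (fun x : measurableTypeR R => (expR (0 * (x : R) - gam * (x : R) ^+ 2 / 2))%:E)); last first.
  by move=> x _; rewrite mul0r sub0r.
rewrite gauss_integral// expr0n /= mul0r expR0 mulr1 -EFinM mulVf// gt_eqF//.
Qed.

Lemma integrable_ndens : leb.-integrable setT (EFin \o ndens).
Proof.
apply/integrableP; split.
  by apply/measurable_EFinP; exact: measurable_ndens.
under eq_integral do rewrite /= ger0_norm ?ndens_ge0//.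
by rewrite ereal_integral_ndens ltry.
Qed.

Lemma integrable_ndens_sub (A : set R) : measurable A ->
  leb.-integrable A (EFin \o ndens).
Proof. by move=> mA; apply: integrableS integrable_ndens. Qed.

Lemma is_derive_expR_sq (c x : R) :
  is_derive (x : R) (1 : R) (fun w => expR (c * w ^+ 2 / 2)) (c * x * expR (c * x ^+ 2 / 2)).
Proof.
by apply: is_derive_eq; rewrite /GRing.scale /=; field.
Qed.

Lemma continuous_ndens : continuous ndens.
Proof.
move=> x; apply: differentiable_continuous; apply/derivable1_diffP.
apply: ex_derive.
Qed.

Lemma is_derive_ncdf (z : R) : is_derive (z : R) (1 : R) ncdf (ndens z).
Proof.
have [||//||d e] := @continuous_FTC1 R ndens -oo%O z (z + 1).
- by rewrite ltrDl.
- exact: integrable_ndens_sub.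
- first [exact: isT | by rewrite bnd_simp | by rewrite ltNyr | by rewrite ltEereal].
- exact: continuous_ndens.
apply: DeriveDef; first exact: d.
by rewrite -e derive1E.
Qed.

Definition ntail (z : R) : R := \int[leb]_(x in `]z, +oo[) ndens x.

Lemma ntailE z : ntail z = 1 - ncdf z.
Proof.
have h : leb.-integrable `]-oo, +oo[ (EFin \o ndens) by exact: integrable_ndens_sub.
have -> : ntail z = _ := esym (@Rintegral_itvB R ndens -oo%O +oo%O z h isT isT).
by rewrite set_itvNyy /ncdf; congr (_ - _); rewrite /Rintegral ereal_integral_ndens.
Qed.

Lemma ncdf_ge0 z : 0 <= ncdf z.
Proof. by apply: Rintegral_ge0 => x _; exact: ndens_ge0. Qed.

Lemma ncdf_le1 z : ncdf z <= 1.
Proof.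
rewrite -subr_ge0 -ntailE; apply: Rintegral_ge0 => x _; exact: ndens_ge0.
Qed.

Lemma ncdfN z : ncdf (- z) = 1 - ncdf z.
Proof.
rewrite -ntailE /ncdf /ntail Rintegral_itv_obnd_cbnd; last exact: integrable_ndens_sub.
rewrite /Rintegral ge0_integration_by_substitutionNy; last 2 first.
- apply: continuous_subspaceT; exact: continuous_ndens.
- by move=> x _; exact: ndens_ge0.
by congr fine; apply: eq_integral => x _; rewrite /= /ndens sqrrN.
Qed.

(** On x > z the square x^2 exceeds z^2 + (x - z)^2, which compares the tail
    with a whole Gaussian integral centred at z. *)
Lemma ntail_le (z : R) : 0 <= z -> ntail z <= expR (- (gam * z ^+ 2 / 2)).
Proof.
move=> z0.
pose h x := expR (- (gam * z ^+ 2)) * ((gnorm gam)^-1 * expR (gam * z * x - gam * x ^+ 2 / 2)).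
have h0 x : 0 <= h x by rewrite !mulr_ge0 ?expR_ge0// invr_ge0 ltW.
have mh : measurable_fun setT h by rewrite /h; mfun.
rewrite -lee_fin /ntail fineK; last first.
  by apply: integrable_fin_num => //; exact: integrable_ndens_sub.
apply: (@le_trans _ _ (\int[leb]_(x in `]z, +oo[) (h x)%:E)%E).
  apply: ge0_le_integral => //.
  - by move=> x _; rewrite lee_fin ndens_ge0.
  - by apply: measurable_funTS; apply/measurable_EFinP; exact: measurable_ndens.
  - by apply: measurable_funTS; apply/measurable_EFinP.
  - move=> x; rewrite /= in_itv /= andbT => zx; rewrite lee_fin /h /ndens [leRHS]mulrCA.
    rewrite ler_wpM2l ?invr_ge0 ?(ltW g0)// -expRD ler_expR.
    suff : 0 <= gam * z * (x - z) by lra.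
    by rewrite !mulr_ge0 ?(ltW gam0)// subr_ge0 ltW.
apply: (@le_trans _ _ (\int[leb]_x (h x)%:E)%E).
  apply: ge0_subset_integral => //; first by apply/measurable_EFinP.
  by move=> x _; rewrite lee_fin.
rewrite /h ge0_intZl//; [|by mfun|by move=> x; rewrite mulr_ge0 ?expR_ge0// invr_ge0 ltW].
rewrite ge0_intZl//; [|by mfun|by rewrite invr_ge0 ltW].
rewrite gauss_integral// -!EFinM lee_fin [(gnorm gam)^-1 * _]mulrA mulVf ?gt_eqF// mul1r.
rewrite -expRD ler_expR le_eqVlt; apply/orP; left; apply/eqP.
by field; rewrite gt_eqF.
Qed.

Lemma cvg_ndens : ndens x @[x --> +oo%R] --> (0 : R).
Proof.
rewrite -(mulr0 (gnorm gam)^-1); apply: cvgMr.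
apply: (cvg_comp (fun x : R => gam * x ^+ 2 / 2) (fun x => expR (- x))); last exact: cvgr_expR.
have h : (gam / 2 * x ^+ 2) @[x --> +oo%R] --> +oo%R.
  by apply: gt0_cvgMry; [rewrite divr_gt0|exact: cvgr_expr2].
by move: h; under eq_fun do rewrite mulrAC.
Qed.

(** Mills' bound: z times the tail is at most the integral of x times the
    density, which has an explicit primitive. *)
Lemma ntail_mul_le (z : R) : 0 <= z ->
  z * ntail z <= (gam * gnorm gam)^-1 * expR (- (gam * z ^+ 2 / 2)).
Proof.
move=> z0.
have dF x : is_derive (x : R) (1 : R) (fun x => - gam^-1 * ndens x) (x * ndens x).
  rewrite /ndens; apply: is_derive_eq; rewrite /GRing.scale /=; field.
  by rewrite !gt_eqF.
have cf : continuous (fun x : R => x * ndens x).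
  move=> x; apply: differentiable_continuous; apply/derivable1_diffP.
  exact: ex_derive.
have cF : continuous (fun x : R => - gam^-1 * ndens x).
  move=> x; apply: differentiable_continuous; apply/derivable1_diffP.
  exact: ex_derive.
have E : \int[leb]_(x in `[z, +oo[) (x * ndens x) = 0 - (- gam^-1 * ndens z).
  apply: (@Rintegral_ge0_continuous_FTC2y R (fun x => x * ndens x)
    (fun x => - gam^-1 * ndens x) z 0).
  - by move=> x zx; rewrite mulr_ge0 ?ndens_ge0// (le_trans z0).
  - exact: continuous_subspaceT.
  - rewrite -(mulr0 (- gam^-1)); apply: cvgMr; exact: cvg_ndens.
  - by move=> x _; exact: ex_derive.
  - by apply: cvg_at_right_filter; exact: cF.
  - by move=> x _; rewrite derive1E derive_val.
have -> : (gam * gnorm gam)^-1 * expR (- (gam * z ^+ 2 / 2)) = 0 - (- gam^-1 * ndens z).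
  by rewrite /ndens invfM; ring.
rewrite -E.
have ix : leb.-integrable `[z, +oo[ (EFin \o (fun x => x * ndens x)).
  apply/integrableP; split.
    apply: measurable_funTS; apply/measurable_EFinP; apply: continuous_measurable_fun.
    exact: cf.
  rewrite (eq_integral (fun x : measurableTypeR R => ((x : R) * ndens x)%:E)); last first.
    move=> x; rewrite inE /= in_itv /= andbT => zx; rewrite ger0_norm//.
    by rewrite mulr_ge0 ?ndens_ge0// (le_trans z0).
  rewrite (@ge0_continuous_FTC2y R (fun x => x * ndens x)
    (fun x => - gam^-1 * ndens x) z 0); first by rewrite -EFinB ltry.
  - by move=> x zx; rewrite mulr_ge0 ?ndens_ge0// (le_trans z0).
  - exact: continuous_subspaceT.
  - rewrite -(mulr0 (- gam^-1)); apply: cvgMr; exact: cvg_ndens.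
  - by move=> x _; exact: ex_derive.
  - by apply: cvg_at_right_filter; exact: cF.
  - by move=> x _; rewrite derive1E derive_val.
rewrite /ntail Rintegral_itv_obnd_cbnd; last exact: integrable_ndens_sub.
rewrite -RintegralZl//; last exact: integrable_ndens_sub.
apply: le_Rintegral => //.
- apply: (@integrableZl _ _ _ leb `[z, +oo[%classic _ z (EFin \o ndens)) => //.
  exact: integrable_ndens_sub.
- move=> x; rewrite /= in_itv /= andbT => zx.
  by rewrite ler_wpM2r ?ndens_ge0.
Qed.

Definition tailc : R := 1 + (gam * gnorm gam)^-1.

Lemma tailc_ge1 : 1 <= tailc.
Proof. by rewrite lerDl invr_ge0 mulr_ge0// ltW. Qed.

Lemma ntail_weighted (z : R) : 0 <= z ->
  (1 + z) * (1 - ncdf z) <= tailc * expR (- (gam * z ^+ 2 / 2)).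
Proof.
move=> z0; rewrite -ntailE mulrDl mul1r [tailc * _]mulrDl mul1r lerD//.
  exact: ntail_le.
exact: ntail_mul_le.
Qed.

Lemma normal_probE (z : R) :
  normal_prob 0 (Num.sqrt (1 / gam)) `]-oo, z]%classic = (ncdf z)%:E.
Proof.
have s0 : Num.sqrt (1 / gam) != 0 by rewrite gt_eqF// sqrtr_gt0 divr_gt0.
rewrite /normal_prob /ncdf /Rintegral fineK; last first.
  by apply: integrable_fin_num => //; exact: integrable_ndens_sub.
apply: eq_integral => x _; rewrite (normal_pdfE _ s0) /normal_fun /normal_peak /ndens /gnorm.
have e : Num.sqrt (1 / gam) ^+ 2 = gam^-1 by rewrite sqr_sqrtr ?div1r// invr_ge0 ltW.
rewrite e subr0; congr (_ * expR _)%:E.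
  by congr (Num.sqrt _)^-1; rewrite -mulr_natl; ring.
by rewrite -mulr_natl invfM invrK; field.
Qed.

End normal_tail.

(** * Stein's equation for the weighted score *)
Section stein_solution.
Context (R : realType) (gam : R).
Hypotheses (gam0 : 0 < gam) (gam1 : gam < 1).
Local Notation F := (ncdf gam).
Local Notation gn := (gnorm gam).
Local Notation kap := (tailc gam).
Local Notation beta := (1 - gam).

(** The Curie-Weiss weight as a function of w = s / sqrt n. *)
Definition cw_psi (w : R) : R := expR (beta * w ^+ 2 / 2).

(** The bounded solution of Stein's equation for the normal law of variance
    1/gam is explicit on each side of z.  Multiplied by the weight cw_psi it
    becomes stein_g, which solves g' - w g = cw_psi (1_{w <= z} - F z) away
    from z: the drift is that of the standard normal law, to which the sum of
    independent variables is compared.  The functions with q and d in their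
    names are first and second derivatives of the two branches. *)
Definition stein_l (z w : R) : R := gn * expR (w ^+ 2 / 2) * F w * (1 - F z).
Definition stein_r (z w : R) : R := gn * expR (w ^+ 2 / 2) * (1 - F w) * F z.
Definition stein_ql (z w : R) : R := w * stein_l z w + cw_psi w * (1 - F z).
Definition stein_qr (z w : R) : R := w * stein_r z w - cw_psi w * F z.
Definition stein_dl (z w : R) : R :=
  stein_l z w + w * stein_ql z w + beta * w * cw_psi w * (1 - F z).
Definition stein_dr (z w : R) : R :=
  stein_r z w + w * stein_qr z w - beta * w * cw_psi w * F z.

Definition stein_g (z w : R) : R := if w <= z then stein_l z w else stein_r z w.
Definition stein_q (z w : R) : R := if w <= z then stein_ql z w else stein_qr z w.

Let gn0 : 0 < gn. Proof. exact: gnorm_gt0. Qed.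
Let kap1 : 1 <= kap. Proof. exact: tailc_ge1. Qed.
Let F0 z : 0 <= F z. Proof. exact: ncdf_ge0. Qed.
Let F1 z : 0 <= 1 - F z. Proof. by rewrite subr_ge0 ncdf_le1. Qed.
Let psi0 w : 0 <= cw_psi w. Proof. exact: expR_ge0. Qed.
Let beta0 : 0 < beta. Proof. by rewrite subr_gt0. Qed.

Lemma psiE w : cw_psi w = gn * expR (w ^+ 2 / 2) * ndens gam w.
Proof.
rewrite /ndens /cw_psi mulrACA mulfV ?gt_eqF// mul1r -expRD; congr expR; ring.
Qed.

Lemma stein_qE z w :
  stein_q z w - w * stein_g z w = cw_psi w * ((w <= z)%R%:R - F z).
Proof.
rewrite /stein_q /stein_g; by case: (leP w z) => _; rewrite /stein_ql /stein_qr /=; ring.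
Qed.

Lemma is_derive_stein_l z (w : R) :
  is_derive (w : R) (1 : R) (stein_l z) (stein_ql z w).
Proof.
have := is_derive_ncdf gam0 w => d.
rewrite /stein_l; apply: is_derive_eq; by rewrite /stein_ql /stein_l psiE /GRing.scale /=; field.
Qed.

Lemma is_derive_stein_r z (w : R) :
  is_derive (w : R) (1 : R) (stein_r z) (stein_qr z w).
Proof.
have := is_derive_ncdf gam0 w => d.
rewrite /stein_r; apply: is_derive_eq; by rewrite /stein_qr /stein_r psiE /GRing.scale /=; field.
Qed.

Lemma is_derive_cw_psi (w : R) :
  is_derive (w : R) (1 : R) cw_psi (beta * w * cw_psi w).
Proof. exact: is_derive_expR_sq. Qed.

Lemma is_derive_stein_ql z (w : R) :
  is_derive (w : R) (1 : R) (stein_ql z) (stein_dl z w).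
Proof.
have d1 := is_derive_stein_l z w; have d2 := is_derive_cw_psi w.
rewrite /stein_ql; apply: is_derive_eq; rewrite /stein_dl /GRing.scale /=; ring.
Qed.

Lemma is_derive_stein_qr z (w : R) :
  is_derive (w : R) (1 : R) (stein_qr z) (stein_dr z w).
Proof.
have d1 := is_derive_stein_r z w; have d2 := is_derive_cw_psi w.
rewrite /stein_qr; apply: is_derive_eq; rewrite /stein_dr /GRing.scale /=; ring.
Qed.

Lemma expR_split (w : R) : expR (w ^+ 2 / 2) = cw_psi w * expR (gam * w ^+ 2 / 2).
Proof. by rewrite /cw_psi -expRD; congr expR; ring. Qed.

(** The source of the factor 1/(1 + |z|): to the right of 0 the tail 1 - F z
    beats 1 + |z|, and to the left w is at least as far from 0 as z. *)
Lemma tail_weight z w : w <= z -> (1 - F z) * (1 + `|z|) <= kap * (1 + `|w|).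
Proof.
move=> wz; have [z0|z0] := leP 0 z.
  rewrite (ger0_norm z0) mulrC.
  apply: (le_trans (ntail_weighted gam0 z0)).
  have : expR (- (gam * z ^+ 2 / 2)) <= 1.
    by rewrite expR_le1 oppr_le0 divr_ge0// mulr_ge0 ?sqr_ge0 ?(ltW gam0).
  by have := normr_ge0 w; have := kap1; nra.
have hw : `|z| <= `|w| by rewrite (ltr0_norm z0) ltr0_norm; lra.
have := F0 z; have := F1 z; have := kap1; have := normr_ge0 z; nra.
Qed.

(** The growing factor exp(gam w^2 / 2) is compensated by F w when w <= 0 and
    by 1 - F z when 0 <= w <= z. *)
Lemma left_bound z w : w <= z ->
  expR (gam * w ^+ 2 / 2) * F w * (1 - F z) * (1 + `|z|) <= kap ^+ 2.
Proof.
move=> wz.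
have T t : 0 <= t -> expR (gam * t ^+ 2 / 2) * ((1 + t) * (1 - F t)) <= kap.
  move=> t0; have h := ntail_weighted gam0 t0.
  have := ler_wpM2l (expR_ge0 (gam * t ^+ 2 / 2)) h.
  by rewrite [leRHS]mulrCA expRxMexpNx_1 mulr1.
have N t : t <= 0 -> expR (gam * t ^+ 2 / 2) * F t * (1 + `|t|) <= kap.
  move=> t0; have := T (- t); rewrite oppr_ge0 => /(_ t0).
  by rewrite sqrrN ncdfN// (ler0_norm t0) subKr -[X in _ -> X <= _]mulrA [F t * _]mulrC.
have kk : kap <= kap ^+ 2 by rewrite expr2; have := kap1; nra.
have [z0|z0] := leP 0 z.
  have [w0|w0] := leP w 0.
    have h1 := N w w0; have h2 := @tail_weight z 0 z0.
    rewrite normr0 addr0 mulr1 in h2.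
    have h3 : expR (gam * w ^+ 2 / 2) * F w <= kap.
      apply: le_trans h1; rewrite ler_peMr ?lerDl// mulr_ge0 ?expR_ge0//.
    rewrite -mulrA expr2; apply: ler_pM => //.
    - by rewrite mulr_ge0 ?expR_ge0.
    - by rewrite mulr_ge0// addr_ge0.
  apply: le_trans kk; apply: le_trans (T z z0).
  rewrite (ger0_norm z0) -mulrA [(1 + z) * _]mulrC.
  apply: ler_wpM2r; first by rewrite mulr_ge0// addr_ge0.
  rewrite -[leRHS]mulr1; apply: ler_pM => //; rewrite ?expR_ge0 ?ncdf_le1//.
  rewrite ler_expR ler_pM2r// ler_pM2l// ler_sqr ?nnegrE//; exact: ltW.
have w0 : w <= 0 by lra.
apply: le_trans kk; apply: le_trans (N w w0).
rewrite -mulrA ler_wpM2l ?mulr_ge0 ?expR_ge0//.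
have hw : `|z| <= `|w| by rewrite (ltr0_norm z0) (ler0_norm w0); lra.
have := F0 z; have := F1 z; have := normr_ge0 z; nra.
Qed.

(** Reflection exchanges the two branches, so that only the left one has to be
    bounded. *)
Lemma stein_rN z w : stein_r z w = stein_l (- z) (- w).
Proof. by rewrite /stein_r /stein_l sqrrN !ncdfN// subKr. Qed.

Lemma stein_qrN z w : stein_qr z w = - stein_ql (- z) (- w).
Proof.
rewrite /stein_qr /stein_ql stein_rN /cw_psi sqrrN !ncdfN//; ring.
Qed.

Lemma stein_drN z w : stein_dr z w = stein_dl (- z) (- w).
Proof.
rewrite /stein_dr /stein_dl stein_rN stein_qrN /cw_psi sqrrN !ncdfN//; ring.
Qed.

Definition steinc1 : R := gn * kap ^+ 2.
Definition steinc2 : R := steinc1 + kap.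
Definition steinc3 : R := steinc1 + steinc2 + kap.

Let c1_ge0 : 0 <= steinc1. Proof. by rewrite mulr_ge0 ?exprn_ge0 ?(ltW gn0)// (le_trans ler01). Qed.

Lemma stein_l_le z w : w <= z -> `|stein_l z w| * (1 + `|z|) <= steinc1 * cw_psi w.
Proof.
move=> wz; rewrite /stein_l expR_split ger0_norm; last first.
  by rewrite !mulr_ge0 ?expR_ge0 ?(ltW gn0).
have := left_bound wz => h.
have e : gn * (cw_psi w * expR (gam * w ^+ 2 / 2)) * F w * (1 - F z) * (1 + `|z|) =
    (gn * cw_psi w) * (expR (gam * w ^+ 2 / 2) * F w * (1 - F z) * (1 + `|z|)).
  by move: (expR (gam * w ^+ 2 / 2)) (cw_psi w) (F w) => A B C; ring.
rewrite e /steinc1 [gn * _ * cw_psi w]mulrAC ler_wpM2l// mulr_ge0//; exact: ltW.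
Qed.

Lemma stein_ql_le z w : w <= z ->
  `|stein_ql z w| * (1 + `|z|) <= steinc2 * (1 + `|w|) * cw_psi w.
Proof.
move=> wz; rewrite /stein_ql.
have h1 := stein_l_le wz.
have h2 := tail_weight wz.
have z0 : 0 <= 1 + `|z| by rewrite addr_ge0.
move: (F1 z) (psi0 w) h1 h2 z0; rewrite /steinc2.
move: c1_ge0; move: (1 - F z) (cw_psi w) (1 + `|z|) (stein_l z w) steinc1 kap.
move=> f p Z l c k c0 f0 p0 h1 h2 Z0.
apply: (le_trans (ler_wpM2r Z0 (ler_normD _ _))).
rewrite mulrDl !normrM (ger0_norm p0) (ger0_norm f0) -!mulrA.
have h3 := ler_wpM2l (normr_ge0 w) h1.
have h4 := ler_wpM2l p0 h2.
apply: (le_trans (lerD h3 h4)).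
have : 0 <= c * p by rewrite mulr_ge0.
lra.
Qed.

Lemma stein_dl_le z w : w <= z ->
  `|stein_dl z w| * (1 + `|z|) <= steinc3 * (1 + `|w|) ^+ 2 * cw_psi w.
Proof.
move=> wz; rewrite /stein_dl.
have z0 : 0 <= 1 + `|z| by rewrite addr_ge0.
have h1 := stein_l_le wz.
have h2 := ler_wpM2l (normr_ge0 w) (stein_ql_le wz).
have h3 := ler_wpM2l (mulr_ge0 (mulr_ge0 (ltW beta0) (normr_ge0 w)) (psi0 w)) (tail_weight wz).
have H : `|stein_l z w + w * stein_ql z w + beta * w * cw_psi w * (1 - F z)| * (1 + `|z|) <=
    `|stein_l z w| * (1 + `|z|) + `|w| * (`|stein_ql z w| * (1 + `|z|)) +
    beta * `|w| * cw_psi w * ((1 - F z) * (1 + `|z|)).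
  move: (F1 z) (psi0 w) (ltW beta0) z0.
  move: (1 - F z) (cw_psi w) (1 + `|z|) (stein_l z w) (stein_ql z w) beta.
  move=> f p Z l q be f0 p0 be0 Z0.
  apply: (le_trans (ler_wpM2r Z0 (ler_normD _ _))).
  apply: (le_trans (ler_wpM2r Z0 (lerD (ler_normD _ _) (lexx _)))).
  rewrite !normrM (ger0_norm p0) (ger0_norm f0) (ger0_norm be0) le_eqVlt.
  by apply/orP; left; apply/eqP; ring.
apply: (le_trans H); apply: (le_trans (lerD (lerD h1 h2) h3)).
have b0 := ltW beta0; have b1 : beta <= 1 by rewrite lerBlDr lerDl ltW.
clear h1 h2 h3 H.
have c1 := c1_ge0; have k1 := kap1; have w0 := normr_ge0 w; have p0 := psi0 w.
have c2 : 0 <= steinc2 by rewrite /steinc2 addr_ge0// (le_trans ler01).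
rewrite /steinc3.
have e1 : steinc1 * cw_psi w <= steinc1 * (1 + `|w|) ^+ 2 * cw_psi w.
  by rewrite -mulrA ler_wpM2l// ler_peMl// expr2; nra.
have e2 : `|w| * (steinc2 * (1 + `|w|) * cw_psi w) <= steinc2 * (1 + `|w|) ^+ 2 * cw_psi w.
  rewrite [leLHS](_ : _ = steinc2 * (`|w| * (1 + `|w|)) * cw_psi w); last by ring.
  by rewrite ler_wpM2r// ler_wpM2l// expr2; nra.
have e3 : beta * `|w| * cw_psi w * (kap * (1 + `|w|)) <= kap * (1 + `|w|) ^+ 2 * cw_psi w.
  rewrite [leLHS](_ : _ = kap * (beta * (`|w| * (1 + `|w|))) * cw_psi w); last by ring.
  have kk : 0 <= kap by rewrite (le_trans ler01).
  rewrite ler_wpM2r// ler_wpM2l// expr2.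
  by have : 0 <= `|w| * (1 + `|w|); [rewrite mulr_ge0// addr_ge0 | nra].
lra.
Qed.

Variable b1 : R.
Hypothesis b1beta : beta < b1.

Definition polyc : R := 2 + 4 / (b1 - beta).

(** The rate b1 exceeds beta, which leaves room to absorb polynomial factors
    into the Gaussian weight. *)
Lemma poly_psi w : (1 + `|w|) ^+ 2 * cw_psi w <= polyc * expR (b1 * w ^+ 2 / 2).
Proof.
have d0 : 0 < b1 - beta by rewrite subr_gt0.
rewrite (_ : expR (b1 * w ^+ 2 / 2) = expR ((b1 - beta) * w ^+ 2 / 2) * cw_psi w); last first.
  by rewrite -expRD; congr expR; field.
rewrite mulrA ler_wpM2r//.
have h := expR_ge1Dx ((b1 - beta) * w ^+ 2 / 2).
apply: (@le_trans _ _ (polyc * (1 + (b1 - beta) * w ^+ 2 / 2))); last first.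
  by rewrite ler_wpM2l// addr_ge0// divr_ge0// ltW.
have -> : polyc * (1 + (b1 - beta) * w ^+ 2 / 2) =
    2 + 2 * w ^+ 2 + 4 / (b1 - beta) + (b1 - beta) * w ^+ 2.
  by rewrite /polyc; field; rewrite gt_eqF.
have : 0 <= 4 / (b1 - beta) by rewrite divr_ge0// ltW.
have : 0 <= (b1 - beta) * w ^+ 2 by rewrite mulr_ge0 ?sqr_ge0// ltW.
have : `|w| ^+ 2 = w ^+ 2 by rewrite real_normK ?num_real.
have := sqr_ge0 (1 - `|w|); rewrite !expr2; nra.
Qed.

Definition steinK : R := steinc3 * polyc.

Definition egauss (w : R) : R := expR (b1 * w ^+ 2 / 2).

Lemma stein_bounds_l z w : w <= z ->
  [/\ `|stein_l z w| <= steinK / (1 + `|z|) * egauss `|w|,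
      `|stein_ql z w| <= steinK / (1 + `|z|) * egauss `|w| &
      `|stein_dl z w| <= steinK / (1 + `|z|) * egauss `|w|].
Proof.
move=> wz.
have z0 : 0 < 1 + `|z| by rewrite ltr_pwDl.
have P := poly_psi w.
have k1 := kap1; have c1 := c1_ge0; have w0 := normr_ge0 w; have p0 := psi0 w.
have c2 : 0 <= steinc2 by rewrite /steinc2 addr_ge0// (le_trans ler01).
have c23 : steinc2 <= steinc3 by rewrite /steinc3; lra.
have c13 : steinc1 <= steinc3 by rewrite /steinc3; lra.
have c3 : 0 <= steinc3 by lra.
have eE : egauss `|w| = expR (b1 * w ^+ 2 / 2) by rewrite /egauss real_normK ?num_real.
have H (a : R) : `|a| * (1 + `|z|) <= steinc3 * ((1 + `|w|) ^+ 2 * cw_psi w) ->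
   `|a| <= steinK / (1 + `|z|) * egauss `|w|.
  move=> h; rewrite mulrAC ler_pdivlMr// (le_trans h)// /steinK -[leRHS]mulrA eE.
  exact: ler_wpM2l.
have w1 : 1 <= (1 + `|w|) ^+ 2 by rewrite expr2; nra.
have w2 : 1 + `|w| <= (1 + `|w|) ^+ 2 by rewrite expr2; nra.
split; apply: H.
- apply: (le_trans (stein_l_le wz)); apply: ler_pM => //.
  by rewrite ler_peMl.
- apply: (le_trans (stein_ql_le wz)); rewrite -mulrA; apply: ler_pM => //.
    by rewrite mulr_ge0// addr_ge0.
  by rewrite ler_wpM2r.
- by rewrite mulrA; exact: stein_dl_le.
Qed.

Lemma stein_bounds_r z w : z <= w ->
  [/\ `|stein_r z w| <= steinK / (1 + `|z|) * egauss `|w|,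
      `|stein_qr z w| <= steinK / (1 + `|z|) * egauss `|w| &
      `|stein_dr z w| <= steinK / (1 + `|z|) * egauss `|w|].
Proof.
rewrite -lerN2 => /stein_bounds_l; rewrite !normrN.
by rewrite stein_rN stein_qrN stein_drN normrN.
Qed.

Lemma steinK_ge0 : 0 <= steinK.
Proof.
have k1 := kap1; have c1 := c1_ge0.
have k0 : 0 <= kap by rewrite (le_trans ler01).
have d0 : 0 <= 4 / (b1 - beta) by rewrite divr_ge0// subr_ge0 ltW.
have s2 : 0 <= steinc2 by apply: addr_ge0.
have s3 : 0 <= steinc3 by apply: addr_ge0 => //; exact: addr_ge0.
by apply: mulr_ge0 => //; apply: addr_ge0.
Qed.

Lemma stein_g_le z w : `|stein_g z w| <= steinK / (1 + `|z|) * egauss `|w|.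
Proof.
rewrite /stein_g; have [wz|/ltW zw] := leP w z; first by have [] := stein_bounds_l wz.
by have [] := stein_bounds_r zw.
Qed.

Lemma stein_q_le z w : `|stein_q z w| <= steinK / (1 + `|z|) * egauss `|w|.
Proof.
rewrite /stein_q; have [wz|/ltW zw] := leP w z; first by have [] := stein_bounds_l wz.
by have [] := stein_bounds_r zw.
Qed.

Lemma stein_increment (z y r : R) :
  `|stein_q z (y + r) - stein_q z y| <=
    2 * (steinK / (1 + `|z|)) * egauss (`|y| + `|r|) * (`|r| + (`|y - z| <= `|r|)%R%:R) /\
  `|stein_g z (y + r) - stein_g z y - r * stein_q z y| <=
    2 * (steinK / (1 + `|z|)) * egauss (`|y| + `|r|) * `|r| *
      (`|r| + (`|y - z| <= `|r|)%R%:R).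
Proof.
apply: (@piecewise_increment R z (steinK / (1 + `|z|)) egauss (stein_l z) (stein_r z)
  (stein_ql z) (stein_qr z) (stein_dl z) (stein_dr z)).
- by rewrite divr_ge0 ?steinK_ge0// addr_ge0.
- move=> u v u0 uv; rewrite /egauss expR_ge0 ler_expR ler_pM2r// ler_wpM2l//; last first.
    by rewrite ler_sqr ?nnegrE// (le_trans u0).
  by rewrite (le_trans (ltW beta0))// ltW.
- exact: is_derive_stein_l.
- exact: is_derive_stein_r.
- exact: is_derive_stein_ql.
- exact: is_derive_stein_qr.
- by move=> x /stein_bounds_l[].
- by move=> x /stein_bounds_r[].
- by move=> x /stein_bounds_l[].
- by move=> x /stein_bounds_r[].
- by rewrite /stein_l /stein_r; ring.
Qed.

End stein_solution.

(** * Gaussian moments and concentration of the sum *)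
Section sums.
Context (R : realType).
Local Notation M := (measurableTypeR R).
Implicit Types (P : probability M R) (v theta : R).

Lemma sum_lawS_pushforward P n (A : set M) : measurable A ->
  sum_law P n.+1 A = (P \x sum_law P n)%E [set p | A ((p.1 : R) + (p.2 : R))].
Proof.
move=> mA.
have madd : measurable_fun setT (fun p : M * M => (p.1 : R) + (p.2 : R) : M).
  by apply: measurable_funD; [exact: measurable_fst|exact: measurable_snd].
have mI : measurable_fun setT (fun s : M => \1_A s : R) by exact: measurable_indic.
have := ge0_int_sum_lawS P n mI (fun=> ler0n _ _).
rewrite integral_indic// setIT => ->.
pose B := [set p : M * M | A ((p.1 : R) + (p.2 : R))].
have mB : measurable B by rewrite -[B]setTI; exact: madd.
rewrite -/B.
have mF : measurable_fun setT (fun p : M * M => \1_A ((p.1 : R) + (p.2 : R)) : R).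
  exact: (measurableT_comp mI madd).
have F0 (p : M * M) : 0 <= (\1_A ((p.1 : R) + (p.2 : R)) : R) by rewrite ler0n.
rewrite -(ge0_int_prod P (sum_law P n) mF F0).
transitivity (\int[P \x sum_law P n]_p (\1_B p)%:E)%E; last by rewrite integral_indic// setIT.
by apply: eq_integral => p _; rewrite !indicE.
Qed.

Lemma sum_lawS_Rint P n (f : M -> R) : measurable_fun setT f ->
  (sum_law P n.+1).-integrable setT (EFin \o f) ->
  (P \x sum_law P n)%E.-integrable setT (EFin \o (fun p => f ((p.1 : R) + (p.2 : R)))) /\
  \int[sum_law P n.+1]_s f s = \int[(P \x sum_law P n)%E]_p f ((p.1 : R) + (p.2 : R)).
Proof.
move=> mf fi.
have madd : measurable_fun setT (fun p : M * M => (p.1 : R) + (p.2 : R) : M).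
  by apply: measurable_funD; [exact: measurable_fst|exact: measurable_snd].
pose add (p : M * M) : M := (p.1 : R) + (p.2 : R).
have mfa : measurable_fun setT (fun p : M * M => f (add p)) by exact: (measurableT_comp mf madd).
have ip : (P \x sum_law P n)%E.-integrable setT (EFin \o (fun p => f (add p))).
  apply/integrableP; split; first exact/measurable_EFinP.
  move/integrableP : fi => [_]; apply: le_lt_trans.
  rewrite (ge0_int_sum_lawS P n (f := fun s => `|f s|))//; last exact: measurableT_comp.
  rewrite -(ge0_int_prod P (sum_law P n) (F := fun p => `|f (add p)|))//.
  exact: measurableT_comp.
split=> //; rewrite /Rintegral; congr fine.
rewrite (eq_measure_integral (pushforward (P \x sum_law P n)%E add)); last first.
  by move=> A mA _; exact: sum_lawS_pushforward.
rewrite integral_pushforward//; exact/measurable_EFinP.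
Qed.

Lemma subgaussian_sum_law v P j n : 0 <= v -> subgaussian v P -> (j <= n)%N ->
  subgaussian (v * n%:R) (sum_law P j).
Proof.
move=> v0 sg jn t; rewrite sum_law_mgf.
move: (sg t).
have : (0 <= \int[P]_x (expR (t * (x : R)))%:E)%E.
  by apply: integral_ge0 => x _; rewrite lee_fin expR_ge0.
case: (\int[P]_x (expR (t * (x : R)))%:E)%E => [a| |]//.
rewrite !lee_fin => a0 h; rewrite -EFin_expe lee_fin.
have hc : 0 <= v * t ^+ 2 / 2 by rewrite divr_ge0// mulr_ge0// sqr_ge0.
apply: (@le_trans _ _ (expR (v * t ^+ 2 / 2) ^+ j)); first by rewrite lerXn2r// ?nnegrE ?expR_ge0.
rewrite -expRM_natl ler_expR.
rewrite (_ : v * n%:R * t ^+ 2 / 2 = n%:R * (v * t ^+ 2 / 2)); last by ring.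
by rewrite ler_wpM2r// ler_nat.
Qed.

Definition gaussc (v theta : R) : R := Num.sqrt (1 - theta * v)^-1.

(** Uniformity in j <= n lets the same constant serve for the sum and for the
    sum with one summand removed, both divided by sqrt n. *)
Lemma sum_law_gauss_moment v P j n theta : 0 <= v -> subgaussian v P ->
  (0 < n)%N -> (j <= n)%N -> 0 < theta -> theta * v < 1 ->
  (\int[sum_law P j]_s (expR (theta * ((s : R) / Num.sqrt n%:R) ^+ 2 / 2))%:E <=
    (gaussc v theta)%:E)%E.
Proof.
move=> v0 sg n0 jn t0 tv.
have n0' : 0 < n%:R :> R by rewrite ltr0n.
have := @subgaussian_sq R (v * n%:R) (sum_law P j) (theta / n%:R)
  (subgaussian_sum_law v0 sg jn).
have -> : theta / n%:R * (v * n%:R) = theta * v by field; rewrite gt_eqF.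
rewrite divr_gt0// => /(_ isT tv); apply: le_trans.
rewrite le_eqVlt; apply/orP; left; apply/eqP; apply: eq_integral => s _.
by rewrite expr_div_n sqr_sqrtr ?ler0n//; congr (expR _)%:E; field; rewrite gt_eqF.
Qed.

(** The best constant in Young's inequality below: a cross term is paid for by
    a slightly larger rate a' for y and a large one for r. *)
Definition youngc (a a' : R) : R := a + a ^+ 2 / (a' - a).

Lemma young_sq (a a' y r : R) : 0 < a -> a < a' -> 0 <= y -> 0 <= r ->
  a * (y + r) ^+ 2 <= a' * y ^+ 2 + youngc a a' * r ^+ 2.
Proof.
move=> a0 aa' y0 r0; rewrite /youngc.
have d0 : 0 < a' - a by rewrite subr_gt0.
rewrite -subr_ge0 (_ : _ - _ = ((a' - a) * y - a * r) ^+ 2 / (a' - a)); last first.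
  by field; rewrite gt_eqF.
by rewrite divr_ge0 ?sqr_ge0// ltW.
Qed.

Lemma youngc_ge0 (a a' : R) : 0 < a -> a < a' -> 0 <= youngc a a'.
Proof.
move=> a0 aa'; rewrite /youngc addr_ge0 ?divr_ge0 ?sqr_ge0//; last by rewrite subr_ge0 ltW.
exact: ltW.
Qed.

Lemma abs_le_gauss (kappa w : R) : 0 < kappa ->
  `|w| <= (1 + kappa^-1) * expR (kappa * w ^+ 2 / 2).
Proof.
move=> k0; have h := expR_ge1Dx (kappa * w ^+ 2 / 2).
have k1 : 0 < kappa^-1 by rewrite invr_gt0.
apply: (@le_trans _ _ ((1 + kappa^-1) * (1 + kappa * w ^+ 2 / 2))); last first.
  by rewrite ler_wpM2l// addr_ge0// ltW.
rewrite [leRHS](_ : _ = 1 + kappa * w ^+ 2 / 2 + kappa^-1 + w ^+ 2 / 2); last first.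
  by field; rewrite gt_eqF.
have : 0 <= kappa * w ^+ 2 / 2 by rewrite divr_ge0// mulr_ge0 ?sqr_ge0// ltW.
have : `|w| ^+ 2 = w ^+ 2 by rewrite real_normK ?num_real.
have := sqr_ge0 (1 - `|w|); rewrite !expr2; nra.
Qed.

Definition standard v P := [/\ subgaussian v P, \int[P]_x (x : R) = 0 &
  \int[P]_x ((x : R) ^+ 2) = 1].

Lemma integrable_pow_expR v P (c : R) j : 0 <= c -> subgaussian v P ->
  P.-integrable setT (EFin \o (fun x : M => `|x : R| ^+ j * expR (c * `|x : R|))).
Proof.
move=> c0 sg.
apply: (proj1 (ge0_Rint_le _ _ (moment_expR j c0 sg))); first by mfun.
by move=> x; rewrite mulr_ge0 ?expR_ge0// exprn_ge0.
Qed.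

Lemma integrable_abs_pow v P j : subgaussian v P ->
  P.-integrable setT (EFin \o (fun x : M => `|x : R| ^+ j)).
Proof.
move=> sg; have := @integrable_pow_expR v P 0 j (lexx _) sg.
by apply: eq_integrable => // x _ /=; rewrite mul0r expR0 mulr1.
Qed.

Lemma integrable_pow v P j : subgaussian v P ->
  P.-integrable setT (EFin \o (fun x : M => (x : R) ^+ j)).
Proof.
move=> sg; apply: dominated_integrable (integrable_abs_pow j sg); first by mfun.
by move=> x; rewrite normrX.
Qed.

Lemma integrable_id v P : subgaussian v P ->
  P.-integrable setT (EFin \o (fun x : M => (x : R))).
Proof.
move=> sg; have := integrable_pow 1 sg.
by apply: eq_integrable => // x _ /=; rewrite expr1.
Qed.

(** Chosen so that the fourth moment, at most 48 exp(v/2), makes the variance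
    beyond this level at most one half. *)
Definition trunc_level (v : R) : R := Num.sqrt (96 * expR (v / 2)).

Lemma trunc_level_gt0 v : 0 < trunc_level v.
Proof. by rewrite sqrtr_gt0 mulr_gt0// expR_gt0. Qed.

(** Beyond the level c one has x^2 <= x^4 / c^2. *)
Lemma truncated_variance v P : standard v P ->
  1 / 2 <= \int[P]_x ((x : R) ^+ 2 * (`|x : R| <= trunc_level v)%R%:R).
Proof.
move=> [sg _ var].
have i2 := integrable_pow 2 sg; have i4 := integrable_pow 4 sg.
set c := trunc_level v.
have c0 : 0 < c := trunc_level_gt0 v.
have mind : measurable_fun setT (fun x : M => (`|x : R| <= c)%R%:R : R).
  by apply: measurable_indic_le; mfun.
have i2c : P.-integrable setT (EFin \o (fun x : M => (x : R) ^+ 2 * (`|x : R| <= c)%R%:R)).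
  apply: dominated_integrable i2; first by apply: measurable_funM => //; mfun.
  move=> x; rewrite normrM ger0_norm ?sqr_ge0// ler_piMr ?sqr_ge0//.
  by case: (`|x : R| <= c); rewrite /= ?normr1 ?normr0.
have i4c : P.-integrable setT (EFin \o (fun x : M => c ^- 2 * (x : R) ^+ 4)).
  have := integrableZl measurableT (c ^- 2) i4; by apply: eq_integrable.
have h : \int[P]_x ((x : R) ^+ 2) <=
   \int[P]_x ((x : R) ^+ 2 * (`|x : R| <= c)%R%:R) + \int[P]_x (c ^- 2 * (x : R) ^+ 4).
  rewrite -RintegralD//; apply: le_Rint => //.
    by have := integrableD measurableT i2c i4c; apply: eq_integrable.
  move=> x; case: (leP `|x : R| c) => /= xc.
    rewrite mulr1 lerDl; apply: mulr_ge0; last exact: exprn_even_ge0.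
    by rewrite invr_ge0 exprn_ge0// ltW.
  rewrite mulr0 add0r (_ : _ ^+ 4 = x ^+ 2 * x ^+ 2); last by rewrite -exprD.
  rewrite mulrA ler_peMl ?sqr_ge0// mulrC ler_pdivlMr ?exprn_gt0// mul1r.
  by rewrite -[x ^+ 2]real_normK ?num_real// ler_sqr ?nnegrE// ltW.
rewrite var in h.
have h4 : \int[P]_x ((x : R) ^+ 4) <= 48 * expR (v / 2).
  have [||_] := @ge0_Rint_le _ _ _ P (fun x : M => `|x : R| ^+ 4 * expR (0 * `|x : R|))
    (4`!%:R * (2 * expR (v * (0 + 1) ^+ 2 / 2))) _ _ (moment_expR 4 (lexx 0) sg).
  - by mfun.
  - by move=> x; rewrite mulr_ge0 ?expR_ge0// exprn_ge0.
  - move=> h4; apply: (@le_trans _ _ (\int[P]_x (`|x : R| ^+ 4 * expR (0 * `|x : R|)))).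
      rewrite le_eqVlt; apply/orP; left; apply/eqP; apply: eq_Rint => x.
      by rewrite mul0r expR0 mulr1 -normrX ger0_norm// exprn_even_ge0.
    apply: (le_trans h4); rewrite add0r expr1n mulr1 mulrA -natrM.
    by rewrite ler_wpM2r ?expR_ge0// ler_nat.
have : \int[P]_x (c ^- 2 * (x : R) ^+ 4) <= 1 / 2.
  rewrite RintegralZl// mulrC ler_pdivrMr ?exprn_gt0//.
  apply: (le_trans h4); rewrite /c /trunc_level sqr_sqrtr; last by rewrite mulr_ge0 ?expR_ge0.
  by have := expR_ge0 (v / 2); lra.
lra.
Qed.

(** The test function of the concentration inequality: slope 1 near z and
    constant elsewhere. *)
Definition clampz (z rho w : R) : R := Num.max (- rho) (Num.min rho (w - z)).

Lemma clampz_incr z rho a b : a <= b -> clampz z rho a <= clampz z rho b.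
Proof.
by move=> ab; rewrite /clampz ge_max !le_max lexx /= le_min !ge_min lexx /= lerD2r ab !orbT.
Qed.

Lemma clampz_in z rho w : `|w - z| <= rho -> clampz z rho w = w - z.
Proof.
rewrite ler_norml => /andP[h1 h2]; rewrite /clampz (min_idPr h2).
exact/max_idPr.
Qed.

Lemma clampz_le z rho w : 0 <= rho -> `|clampz z rho w| <= rho.
Proof.
move=> r0; rewrite ler_norml /clampz le_max lexx /= ge_max ge_min lexx /= andbT.
by rewrite (le_trans _ r0)// oppr_le0.
Qed.

Lemma clampz_far z rho w : 0 <= rho -> `|w| < `|z| - rho ->
  clampz z rho w = clampz z rho 0.
Proof.
move=> r0; have [z0|z0] := leP 0 z => h.
  have h1 u : u - z <= - rho -> clampz z rho u = - rho.
    move=> hu; rewrite /clampz; apply/max_idPl; rewrite ge_min; apply/orP; right.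
    exact: hu.
  by rewrite !h1//; have := ler_norm w; move: h; rewrite ?(ger0_norm z0); have := normr_ge0 w; lra.
have h1 u : rho <= u - z -> clampz z rho u = rho.
  move=> hu; rewrite /clampz (min_idPl hu); apply/max_idPr.
  by rewrite (le_trans _ r0)// oppr_le0.
by rewrite !h1//; have := ler_normr (- w) w; move: h; rewrite ?(ltr0_norm z0);
  have := ler_norm (- w); rewrite normrN; have := normr_ge0 w; lra.
Qed.

(** The clamp differs from its value at 0 only when w is close to z, and then
    exp(b4 w^2 / 2) dominates exp(b3 z^2 / 2) up to a factor depending on
    rho.  This yields the Gaussian decay in z of the concentration bound. *)
Lemma clampz_decay b3 b4 z rho w : 0 < b3 -> b3 < b4 -> 0 <= rho ->
  `|clampz z rho w - clampz z rho 0| <= 2 * rho *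
    (expR (youngc b3 b4 * rho ^+ 2 / 2) * expR (- (b3 * z ^+ 2 / 2)) * expR (b4 * w ^+ 2 / 2)).
Proof.
move=> b30 b34 rho0.
have [far|near] := ltP `|w| (`|z| - rho).
  rewrite (clampz_far rho0 far) subrr normr0.
  by apply: mulr_ge0; [exact: mulr_ge0|rewrite !mulr_ge0 ?expR_ge0].
apply: (@le_trans _ _ (2 * rho)).
  by rewrite (le_trans (ler_normB _ _))// mulrDl !mul1r lerD//; exact: clampz_le.
rewrite ler_peMr ?mulr_ge0// -!expRD -[leLHS]expR0 ler_expR.
have zr : `|z| <= `|w| + rho by rewrite -lerBlDr.
have := young_sq b30 b34 (normr_ge0 w) rho0; rewrite real_normK ?num_real//.
have : b3 * z ^+ 2 <= b3 * (`|w| + rho) ^+ 2.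
  rewrite ler_pM2l// -[z ^+ 2]real_normK ?num_real// ler_sqr ?nnegrE//.
  by rewrite addr_ge0.
move: (b3 * (`|w| + rho) ^+ 2) (b3 * z ^+ 2) (b4 * w ^+ 2) (_ * rho ^+ 2) => p q u t.
by move=> h1 h2; lra.
Qed.

Lemma clampz_decay_mul b3 b4 b5 z rho w : 0 < b3 -> b3 < b4 -> b4 < b5 -> 0 <= rho ->
  `|w * (clampz z rho w - clampz z rho 0)| <= 2 * rho * (1 + (b5 - b4)^-1) *
    expR (youngc b3 b4 * rho ^+ 2 / 2) * expR (- (b3 * z ^+ 2 / 2)) * expR (b5 * w ^+ 2 / 2).
Proof.
move=> b30 b34 b45 rho0.
have k0 : 0 < b5 - b4 by rewrite subr_gt0.
rewrite normrM; apply: (le_trans (ler_pM (normr_ge0 _) (normr_ge0 _)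
  (abs_le_gauss w k0) (clampz_decay z w b30 b34 rho0))).
have -> : expR (b5 * w ^+ 2 / 2) = expR ((b5 - b4) * w ^+ 2 / 2) * expR (b4 * w ^+ 2 / 2).
  by rewrite -expRD; congr expR; field.
rewrite le_eqVlt; apply/orP; left; apply/eqP.
move: (expR _) (expR _) (expR _) (expR _) (_^-1) => A1 A2 A3 A4 A5; ring.
Qed.

Lemma measurable_clampz z rho : measurable_fun setT (clampz z rho).
Proof.
apply: measurable_maxr => //; apply: measurable_minr => //; by mfun.
Qed.

Lemma concentration_arith (c r q y K G E C0 : R) : C0 = 4 * (1 + c) * K * G * expR (y * c ^+ 2) -> 0 <= c -> 0 <= r -> 0 <= q -> q <= 1 ->
  0 <= y -> 0 <= K -> 0 <= G -> 0 <= E ->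
  4 * (r + c * q) * K * expR (y * (r + c * q) ^+ 2 / 2) * E * G <=
  (C0 + y) * (r + q) * expR ((C0 + y) * r ^+ 2) * E.
Proof.
move=> C0E c0 r0 q0 q1 y0 K0 G0 E0.
have C00 : 0 <= C0 by rewrite C0E !mulr_ge0 ?expR_ge0// addr_ge0.
have cr0 : 0 <= c * r by rewrite mulr_ge0.
have cq0 : 0 <= c * q by rewrite mulr_ge0.
have r1 : r + c * q <= (1 + c) * (r + q) by lra.
have r2 : expR (y * (r + c * q) ^+ 2 / 2) <= expR (y * c ^+ 2) * expR ((C0 + y) * r ^+ 2).
  rewrite -expRD ler_expR.
  have hc : (c * q) ^+ 2 <= c ^+ 2 by rewrite ler_sqr ?nnegrE// ler_piMr.
  have r22 : (r + c * q) ^+ 2 <= 2 * r ^+ 2 + 2 * c ^+ 2.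
    apply: (@le_trans _ _ (2 * r ^+ 2 + 2 * (c * q) ^+ 2)); last by lra.
    rewrite -subr_ge0 (_ : _ - _ = (r - c * q) ^+ 2) ?sqr_ge0//; ring.
  have := ler_wpM2l y0 r22.
  have : 0 <= C0 * r ^+ 2 by rewrite mulr_ge0// sqr_ge0.
  move: (y * (r + c * q) ^+ 2) => A; lra.
apply: (@le_trans _ _ (4 * ((1 + c) * (r + q)) * K *
   (expR (y * c ^+ 2) * expR ((C0 + y) * r ^+ 2)) * E * G)).
  do 2 apply: ler_wpM2r => //.
  apply: ler_pM => //; rewrite ?expR_ge0 ?mulr_ge0// ?addr_ge0//.
  by apply: ler_wpM2r => //; apply: ler_wpM2l.
rewrite (_ : _ * G = C0 * (r + q) * expR ((C0 + y) * r ^+ 2) * E); last first.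
  by rewrite C0E; move: (expR (y * c ^+ 2)) (expR _) => e1 e2; ring.
do 2 (apply: ler_wpM2r; first by rewrite ?expR_ge0).
apply: ler_wpM2r; last by rewrite lerDl.
by rewrite addr_ge0.
Qed.

(** Concentration by Stein's method.  Exchange the factor S in the expectation
    of S h(S), with h the clamp around z: a summand of size at most c moves
    the sum by at most c / sqrt n, so h increases by the full step whenever
    the remaining sum is within r of z, and it never decreases in the
    direction of the summand.  The truncated variance keeps at least half of
    this gain, which bounds the probability of the window by the size of
    S h(S). *)
Lemma sum_law_concentration v b3 b4 b5 : 0 <= v -> 0 < b3 -> b3 < b4 -> b4 < b5 -> b5 * v < 1 ->
  exists2 C, 0 <= C & forall P, standard v P -> forall n z r, 0 <= r ->
  (\int[sum_law P n]_s ((`|(s : R) / Num.sqrt n.+1%:R - z| <= r)%R%:R)%:E <=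
   (C * (r + (Num.sqrt n.+1%:R)^-1) * expR (C * r ^+ 2) * expR (- (b3 * z ^+ 2 / 2)))%:E)%E.
Proof.
move=> v0 b30 b34 b45 b5v.
set c := trunc_level v; set kappa := b5 - b4; set y := youngc b3 b4.
have c0 : 0 < c := trunc_level_gt0 v.
have k0 : 0 < kappa by rewrite subr_gt0.
have y0 : 0 <= y by exact: youngc_ge0.
pose C0 := 4 * (1 + c) * (1 + kappa^-1) * gaussc v b5 * expR (y * c ^+ 2).
have ki0 : 0 < kappa^-1 by rewrite invr_gt0.
have C00 : 0 <= C0.
  by rewrite /C0 !mulr_ge0 ?expR_ge0 ?sqrtr_ge0// addr_ge0// ltW.
exists (C0 + y); first by rewrite addr_ge0.
move=> P sP n z r r0; have [sg mean var] := sP.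
set rn := Num.sqrt n.+1%:R.
have rn0 : 0 < rn by rewrite sqrtr_gt0 ltr0n.
have rn1 : 1 <= rn by rewrite -[1]sqrtr1 ler_sqrt// ler1n.
have rnE : rn ^+ 2 = n.+1%:R by rewrite sqr_sqrtr ?ler0n.
pose rho := r + c / rn.
have rho0 : 0 <= rho by rewrite addr_ge0// divr_ge0 ?(ltW c0)// ltW.
pose g := clampz z rho.
pose h (s : M) := g ((s : R) / rn) - g 0.
have mg : measurable_fun setT g by exact: measurable_clampz.
have mh : measurable_fun setT h by rewrite /h; mfun.
have hb s : `|h s| <= 2 * rho.
  rewrite /h (le_trans (ler_normB _ _))// mulrDl !mul1r lerD//; exact: clampz_le.
have ix := integrable_prod1 (sum_law P n) (integrable_norm (integrable_id sg)).
have ix' : (P \x sum_law P n)%E.-integrable setT (EFin \o (fun p => 2 * rho * `|p.1 : R|)).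
  by have := integrableZl measurableT (2 * rho) ix; apply: eq_integrable.
have madd : measurable_fun setT (fun p : M * M => (p.1 : R) + (p.2 : R)) by mfun.
have i1 : (P \x sum_law P n)%E.-integrable setT
    (EFin \o (fun p => (p.1 : R) * h ((p.1 : R) + (p.2 : R)))).
  apply: dominated_integrable ix'; first by mfun.
  by move=> p; rewrite normrM mulrC ler_wpM2r.
have ih : (sum_law P n).-integrable setT (EFin \o h).
  apply: dominated_integrable (finite_measure_integrable_cst _ (2 * rho) measurableT) => //.
have i2 := integrable_prodM (integrable_id sg) ih.
have e2 := Rint_prodM (integrable_id sg) ih.
rewrite mean mul0r in e2.
have [iS eS] := sum_law_exchange mh i1.
set Pr := \int[sum_law P n]_s ((`|(s : R) / rn - z| <= r)%R%:R).
have mind : measurable_fun setT (fun s : M => (`|(s : R) / rn - z| <= r)%R%:R : R).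
  by apply: measurable_indic_le; mfun.
have ii : (sum_law P n).-integrable setT
    (EFin \o (fun s : M => (`|(s : R) / rn - z| <= r)%R%:R)).
  apply: dominated_integrable (finite_measure_integrable_cst _ 1 measurableT) => // s.
  by rewrite normr_nat lern1 leq_b1.
rewrite -EFin_Rint// lee_fin -/Pr.
have it : P.-integrable setT (EFin \o (fun x : M => rn^-1 * ((x : R) ^+ 2 * (`|x : R| <= c)%R%:R))).
  apply: dominated_integrable (integrable_pow 2 sg).
    apply: measurable_funM => //; apply: measurable_funM; first by mfun.
    by apply: measurable_indic_le; mfun.
  have ri0 : 0 <= rn^-1 by rewrite invr_ge0 ltW.
  move=> x; rewrite ger0_norm; last first.
    by apply: mulr_ge0 => //; apply: mulr_ge0; [exact: sqr_ge0|exact: ler0n].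
  rewrite mulrCA ler_piMr ?sqr_ge0// -[leRHS]mulr1; apply: ler_pM => //.
  - by rewrite invf_le1.
  - by rewrite lern1 leq_b1.
have il := integrable_prodM it ii.
have el := Rint_prodM it ii.
have lower : rn^-1 * (1 / 2) * Pr <= \int[(P \x sum_law P n)%E]_p ((p.1 : R) * h ((p.1 : R) + (p.2 : R))).
  apply: (@le_trans _ _ (\int[P]_x (rn^-1 * ((x : R) ^+ 2 * (`|x : R| <= c)%R%:R)) * Pr)).
    apply: ler_wpM2r; first by apply: Rintegral_ge0.
    rewrite RintegralZl//; last first.
      have := integrableZl measurableT rn it; apply: eq_integrable => // x _ /=.
      by rewrite -EFinM mulrA divff ?mul1r// gt_eqF.
    by rewrite ler_wpM2l ?invr_ge0 ?(ltW rn0)//; exact: truncated_variance.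
  rewrite -el -[leRHS]subr0 -{1}e2 -RintegralB//.
  apply: le_Rint => //; first by have := integrableB measurableT i1 i2; apply: eq_integrable.
  move=> p /=; rewrite -mulrBr /h opprB addrA subrK.
  have sgn : 0 <= p.1 * (g ((p.1 + p.2) / rn) - g (p.2 / rn)).
    have [x0|x0] := leP 0 p.1.
      by rewrite mulr_ge0// subr_ge0; apply: clampz_incr; rewrite ler_pM2r ?invr_gt0// lerDr.
    rewrite nmulr_rge0// subr_le0; apply: clampz_incr; rewrite ler_pM2r ?invr_gt0//.
    by rewrite gerDr ltW.
  case: (leP `|p.1| c) => xc /=; last by rewrite mulr0 mulr0 mul0r.
  case: (leP `|p.2 / rn - z| r) => yr /=; last by rewrite mulr0.
  have hx : `|p.1 / rn| <= c / rn by rewrite normrM (@ger0_norm _ rn^-1) ?invr_ge0 ?(ltW rn0)// ler_pM2r ?invr_gt0.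
  have crn : 0 <= c / rn by rewrite divr_ge0// ltW.
  rewrite /g !clampz_in.
  - rewrite le_eqVlt; apply/orP; left; apply/eqP; rewrite !mulr1; field; rewrite gt_eqF//.
  - by rewrite (le_trans yr)// /rho lerDl.
  - rewrite mulrDl -addrA addrC (le_trans (ler_normD _ _))// lerD//.
have upper : \int[sum_law P n.+1]_s ((s : R) * h s) <=
   rn * (2 * rho * (1 + kappa^-1) * expR (y * rho ^+ 2 / 2) * expR (- (b3 * z ^+ 2 / 2)) * gaussc v b5).
  apply: (le_trans (ler_norm _)).
  pose A := rn * (2 * rho * (1 + kappa^-1) * expR (y * rho ^+ 2 / 2) * expR (- (b3 * z ^+ 2 / 2))).
  have A0 : 0 <= A.
    by rewrite /A !mulr_ge0 ?expR_ge0 ?(ltW rn0)// addr_ge0// ltW.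
  have -> : rn * (2 * rho * (1 + kappa^-1) * expR (y * rho ^+ 2 / 2) * expR (- (b3 * z ^+ 2 / 2)) *
     gaussc v b5) = A * gaussc v b5 by rewrite /A; ring.
  apply: (proj2 (norm_Rint_le (g := fun s : M => A * expR (b5 * ((s : R) / rn) ^+ 2 / 2)) _ _ _ _)).
  - by mfun.
  - by mfun.
  - move=> s; set w := (s : R) / rn.
    have -> : (s : R) * h s = rn * (w * h s) by rewrite mulrA /w [rn * _]mulrC divfK// gt_eqF.
    rewrite normrM (gtr0_norm rn0) /A -[leRHS]mulrA; apply: ler_wpM2l; first exact: ltW.
    exact: clampz_decay_mul.
  - rewrite ge0_intZl//; last by mfun.
    rewrite [leRHS]EFinM; apply: lee_wpmul2l; first by rewrite lee_fin.
    apply: sum_law_gauss_moment => //; exact: (lt_trans b30 (lt_trans b34 b45)).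
have PrB : Pr <= 4 * (r + c * rn^-1) * (1 + kappa^-1) * expR (y * (r + c * rn^-1) ^+ 2 / 2) * expR (- (b3 * z ^+ 2 / 2)) * gaussc v b5.
  have e : \int[(P \x sum_law P n)%E]_p ((p.1 : R) * h ((p.1 : R) + (p.2 : R))) =
     (\int[sum_law P n.+1]_s ((s : R) * h s)) / rn ^+ 2.
    by rewrite eS rnE mulrC mulKf// pnatr_eq0.
  rewrite e in lower.
  have l2 : Pr <= 2 / rn * \int[sum_law P n.+1]_s ((s : R) * h s).
    have := ler_wpM2l (ltW (mulr_gt0 (ltr0n R 2) rn0)) lower.
    rewrite (_ : 2 * rn * (rn^-1 * (1 / 2) * Pr) = Pr); last by field; rewrite gt_eqF.
    by rewrite (_ : 2 * rn * (_ / rn ^+ 2) = 2 / rn * \int[sum_law P n.+1]_s ((s : R) * h s))//;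
      field; rewrite gt_eqF.
  apply: (le_trans l2).
  have rn20 : 0 <= 2 / rn by rewrite divr_ge0// ltW.
  apply: (le_trans (ler_wpM2l rn20 upper)).
  rewrite mulrA divfK ?gt_eqF// -/rho le_eqVlt; apply/orP; left; apply/eqP.
  by move: (expR _) (expR _) (gaussc _ _) (kappa^-1) => a1 a2 a3 a4; ring.
apply: (le_trans PrB).
have q0 : 0 <= rn^-1 by rewrite invr_ge0 ltW.
have q1 : rn^-1 <= 1 by rewrite invf_le1.
have K0 : 0 <= 1 + kappa^-1 by rewrite addr_ge0// ltW.
exact: (concentration_arith (erefl C0) (ltW c0) r0 q0 q1 y0 K0 (sqrtr_ge0 _) (expR_ge0 _)).
Qed.

End sums.

(** * Splitting off one summand *)
Section subcritical.
Context (R : realType) (gam : R).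
Hypotheses (gam0 : 0 < gam) (gam1 : gam < 1).
Local Notation M := (measurableTypeR R).
Local Notation beta := (1 - gam).
Local Notation F := (ncdf gam).

Lemma measurable_of_is_derive (f df : R -> R) :
  (forall x : R, is_derive (x : R) (1 : R) f (df x)) -> measurable_fun setT f.
Proof.
move=> d; apply: continuous_measurable_fun => x.
apply: differentiable_continuous; apply/derivable1_diffP.
by have := d x => ?; exact: ex_derive.
Qed.

Lemma measurable_stein_q z : measurable_fun setT (stein_q gam z).
Proof.
have ml := measurable_of_is_derive (is_derive_stein_ql gam0 z).
have mr := measurable_of_is_derive (is_derive_stein_qr gam0 z).
have mi : measurable_fun setT (fun w : R => (w <= z)%R%:R : R).
  exact: (@measurable_indic_le R z _ R id).
have -> : stein_q gam z = fun w => (w <= z)%R%:R * stein_ql gam z w +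
    (1 - (w <= z)%R%:R) * stein_qr gam z w.
  by apply/funext => w; rewrite /stein_q; case: (w <= z) => /=; ring.
by mfun.
Qed.

Lemma measurable_stein_g z : measurable_fun setT (stein_g gam z).
Proof.
have ml := measurable_of_is_derive (is_derive_stein_l gam0 z).
have mr := measurable_of_is_derive (is_derive_stein_r gam0 z).
have mi : measurable_fun setT (fun w : R => (w <= z)%R%:R : R).
  exact: (@measurable_indic_le R z _ R id).
have -> : stein_g gam z = fun w => (w <= z)%R%:R * stein_l gam z w +
    (1 - (w <= z)%R%:R) * stein_r gam z w.
  by apply/funext => w; rewrite /stein_g; case: (w <= z) => /=; ring.
by mfun.
Qed.

Lemma one_plus_sq_le (kappa x : R) : 0 < kappa ->
  1 + x ^+ 2 <= (1 + 2 / kappa) * expR (kappa * x ^+ 2 / 2).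
Proof.
move=> k0; have h := expR_ge1Dx (kappa * x ^+ 2 / 2).
have k1 : 0 <= 2 / kappa by rewrite divr_ge0// ltW.
apply: (@le_trans _ _ ((1 + 2 / kappa) * (1 + kappa * x ^+ 2 / 2))); last first.
  by rewrite ler_wpM2l// addr_ge0.
rewrite [leRHS](_ : _ = 1 + x ^+ 2 + (kappa * x ^+ 2 / 2 + 2 / kappa)); last first.
  by field; rewrite gt_eqF.
rewrite lerDl addr_ge0// divr_ge0//; apply: mulr_ge0; [exact: ltW|exact: sqr_ge0].
Qed.

Lemma cubic_le (eta x : R) : 0 < eta ->
  (1 + x ^+ 2) * (1 + `|x|) <= 2 * (1 + 4 / eta) ^+ 2 * expR (eta * x ^+ 2 / 2).
Proof.
move=> e0; have e20 : 0 < eta / 2 by rewrite divr_gt0.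
have h := one_plus_sq_le x e20.
have h0 : 0 <= 1 + x ^+ 2 by rewrite addr_ge0// sqr_ge0.
have xx : `|x| ^+ 2 = x ^+ 2 by rewrite real_normK ?num_real.
have h1 : 1 + `|x| <= 2 * (1 + x ^+ 2).
  by have := sqr_ge0 (1 - `|x|); have := normr_ge0 x; rewrite -xx !expr2; nra.
apply: (@le_trans _ _ (2 * (1 + x ^+ 2) ^+ 2)).
  by rewrite expr2 mulrCA; apply: ler_wpM2l.
rewrite -mulrA ler_pM2l//.
have -> : expR (eta * x ^+ 2 / 2) = expR (eta / 2 * x ^+ 2 / 2) ^+ 2.
  by rewrite -expRM_natl; congr expR; field.
rewrite -exprMn ler_sqr ?nnegrE//.
  by apply: (le_trans h); rewrite (_ : 2 / (eta / 2) = 4 / eta)//; field; rewrite gt_eqF.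
by rewrite mulr_ge0 ?expR_ge0// addr_ge0// divr_ge0// ltW.
Qed.

(* The rates beta < b1 < b2 < b3 < b4 < b5 < 1/v: each passage to the next one
   absorbs a polynomial factor or a cross term. *)
Variables (b1 b2 b3 : R).
Hypotheses (h01 : beta < b1) (h12 : b1 < b2) (h23 : b2 < b3).

Let beta0 : 0 < beta. Proof. by rewrite subr_gt0. Qed.
Let b1_gt0 : 0 < b1. Proof. exact: lt_trans h01. Qed.
Let b2_gt0 : 0 < b2. Proof. exact: lt_trans h12. Qed.

(** Here x is one summand, y the rest divided by rn = sqrt n.  With mean 0 and
    variance 1 the terms rn x g(y) and (1 - x^2) q(y) have mean zero, so the
    expectation of q(W) - W g(W) is that of this second-order remainder. *)
Definition stein_error z (rn x y : R) : R :=
  (stein_q gam z (y + x / rn) - stein_q gam z y) -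
  rn * x * (stein_g gam z (y + x / rn) - stein_g gam z y - x / rn * stein_q gam z y).

Local Notation K := (steinK gam b1).

(** The crossing indicator confines y to within |x / rn| of z, where the weight
    exp(b2 y^2 / 2) can be replaced by exp(b3 z^2 / 2), which no longer depends
    on y. *)
Lemma stein_error_le z (rn x y : R) : 0 < rn ->
  `|stein_error z rn x y| <=
    (2 * K / (1 + `|z|) * ((1 + x ^+ 2) * expR (youngc b1 b2 * (x / rn) ^+ 2 / 2))) *
    (`|x / rn| * expR (b2 * y ^+ 2 / 2) +
     expR (b3 * z ^+ 2 / 2) * expR (youngc b2 b3 * (x / rn) ^+ 2 / 2) *
       (`|y - z| <= `|x / rn|)%R%:R).
Proof.
move=> rn0; set r := x / rn.
have [i1 i2] := stein_increment gam0 gam1 h01 z y r.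
set I := (`|y - z| <= `|r|)%R in i1 i2 *.
set E := egauss b1 (`|y| + `|r|) in i1 i2.
have z1 : 0 < 1 + `|z| by rewrite ltr_pwDl.
have K0 : 0 <= K by exact: steinK_ge0.
have KZ : 0 <= 2 * K / (1 + `|z|) by apply: divr_ge0; [exact: mulr_ge0|exact: ltW].
have E0 : 0 <= E by exact: expR_ge0.
have x2 : `|rn * x| * `|r| = x ^+ 2.
  rewrite -normrM /r (_ : rn * x * (x / rn) = x ^+ 2) ?ger0_norm ?sqr_ge0//.
  by field; rewrite gt_eqF.
have step1 : `|stein_error z rn x y| <=
    (2 * K / (1 + `|z|)) * (1 + x ^+ 2) * (E * (`|r| + I%:R)).
  rewrite /stein_error -/r; apply: (le_trans (ler_normB _ _)).
  rewrite [`|rn * x * _|]normrM.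
  have := ler_wpM2l (normr_ge0 (rn * x)) i2.
  have -> : `|rn * x| * (2 * (K / (1 + `|z|)) * E * `|r| * (`|r| + I%:R)) =
     (2 * K / (1 + `|z|)) * x ^+ 2 * (E * (`|r| + I%:R)).
    by rewrite -x2; field; rewrite gt_eqF.
  have -> : 2 * K / (1 + `|z|) * (1 + x ^+ 2) * (E * (`|r| + I%:R)) =
      2 * (K / (1 + `|z|)) * E * (`|r| + I%:R) +
      2 * K / (1 + `|z|) * x ^+ 2 * (E * (`|r| + I%:R)).
    by field; rewrite gt_eqF.
  move=> i3; exact: lerD.
apply: (le_trans step1).
have Ele : E <= expR (youngc b1 b2 * r ^+ 2 / 2) * expR (b2 * y ^+ 2 / 2).
  rewrite /E /egauss -expRD ler_expR.
  have := young_sq b1_gt0 h12 (normr_ge0 y) (normr_ge0 r).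
  rewrite !real_normK ?num_real//.
  by move: (b1 * _) (b2 * _) (_ * r ^+ 2) => A B C h; lra.
have Ile : expR (b2 * y ^+ 2 / 2) * I%:R <=
    expR (b3 * z ^+ 2 / 2) * expR (youngc b2 b3 * r ^+ 2 / 2) * I%:R.
  rewrite /I; case: (leP `|y - z| `|r|) => hI /=; last by rewrite !mulr0.
  rewrite !mulr1 -expRD ler_expR.
  have hy : `|y| <= `|z| + `|r|.
    by rewrite -[y](subrK z) addrC (le_trans (ler_normD _ _))// lerD2l.
  have h1 : b2 * y ^+ 2 <= b2 * (`|z| + `|r|) ^+ 2.
    by rewrite ler_pM2l// -[y ^+ 2]real_normK ?num_real// ler_sqr ?nnegrE// addr_ge0.
  have := young_sq b2_gt0 h23 (normr_ge0 z) (normr_ge0 r).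
  rewrite !real_normK ?num_real//; move: h1.
  by move: (b2 * y ^+ 2) (b2 * _ ^+ 2) (b3 * _) (_ * r ^+ 2) => A B C G' h h'; lra.
rewrite [2 * K / _ * (_ * _)]mulrA -[leRHS]mulrA.
apply: ler_wpM2l; first by apply: mulr_ge0 => //; rewrite addr_ge0// sqr_ge0.
apply: (@le_trans _ _ (expR (youngc b1 b2 * r ^+ 2 / 2) * expR (b2 * y ^+ 2 / 2) * (`|r| + I%:R))).
  by rewrite ler_wpM2r// addr_ge0.
rewrite -mulrA ler_wpM2l ?expR_ge0// mulrDr [_ * `|r|]mulrC lerD2l.
exact: Ile.
Qed.

Variables (b4 b5 v : R).
Hypotheses (h34 : b3 < b4) (h45 : b4 < b5) (hv : b5 * v < 1) (v0 : 0 <= v).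

Let b3_gt0 : 0 < b3. Proof. exact: lt_trans h23. Qed.

Let below (b : R) : 0 < b -> b <= b5 -> b * v < 1.
Proof. by move=> b0 bb; apply: le_lt_trans hv; exact: ler_wpM2r. Qed.

Let b2v : b2 * v < 1. Proof. by apply: below => //; exact: ltW (lt_trans h23 (lt_trans h34 h45)). Qed.
Let b1v : b1 * v < 1. Proof. by apply: below => //; exact: ltW (lt_trans h12 (lt_trans h23 (lt_trans h34 h45))). Qed.
Let betav : beta * v < 1.
Proof. by apply: below => //; exact: ltW (lt_trans h01 (lt_trans h12 (lt_trans h23 (lt_trans h34 h45)))). Qed.

Definition cw_score z (w : R) : R := cw_psi gam w * ((w <= z)%R%:R - F z).

(** The condition on q = 1 / sqrt n says that n is large enough for all the
    factors exp(C (x q)^2) together to stay below exp(beta x^2 / 4). *)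
Lemma stein_error_arith (x q Kz G2 Cc y12 y23 z : R) : 0 <= q -> 0 <= Kz -> 0 <= G2 ->
  0 <= Cc -> 0 <= y12 -> 0 <= y23 -> (y12 / 2 + y23 / 2 + Cc) * q ^+ 2 <= beta / 4 ->
  Kz * ((1 + x ^+ 2) * expR (y12 * (x * q) ^+ 2 / 2)) *
    (`|x * q| * G2 + expR (b3 * z ^+ 2 / 2) * expR (y23 * (x * q) ^+ 2 / 2) *
      (Cc * (`|x * q| + q) * expR (Cc * `|x * q| ^+ 2) * expR (- (b3 * z ^+ 2 / 2)))) <=
  Kz * (G2 + Cc) * q * (2 * (1 + 4 / (beta / 2)) ^+ 2 * expR (beta * x ^+ 2 / 2)).
Proof.
move=> q0 K0 G0 C0 y120 y230 hq.
rewrite real_normK ?num_real//.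
have ez : expR (b3 * z ^+ 2 / 2) * expR (- (b3 * z ^+ 2 / 2)) = 1 by rewrite expRxMexpNx_1.
have bq0 : 0 < beta / 2 by rewrite divr_gt0.
have hc := cubic_le x bq0.
set r := x * q in hq *.
have r0 : 0 <= r ^+ 2 by exact: sqr_ge0.
rewrite [X in _ * (_ + X)](_ : _ = Cc * (`|r| + q) * (expR (y23 * r ^+ 2 / 2) * expR (Cc * r ^+ 2))); last first.
  transitivity (Cc * (`|r| + q) * (expR (y23 * r ^+ 2 / 2) * expR (Cc * r ^+ 2)) *
    (expR (b3 * z ^+ 2 / 2) * expR (- (b3 * z ^+ 2 / 2)))); last by rewrite ez mulr1.
  ring.
have h1 : `|r| * G2 + Cc * (`|r| + q) * (expR (y23 * r ^+ 2 / 2) * expR (Cc * r ^+ 2)) <=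
    (G2 + Cc) * (`|r| + q) * expR ((y23 / 2 + Cc) * r ^+ 2).
  have -> : expR (y23 * r ^+ 2 / 2) * expR (Cc * r ^+ 2) = expR ((y23 / 2 + Cc) * r ^+ 2).
    by rewrite -expRD; congr expR; field.
  have e1 : 1 <= expR ((y23 / 2 + Cc) * r ^+ 2).
    by rewrite -[leLHS]expR0 ler_expR; apply: mulr_ge0 => //; rewrite addr_ge0// divr_ge0.
  rewrite [(G2 + Cc) * _]mulrDl [leRHS]mulrDl lerD2r.
  apply: (@le_trans _ _ (G2 * (`|r| + q))); first by rewrite mulrC ler_wpM2l// lerDl.
  by rewrite ler_peMr// mulr_ge0// addr_ge0.
apply: (@le_trans _ _ (Kz * ((1 + x ^+ 2) * expR (y12 * r ^+ 2 / 2)) *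
   ((G2 + Cc) * (`|r| + q) * expR ((y23 / 2 + Cc) * r ^+ 2)))).
  apply: ler_wpM2l => //; apply: mulr_ge0 => //.
  by apply: mulr_ge0; [rewrite addr_ge0// sqr_ge0|exact: expR_ge0].
have rq : `|r| + q = q * (1 + `|x|) by rewrite /r normrM (ger0_norm q0); ring.
rewrite rq.
have e2 : expR (y12 * r ^+ 2 / 2) * expR ((y23 / 2 + Cc) * r ^+ 2) <= expR (beta / 2 * x ^+ 2 / 2).
  rewrite -expRD ler_expR.
  have -> : y12 * r ^+ 2 / 2 + (y23 / 2 + Cc) * r ^+ 2 = (y12 / 2 + y23 / 2 + Cc) * q ^+ 2 * x ^+ 2.
    by rewrite /r; field.
  have -> : beta / 2 * x ^+ 2 / 2 = beta / 4 * x ^+ 2 by field.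
  by apply: ler_wpM2r => //; exact: sqr_ge0.
have -> : Kz * ((1 + x ^+ 2) * expR (y12 * r ^+ 2 / 2)) *
   ((G2 + Cc) * (q * (1 + `|x|)) * expR ((y23 / 2 + Cc) * r ^+ 2)) =
   Kz * (G2 + Cc) * q * (((1 + x ^+ 2) * (1 + `|x|)) *
     (expR (y12 * r ^+ 2 / 2) * expR ((y23 / 2 + Cc) * r ^+ 2))).
  by move: (expR _) (expR _) => e3 e4; ring.
apply: ler_wpM2l; first by apply: mulr_ge0 => //; apply: mulr_ge0 => //; exact: addr_ge0.
have -> : expR (beta * x ^+ 2 / 2) = expR (beta / 2 * x ^+ 2 / 2) * expR (beta / 2 * x ^+ 2 / 2).
  by rewrite -expRD; congr expR; field.
rewrite [leRHS]mulrA; apply: ler_pM => //.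
- by apply: mulr_ge0; rewrite addr_ge0// sqr_ge0.
Qed.

(** Integrate over y first: the Gaussian moment handles the smooth part, the
    concentration inequality the crossings of z, where its decay in z cancels
    exp(b3 z^2 / 2).  Every term keeps a factor |x| / sqrt n or 1 / sqrt n. *)
Lemma stein_error_mean : exists C n0, 0 <= C /\ forall P, standard v P ->
  forall n z, (n0 <= n.+1)%N ->
  (\int[P \x sum_law P n]_p `|stein_error z (Num.sqrt n.+1%:R) p.1 ((p.2 : R) / Num.sqrt n.+1%:R)|%:E <=
    (C / (1 + `|z|) / Num.sqrt n.+1%:R)%:E)%E.
Proof.
have [Cc Cc0 hC] := sum_law_concentration v0 b3_gt0 h34 h45 hv.
pose G2 := gaussc v b2.
pose C3 := youngc b1 b2 / 2 + youngc b2 b3 / 2 + Cc.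
pose C4 := 2 * (1 + 4 / (beta / 2)) ^+ 2.
pose n0 := (Num.truncn (4 * C3 / beta)).+1.
have y12 : 0 <= youngc b1 b2 by exact: youngc_ge0.
have y23 : 0 <= youngc b2 b3 by exact: youngc_ge0.
have C30 : 0 <= C3 by rewrite !addr_ge0 ?divr_ge0.
have G20 : 0 <= G2 by exact: sqrtr_ge0.
have K0 : 0 <= K by exact: steinK_ge0.
have C40 : 0 <= C4 by rewrite mulr_ge0// sqr_ge0.
pose C := 2 * K * (G2 + Cc) * C4 * gaussc v beta.
have C0 : 0 <= C.
  by apply: mulr_ge0; [apply: mulr_ge0 => //; apply: mulr_ge0; [exact: mulr_ge0|exact: addr_ge0]|exact: sqrtr_ge0].
exists C, n0; split=> // P sP n z nn0; have [sg mean var] := sP.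
set rn := Num.sqrt n.+1%:R.
have rn0 : 0 < rn by rewrite sqrtr_gt0 ltr0n.
have rnE : rn ^+ 2 = n.+1%:R by rewrite sqr_sqrtr ?ler0n.
have z1 : 0 < 1 + `|z| by rewrite ltr_pwDl.
have C3n : C3 / rn ^+ 2 <= beta / 4.
  rewrite rnE ler_pdivrMr ?ltr0n//.
  have : 4 * C3 / beta < n.+1%:R.
    have c0 : 0 <= 4 * C3 / beta by rewrite divr_ge0 ?mulr_ge0// ltW.
    have /andP[_] := truncn_itv c0 => /lt_le_trans; apply.
    by rewrite ler_nat.
  rewrite ltr_pdivrMr// => h; move: h; move: (n.+1%:R) => N h; lra.
pose A (x : R) := 2 * K / (1 + `|z|) * ((1 + x ^+ 2) * expR (youngc b1 b2 * (x / rn) ^+ 2 / 2)).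
pose H (x : R) := expR (b3 * z ^+ 2 / 2) * expR (youngc b2 b3 * (x / rn) ^+ 2 / 2).
have A0 x : 0 <= A x.
  apply: mulr_ge0; first by apply: divr_ge0; [exact: mulr_ge0|exact: ltW].
  by apply: mulr_ge0; [rewrite addr_ge0// sqr_ge0|exact: expR_ge0].
have H0 x : 0 <= H x by rewrite mulr_ge0 ?expR_ge0.
have mA : measurable_fun setT (fun x : M => A x) by rewrite /A; mfun.
have mH : measurable_fun setT (fun x : M => H x) by rewrite /H; mfun.
pose Bd (p : M * M) := A p.1 * (`|(p.1 : R) / rn| * expR (b2 * ((p.2 : R) / rn) ^+ 2 / 2) +
    H p.1 * (`|(p.2 : R) / rn - z| <= `|(p.1 : R) / rn|)%R%:R).
have mI : measurable_fun setT (fun p : M * M => (`|(p.2 : R) / rn - z| <= `|(p.1 : R) / rn|)%R%:R : R).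
  have -> : (fun p : M * M => (`|(p.2 : R) / rn - z| <= `|(p.1 : R) / rn|)%R%:R : R) =
      (fun p : M * M => (`|(p.2 : R) / rn - z| - `|(p.1 : R) / rn| <= 0)%R%:R).
    by apply/funext => p; rewrite subr_le0.
  by apply: measurable_indic_le; mfun.
have mBd : measurable_fun setT Bd by rewrite /Bd; mfun.
have Bd0 p : 0 <= Bd p.
  by apply: mulr_ge0 => //; apply: addr_ge0; apply: mulr_ge0 => //; exact: expR_ge0.
have mq := measurable_stein_q z; have mg := measurable_stein_g z.
have mD : measurable_fun setT (fun p : M * M => stein_error z rn p.1 ((p.2 : R) / rn)).
  by rewrite /stein_error; mfun.
apply: (@le_trans _ _ (\int[P \x sum_law P n]_p (Bd p)%:E)%E).
  apply: ge0_le_int => //; first by mfun.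
  by move=> p; exact: stein_error_le.
rewrite ge0_int_prod//.
pose U (x : R) := 2 * K / (1 + `|z|) * (G2 + Cc) / rn * (C4 * expR (beta * x ^+ 2 / 2)).
apply: (@le_trans _ _ (\int[P]_x (U x)%:E)%E); last first.
  have mU : measurable_fun setT (fun x : M => C4 * expR (beta * (x : R) ^+ 2 / 2)) by mfun.
  have c0 : 0 <= 2 * K / (1 + `|z|) * (G2 + Cc) / rn.
    apply: divr_ge0; last exact: ltW.
    apply: mulr_ge0; last exact: addr_ge0.
    by apply: divr_ge0; [exact: mulr_ge0|exact: ltW].
  rewrite /U ge0_intZl//; last by move=> x; rewrite mulr_ge0 ?expR_ge0.
  rewrite ge0_intZl//; last by mfun.
  rewrite (_ : C / (1 + `|z|) / rn = 2 * K / (1 + `|z|) * (G2 + Cc) / rn * (C4 * gaussc v beta)); last first.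
    by rewrite /C; field; rewrite !gt_eqF.
  rewrite [leRHS]EFinM; apply: lee_wpmul2l; first by rewrite lee_fin.
  rewrite [leRHS]EFinM; apply: lee_wpmul2l; first by rewrite lee_fin.
  exact: subgaussian_sq.
apply: ge0_le_integral => //.
- by move=> x _; apply: integral_ge0 => y _; rewrite lee_fin.
- have h := measurable_fun_fubini_tonelli_F (m2 := sum_law P n) (EFin \o Bd).
  by apply: h; [exact/measurable_EFinP|move=> p; rewrite lee_fin].
- by rewrite /U; mfun.
move=> x _; rewrite /Bd /=.
have q0 : 0 < rn^-1 by rewrite invr_gt0.
have m1 : measurable_fun setT (fun s : M => expR (b2 * ((s : R) / rn) ^+ 2 / 2)) by mfun.
have m2 : measurable_fun setT (fun s : M => (`|(s : R) / rn - z| <= `|x / rn|)%R%:R : R).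
  by apply: measurable_indic_le; mfun.
have M2 : (\int[sum_law P n]_s (expR (b2 * ((s : R) / rn) ^+ 2 / 2))%:E <= G2%:E)%E.
  exact: sum_law_gauss_moment.
have MC := hC P sP n z `|x / rn| (normr_ge0 _).
rewrite ge0_intZl//; last 2 first.
- by apply: measurable_funD; apply: measurable_funM.
- by move=> s; apply: addr_ge0; apply: mulr_ge0 => //; exact: expR_ge0.
under eq_integral do rewrite EFinD.
rewrite ge0_integralD//; last 3 first.
- by apply/measurable_EFinP; apply: measurable_funM.
- by move=> s _; rewrite lee_fin; exact: mulr_ge0.
- by apply/measurable_EFinP; apply: measurable_funM.
rewrite ge0_intZl// ge0_intZl//.
have R0 : 0 <= `|x / rn| by [].
apply: (@le_trans _ _ ((A x)%:E * (`|x / rn|%:E * G2%:E + (H x)%:E *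
   (Cc * (`|x / rn| + rn^-1) * expR (Cc * `|x / rn| ^+ 2) * expR (- (b3 * z ^+ 2 / 2)))%:E))%E).
  apply: lee_wpmul2l; first by rewrite lee_fin.
  by apply: leeD; apply: lee_wpmul2l => //; rewrite lee_fin.
set T := Cc * (`|x / rn| + rn^-1) * expR (Cc * `|x / rn| ^+ 2) * expR (- (b3 * z ^+ 2 / 2)).
have -> : ((A x)%:E * (`|x / rn|%:E * G2%:E + (H x)%:E * T%:E) =
    (A x * (`|x / rn| * G2 + H x * T))%:E)%E by [].
rewrite lee_fin /T /U /A /H.
apply: stein_error_arith => //; first exact: ltW.
- by apply: divr_ge0; [exact: mulr_ge0|exact: ltW].
- by rewrite exprVn.
Qed.

Lemma egauss_sq (w : R) : egauss b1 `|w| = expR (b1 * w ^+ 2 / 2).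
Proof. by rewrite /egauss real_normK ?num_real. Qed.

Lemma cw_scoreE z w : cw_score z w = stein_q gam z w - w * stein_g gam z w.
Proof. by rewrite stein_qE. Qed.

Lemma integrable_gauss_dominated P j n (h : R -> R) c : standard v P -> (0 < n)%N ->
  (j <= n)%N -> measurable_fun setT h -> (forall w, `|h w| <= c * expR (b1 * w ^+ 2 / 2)) ->
  (sum_law P j).-integrable setT (EFin \o (fun s : M => h ((s : R) / Num.sqrt n%:R))).
Proof.
move=> [sg _ _] n0 jn mh hb.
have c0 : 0 <= c.
  have := le_trans (normr_ge0 _) (hb 0).
  by rewrite expr0n /= mulr0 mul0r expR0 mulr1.
have m1 : measurable_fun setT (fun s : M => expR (b1 * ((s : R) / Num.sqrt n%:R) ^+ 2 / 2)) by mfun.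
have [i1 _] := ge0_Rint_le m1 (fun=> expR_ge0 _) (sum_law_gauss_moment v0 sg n0 jn b1_gt0 b1v).
apply: (dominated_integrable (g := fun s : M => c * expR (b1 * ((s : R) / Num.sqrt n%:R) ^+ 2 / 2))).
- by mfun.
- by move=> s; exact: hb.
- by have := integrableZl measurableT c i1; apply: eq_integrable.
Qed.

Lemma measurable_cw_score z : measurable_fun setT (cw_score z).
Proof.
have -> : cw_score z = fun w => stein_q gam z w - w * stein_g gam z w.
  by apply/funext => w; exact: cw_scoreE.
have mq := measurable_stein_q z; have mg := measurable_stein_g z; by mfun.
Qed.

(** Stein's identity: by the exchange identity the mean score is the mean of
    stein_error. *)
Lemma cw_score_large : exists C n0, 0 <= C /\ forall P, standard v P ->
  forall n z, (n0 <= n.+1)%N ->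
  `|\int[sum_law P n.+1]_s cw_score z ((s : R) / Num.sqrt n.+1%:R)| <=
    C / (1 + `|z|) / Num.sqrt n.+1%:R.
Proof.
have [C [n0 [C0 H]]] := stein_error_mean.
exists C, n0; split=> // P sP n z nn0; have [sg mean var] := sP.
have HB := H P sP n z nn0; move: HB; set rn := Num.sqrt n.+1%:R => HB.
have rn0 : 0 < rn by rewrite sqrtr_gt0 ltr0n.
have rnE : rn ^+ 2 = n.+1%:R by rewrite sqr_sqrtr ?ler0n.
pose q := stein_q gam z; pose g := stein_g gam z.
have mq : measurable_fun setT q := measurable_stein_q z.
have mg : measurable_fun setT g := measurable_stein_g z.
pose K' := K / (1 + `|z|).
have qb w : `|q w| <= K' * expR (b1 * w ^+ 2 / 2).
  by rewrite -egauss_sq; exact: stein_q_le.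
have gb w : `|g w| <= K' * expR (b1 * w ^+ 2 / 2).
  by rewrite -egauss_sq; exact: stein_g_le.
have mqs : measurable_fun setT (fun s : M => q ((s : R) / rn)) by mfun.
have mgs : measurable_fun setT (fun s : M => g ((s : R) / rn)) by mfun.
pose Pi : probability (M * M)%type R := (P \x sum_law P n)%E.
have iqW := integrable_gauss_dominated sP (ltn0Sn n) (leqnn _) mq qb.
have [iq1 eq1] := sum_lawS_Rint mqs iqW.
have iqY := integrable_gauss_dominated sP (ltn0Sn n) (leqnSn n) mq qb.
have igY := integrable_gauss_dominated sP (ltn0Sn n) (leqnSn n) mg gb.
have i1x : P.-integrable setT (EFin \o (fun x : M => 1 - (x : R) ^+ 2)).
  have := integrableB measurableT (finite_measure_integrable_cst P 1 measurableT) (integrable_pow 2 sg).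
  by apply: eq_integrable.
have e1x : \int[P]_x (1 - (x : R) ^+ 2) = 0.
  rewrite RintegralB//; last 2 first.
  - exact: finite_measure_integrable_cst.
  - exact: integrable_pow.
  by rewrite var Rintegral_cst//= probability_setT /= mulr1 subrr.
have i2 := integrable_prodM i1x iqY.
have e2 := Rint_prodM i1x iqY; rewrite e1x mul0r in e2.
have i3 := integrable_prodM (integrable_id sg) igY.
have e3 := Rint_prodM (integrable_id sg) igY; rewrite mean mul0r in e3.
pose D (p : M * M) := stein_error z rn p.1 ((p.2 : R) / rn).
have mD : measurable_fun setT D.
  by rewrite /D /stein_error -/q -/g; mfun.
have mDn : measurable_fun setT (fun p => `|D p|) by mfun.
have [iD bD] := @norm_Rint_le _ _ _ Pi D (fun p => `|D p|) _ mD mDn (fun p => lexx _) HB.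
have xgE (p : M * M) : rn * ((p.1 : R) * g (((p.1 : R) + (p.2 : R)) / rn)) =
    q (((p.1 : R) + (p.2 : R)) / rn) - (1 - (p.1 : R) ^+ 2) * q ((p.2 : R) / rn) +
    rn * ((p.1 : R) * g ((p.2 : R) / rn)) - D p.
  rewrite /D /stein_error -/q -/g [p.2 / rn + p.1 / rn]addrC -mulrDl.
  move: (q _) (q _) (g _) (g _) => q1 q2 g1 g2; field; rewrite gt_eqF//.
have i3' : Pi.-integrable setT (EFin \o (fun p : M * M => rn * ((p.1 : R) * g ((p.2 : R) / rn)))).
  by have := integrableZl measurableT rn i3; apply: eq_integrable.
have i12 : Pi.-integrable setT (EFin \o (fun p : M * M => q (((p.1 : R) + (p.2 : R)) / rn) - (1 - (p.1 : R) ^+ 2) * q ((p.2 : R) / rn))).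
  by have := integrableB measurableT iq1 i2; apply: eq_integrable.
have i123 : Pi.-integrable setT (EFin \o (fun p : M * M => q (((p.1 : R) + (p.2 : R)) / rn) - (1 - (p.1 : R) ^+ 2) * q ((p.2 : R) / rn) +
    rn * ((p.1 : R) * g ((p.2 : R) / rn)))).
  by have := integrableD measurableT i12 i3'; apply: eq_integrable.
have ixg : Pi.-integrable setT (EFin \o (fun p : M * M => rn * ((p.1 : R) * g (((p.1 : R) + (p.2 : R)) / rn)))).
  have := integrableB measurableT i123 iD; apply: eq_integrable => // p _.
  by rewrite /= xgE.
have exg : \int[Pi]_p (rn * ((p.1 : R) * g (((p.1 : R) + (p.2 : R)) / rn))) =
    \int[sum_law P n.+1]_s q ((s : R) / rn) - \int[Pi]_p D p.
  rewrite (eq_Rint _ xgE) RintegralB// RintegralD// RintegralB//.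
  rewrite (RintegralZl rn measurableT i3) e2 e3 mulr0 subr0 addr0; congr (_ - _).
  exact: esym eq1.
have ixg' : Pi.-integrable setT (EFin \o (fun p : M * M => (p.1 : R) * g (((p.1 : R) + (p.2 : R)) / rn))).
  have := integrableZl measurableT rn^-1 ixg; apply: eq_integrable => // p _ /=.
  by rewrite -EFinM mulKf// gt_eqF.
have [iS eS] := sum_law_exchange mgs ixg'.
have iS' : (sum_law P n.+1).-integrable setT (EFin \o (fun s : M => (s : R) / rn * g ((s : R) / rn))).
  have := integrableZl measurableT rn^-1 iS; apply: eq_integrable => // s _ /=.
  by rewrite -EFinM mulrA [rn^-1 * s]mulrC.
have -> : \int[sum_law P n.+1]_s cw_score z ((s : R) / rn) = \int[Pi]_p D p.
  rewrite (@eq_Rint _ _ _ (sum_law P n.+1) _ (fun s : M => q ((s : R) / rn) - (s : R) / rn * g ((s : R) / rn))); last first.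
    by move=> s; exact: cw_scoreE.
  rewrite (RintegralB measurableT iqW iS').
  have -> : \int[sum_law P n.+1]_s ((s : R) / rn * g ((s : R) / rn)) =
     \int[Pi]_p (rn * ((p.1 : R) * g (((p.1 : R) + (p.2 : R)) / rn))).
    rewrite (RintegralZl rn measurableT ixg').
    rewrite (@eq_Rint _ _ _ (sum_law P n.+1) _ (fun s : M => rn^-1 * ((s : R) * g ((s : R) / rn)))); last first.
      by move=> s; rewrite mulrA [rn^-1 * s]mulrC.
    rewrite (RintegralZl rn^-1 measurableT iS) eS -rnE expr2 -mulrA mulKf// gt_eqF//.
  by rewrite exg; exact: subKr.
exact: bD.
Qed.

End subcritical.

(** * The rate below the critical temperature *)
Section subcritical_rate.
Context (R : realType) (gam : R).
Hypotheses (gam0 : 0 < gam) (gam1 : gam < 1).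
Local Notation M := (measurableTypeR R).
Local Notation beta := (1 - gam).
Local Notation F := (ncdf gam).

(** For w <= z this is the tail bound; for w > z it is the same bound after
    reflection. *)
Lemma centered_indic_weight z w :
  `|(w <= z)%R%:R - F z| * (1 + `|z|) <= tailc gam * (1 + `|w|).
Proof.
have [wz|zw] := leP w z => /=.
  rewrite ger0_norm ?subr_ge0 ?ncdf_le1//; exact: tail_weight.
rewrite sub0r normrN ger0_norm ?ncdf_ge0//.
have h : - w <= - z by rewrite lerN2 ltW.
have := tail_weight gam0 h; rewrite !normrN ncdfN// opprB addrC subrK//.
Qed.

Lemma cw_score_le b1 z w : beta < b1 ->
  `|cw_score gam z w| <= tailc gam * polyc gam b1 / (1 + `|z|) * expR (b1 * w ^+ 2 / 2).
Proof.
move=> h1; have z1 : 0 < 1 + `|z| by rewrite ltr_pwDl.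
have t0 : 0 <= tailc gam by exact: le_trans (tailc_ge1 gam0).
have p0 : 0 <= cw_psi gam w by exact: expR_ge0.
rewrite /cw_score normrM (ger0_norm p0) mulrAC ler_pdivlMr//.
rewrite -[leLHS]mulrA -[tailc gam * polyc gam b1 * _]mulrA.
apply: (@le_trans _ _ (cw_psi gam w * (tailc gam * (1 + `|w|)))).
  by apply: ler_wpM2l => //; exact: centered_indic_weight.
rewrite mulrCA; apply: ler_wpM2l => //.
apply: le_trans (poly_psi h1 w).
rewrite mulrC; apply: ler_wpM2r => //.
by rewrite ler_eXnr// lerDl.
Qed.

Variables (b1 b2 b3 b4 b5 v : R).
Hypotheses (h01 : beta < b1) (h12 : b1 < b2) (h23 : b2 < b3).
Hypotheses (h34 : b3 < b4) (h45 : b4 < b5) (hv : b5 * v < 1) (v0 : 0 <= v).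

Let b1_gt0 : 0 < b1. Proof. by apply: lt_trans h01; rewrite subr_gt0. Qed.
Let b1v : b1 * v < 1.
Proof.
apply: le_lt_trans hv; apply: ler_wpM2r => //.
exact: ltW (lt_trans h12 (lt_trans h23 (lt_trans h34 h45))).
Qed.

(** For the finitely many small n the crude bound on the score suffices, since
    then 1 is at most sqrt n0 / sqrt n. *)
Lemma cw_score_mean : exists2 C, 0 <= C & forall P, standard v P -> forall n z,
  `|\int[sum_law P n.+1]_s cw_score gam z ((s : R) / Num.sqrt n.+1%:R)| <=
    C / (1 + `|z|) / Num.sqrt n.+1%:R.
Proof.
have [C [n0 [C0 H]]] := cw_score_large gam0 gam1 h01 h12 h23 h34 h45 hv v0.
pose C1 := tailc gam * polyc gam b1 * gaussc v b1.
have t0 : 0 <= tailc gam by exact: le_trans (tailc_ge1 gam0).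
have q0 : 0 <= polyc gam b1 by rewrite /polyc addr_ge0// divr_ge0// subr_ge0 ltW.
have C10 : 0 <= C1 by rewrite !mulr_ge0// sqrtr_ge0.
have D0 : 0 <= C1 * Num.sqrt n0%:R by rewrite mulr_ge0// sqrtr_ge0.
exists (C + C1 * Num.sqrt n0%:R); first exact: addr_ge0.
move=> P sP n z.
have z1 : 0 < 1 + `|z| by rewrite ltr_pwDl.
have rn0 : 0 < Num.sqrt n.+1%:R :> R by rewrite sqrtr_gt0 ltr0n.
have [n0n|nn0] := leqP n0 n.+1.
  apply: (le_trans (H P sP n z n0n)).
  by rewrite ler_pM2r ?invr_gt0// ler_pM2r ?invr_gt0// lerDl.
have [sg _ _] := sP.
have ms := measurable_cw_score gam0 z.
have m1 : measurable_fun setT (fun s : M => cw_score gam z ((s : R) / Num.sqrt n.+1%:R)) by mfun.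
have m3 : measurable_fun setT (fun s : M => expR (b1 * ((s : R) / Num.sqrt n.+1%:R) ^+ 2 / 2)) by mfun.
have m2 : measurable_fun setT (fun s : M => tailc gam * polyc gam b1 / (1 + `|z|) * expR (b1 * ((s : R) / Num.sqrt n.+1%:R) ^+ 2 / 2)) by mfun.
have k0 : 0 <= tailc gam * polyc gam b1 / (1 + `|z|).
  by apply: divr_ge0; [exact: mulr_ge0|exact: ltW].
have g : (\int[sum_law P n.+1]_s (tailc gam * polyc gam b1 / (1 + `|z|) * expR (b1 * ((s : R) / Num.sqrt n.+1%:R) ^+ 2 / 2))%:E <= (C1 / (1 + `|z|))%:E)%E.
  rewrite ge0_intZl//.
  have -> : C1 / (1 + `|z|) = tailc gam * polyc gam b1 / (1 + `|z|) * gaussc v b1.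
    by rewrite /C1; field; rewrite gt_eqF.
  rewrite [leRHS]EFinM; apply: lee_wpmul2l; first by rewrite lee_fin.
  exact: sum_law_gauss_moment.
have [_] := norm_Rint_le m1 m2 (fun s => cw_score_le z ((s : R) / Num.sqrt n.+1%:R) h01) g.
move=> hb; apply: (le_trans hb).
rewrite -[leRHS]mulrA [_^-1 / _]mulrC mulrA; apply: ler_wpM2r; first by rewrite invr_ge0 ltW.
rewrite ler_pdivlMr//; apply: (@le_trans _ _ (C1 * Num.sqrt n0%:R)); last by rewrite lerDr.
by apply: ler_wpM2l => //; rewrite ler_wsqrtr// ler_nat ltnW.
Qed.

(** The difference of the two distribution functions is the mean score divided
    by the normalizing constant, which is at least 1. *)
Lemma subcritical_rate : exists2 C, 0 <= C & forall P, standard v P -> forall n z,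
  let m := sum_law P n.+1 in
  let W := fun s : M => (s : R) / Num.sqrt n.+1%:R in
  [/\ m.-integrable setT (EFin \o (fun s => cw_psi gam (W s))),
      m.-integrable setT (EFin \o (fun s => cw_psi gam (W s) * (W s <= z)%R%:R)) &
      `| (\int[m]_s cw_psi gam (W s))^-1 * \int[m]_s (cw_psi gam (W s) * (W s <= z)%R%:R) - F z|
        <= C / (1 + `|z|) / Num.sqrt n.+1%:R].
Proof.
have [C C0 H] := cw_score_mean.
exists C => // P sP n z m W; have HC := H P sP n z.
have psi_le w : `|cw_psi gam w| <= 1 * expR (b1 * w ^+ 2 / 2).
  rewrite ger0_norm ?expR_ge0// mul1r ler_expR.
  apply: ler_wpM2r => //; apply: ler_wpM2r; [exact: sqr_ge0|exact: ltW].
have mpsi : measurable_fun setT (cw_psi gam) by rewrite /cw_psi; mfun.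
have ip := integrable_gauss_dominated gam1 h01 h12 h23 h34 h45 hv v0 sP (ltn0Sn n) (leqnn _) mpsi psi_le.
have mi : measurable_fun setT (fun w : R => (w <= z)%R%:R : R).
  exact: (@measurable_indic_le R z _ R id).
have mpi : measurable_fun setT (fun w : R => cw_psi gam w * (w <= z)%R%:R) by mfun.
have pi_le w : `|cw_psi gam w * (w <= z)%R%:R| <= 1 * expR (b1 * w ^+ 2 / 2).
  apply: le_trans (psi_le w); rewrite normrM ler_piMr//.
  by case: (w <= z); rewrite /= ?normr1 ?normr0.
have ipi := integrable_gauss_dominated gam1 h01 h12 h23 h34 h45 hv v0 sP (ltn0Sn n) (leqnn _) mpi pi_le.
split => //.
set K := \int[m]_s cw_psi gam (W s).
set I := \int[m]_s (cw_psi gam (W s) * (W s <= z)%R%:R).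
have K1 : 1 <= K.
  have -> : 1 = \int[m]_s (1 : R).
    by rewrite Rintegral_cst//= probability_setT /= mulr1.
  apply: le_Rint => //; first exact: finite_measure_integrable_cst.
  move=> s; rewrite -[leLHS]expR0 ler_expR divr_ge0// mulr_ge0 ?sqr_ge0//.
  by rewrite subr_ge0 ltW.
have e : \int[m]_s cw_score gam z (W s) = I - F z * K.
  rewrite (@eq_Rint _ _ _ m _ (fun s => cw_psi gam (W s) * (W s <= z)%R%:R - F z * cw_psi gam (W s))); last first.
    by move=> s; rewrite /cw_score; ring.
  rewrite RintegralB//; last by have := integrableZl measurableT (F z) ip; apply: eq_integrable.
  by rewrite (RintegralZl (F z) measurableT ip).
have K0 : 0 < K by exact: lt_le_trans K1.
have -> : K^-1 * I - F z = K^-1 * (I - F z * K) by field; rewrite gt_eqF.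
rewrite normrM ger0_norm ?invr_ge0 ?(ltW K0)//.
rewrite -e; apply: le_trans HC.
by rewrite ler_piMl// invf_le1.
Qed.

End subcritical_rate.

Section part_one.
Context (R : realType).
Local Notation M := (measurableTypeR R).

Lemma standard_dmeas (L : distribution_function R) v :
  subgaussian v (dmeas L) ->
  (\int[dmeas L]_x (x : R)%:E = 0)%E ->
  (\int[dmeas L]_x ((x : R) ^+ 2)%:E = 1)%E -> standard v (dmeas L).
Proof. by move=> sg h1 h2; split=> //; rewrite /Rintegral ?h1 ?h2. Qed.

(** Five equally spaced rates fit between beta and b; any step below
    (b - beta)/5 would do. *)
Lemma cw_subcritical (beta b : R) : 0 < beta < 1 -> beta < b ->
  exists C : R, forall L : distribution_function R,
    standard b^-1 (dmeas L) ->
    forall n : nat, (1 <= n)%N ->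
    forall (d : measure_display) (Omega : measurableType d)
      (P : probability Omega R) (X : 'I_n -> {RV P >-> R}),
    has_cw_law L beta X -> forall z : R,
    (`| P [set w | ((\sum_(i < n) X i w) / Num.sqrt n%:R <= z)%R] - normal_limit_cdf beta z |
      <= (C / (1 + (1 - beta) * `|z|) * (1 / Num.sqrt n%:R))%:E)%E.
Proof.
move=> /andP[bt0 bt1] bb.
have b0 : 0 < b by exact: lt_trans bb.
pose gam := 1 - beta.
have gam0 : 0 < gam by rewrite subr_gt0.
have gam1 : gam < 1 by rewrite ltrBlDl ltrDr.
have gE : 1 - gam = beta by rewrite /gam subKr.
pose e := (b - beta) / 8.
have e0 : 0 < e by rewrite divr_gt0// subr_gt0.
have hv : (beta + 5 * e) * b^-1 < 1.
  rewrite ltr_pdivrMr// mul1r /e; lra.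
have h01 : 1 - gam < beta + 1 * e by rewrite gE; lra.
have h12 : beta + 1 * e < beta + 2 * e by lra.
have h23 : beta + 2 * e < beta + 3 * e by lra.
have h34 : beta + 3 * e < beta + 4 * e by lra.
have h45 : beta + 4 * e < beta + 5 * e by lra.
have v0 : 0 <= b^-1 by rewrite invr_ge0 ltW.
have [C C0 H] := subcritical_rate gam0 gam1 h01 h12 h23 h34 h45 hv v0.
exists C => L sL [//|n] _ d Omega P X cw z.
have [i1 i2] := H _ sL n z.
set m := sum_law (dmeas L) n.+1 in i1 i2 *.
set rn := Num.sqrt n.+1%:R in i1 i2 *.
have rn0 : 0 < rn by rewrite sqrtr_gt0 ltr0n.
have rnE : rn ^+ 2 = n.+1%:R by rewrite sqr_sqrtr ?ler0n.
pose B : set M := [set s : M | (s : R) / rn <= z].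
have mB : measurable B.
  have mf : measurable_fun setT (fun s : M => (s : R) / rn) by mfun.
  have := mf measurableT _ (measurable_itv `]-oo, z]); rewrite setTI.
  by congr measurable; apply/seteqP; split=> s /=; rewrite in_itv.
have := cw_law_sum cw mB.
have wE s : expR (beta * s ^+ 2 / (2 * n.+1%:R)) = cw_psi gam (s / rn).
  rewrite /cw_psi gE expr_div_n rnE; congr expR.
  by field; rewrite gt_eqF ?ltr0n.
under eq_integral do rewrite wE.
under [X in (_ * X)%E]eq_integral do rewrite wE.
have -> : (fun s : M => (cw_psi gam ((s : R) / rn) * \1_B s)%:E) =
    (fun s : M => (cw_psi gam ((s : R) / rn) * ((s : R) / rn <= z)%R%:R)%:E).
  apply/funext => s; rewrite indicE; congr (_ * _%:R)%:E.
  by rewrite mem_setE.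
rewrite -/m -(EFin_Rint i1) -(EFin_Rint i2) -EFinM /= => ->.
rewrite /normal_limit_cdf -/gam normal_probE// -EFinB lee_fin => hz.
apply: (le_trans hz); rewrite mul1r; apply: ler_wpM2r; first by rewrite invr_ge0 ltW.
apply: ler_wpM2l => //; rewrite lef_pV2 ?posrE; last 2 first.
- by rewrite ltr_pwDl.
- by rewrite ltr_pwDl// mulr_ge0// ltW.
by rewrite lerD2l ler_piMl// ltW.
Qed.

End part_one.

(** * The moment generating function of the normal law *)
Section normal_mgf.
Context (R : realType).
Local Notation M := (measurableTypeR R).
Local Notation leb := (@lebesgue_measure R).
Local Notation N01 := (normal_prob 0 1 : probability M R).

Lemma ge0_int_normal (f : R -> R) : measurable_fun setT f -> (forall x, 0 <= f x) ->
  (\int[N01]_x (f x)%:E = \int[leb]_x (f x * normal_pdf 0 1 x)%:E)%E.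
Proof.
move=> mf f0.
have mfE : measurable_fun setT (EFin \o f) by exact/measurable_EFinP.
have dom := @normal_prob_dominates R 0 1.
rewrite -(Radon_Nikodym_SigmaFinite.change_of_variables dom (f := EFin \o f))//.
have mp := measurable_normal_pdf (R := R) 0 1.
have iRN := Radon_Nikodym_SigmaFinite.f_integrable dom.
under [RHS]eq_integral do rewrite EFinM.
apply: ae_eq_integral => //.
- by apply: emeasurable_funM => //; exact: (measurable_int leb).
- by apply: emeasurable_funM => //; exact/measurable_EFinP.
- apply: ae_eqe_mul2l.
  apply: integral_ae_eq => //.
  + exact/measurable_EFinP.
  + move=> E ET mE; rewrite -Radon_Nikodym_SigmaFinite.f_integral//.
Qed.

Lemma normal_mgf t :
  (\int[N01]_x (expR (t * (x : R)))%:E = (expR (t ^+ 2 / 2))%:E)%E.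
Proof.
rewrite ge0_int_normal; [|by mfun|by move=> x; exact: expR_ge0].
have g0 : 0 < gnorm (1 : R) by exact: gnorm_gt0.
have H := gauss_integral t (@ltr01 R).
under eq_integral.
  move=> x _.
  rewrite normal_pdfE ?oner_neq0// /normal_fun /normal_peak expr1n subr0 mul1r.
  rewrite (_ : expR _ * _ = (gnorm 1)^-1 * expR (t * x - 1 * x ^+ 2 / 2)); last first.
    rewrite mulrCA -expRD; congr (_ * expR _); last by ring.
    by rewrite /gnorm; congr (Num.sqrt _)^-1; rewrite -mulr_natl; field.
  over.
rewrite ge0_intZl//; last first.
  by rewrite invr_ge0 ltW.
  mfun.
rewrite H -EFinM mulKf ?gt_eqF//; congr (expR _)%:E; by field.
Qed.

Lemma subgaussian_normal : subgaussian 1 N01.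
Proof. by move=> t; rewrite normal_mgf mul1r. Qed.

End normal_mgf.

(** * Taylor expansion of the Gaussian defect *)
Section taylor.
Context (R : realType).

Lemma norm_le_between0 (u x : R) : Num.min 0 u <= x <= Num.max 0 u -> `|x| <= `|u|.
Proof.
case: (lerP 0 u) => u0 /andP[h1 h2]; first by rewrite !ger0_norm.
by rewrite !ler0_norm ?lerN2// ltW.
Qed.

(** Taylor's bound for a flat function, with G j the j-th derivative: integrate
    the bound on G m.+1 back to G 0, one mean value theorem at a time. *)
Lemma flat_bound (G : nat -> R -> R) (m : nat) (b B : R) :
  (forall j, (j <= m)%N -> forall x : R, is_derive (x : R) (1 : R) (G j) (G j.+1 x)) ->
  (forall j, (j <= m)%N -> G j 0 = 0) ->
  (forall x, `|x| <= b -> `|G m.+1 x| <= B) ->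
  forall u, `|u| <= b -> `|G 0 u| <= B * `|u| ^+ m.+1.
Proof.
elim: m G => [|m IH] G dG G0 GB u ub.
  have := @mean_value_bound R (G 0) (G 1) 0 u B (dG 0%N (leqnn _)).
  rewrite G0// !subr0 expr1; apply=> x xu.
  by apply: GB; apply: le_trans ub; exact: norm_le_between0.
have B0 : 0 <= B by apply: le_trans (GB 0 _); rewrite ?normr0 ?(le_trans _ ub).
have IHG := IH (fun j => G j.+1) (fun j jm => dG j.+1 jm) (fun j jm => G0 j.+1 jm) GB.
have := @mean_value_bound R (G 0) (G 1) 0 u (B * `|u| ^+ m.+1) (dG 0%N (leq0n _)).
rewrite G0// !subr0 -mulrA -exprSr; apply=> x xu.
have xu' := norm_le_between0 xu.
apply: (le_trans (IHG x (le_trans xu' ub))).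
by rewrite ler_wpM2l// lerXn2r ?nnegrE.
Qed.

End taylor.

Section moments.
Context (R : realType).
Local Notation M := (measurableTypeR R).
Implicit Types (P : probability M R) (v : R).

(** The j-th derivative of the moment generating function, under the integral
    sign. *)
Definition expm P j (s : R) : R := \int[P]_x ((x : R) ^+ j * expR (s * (x : R))).

Lemma expm_dom (s b x : R) j : `|s| <= b ->
  `|x ^+ j * expR (s * x)| <= `|x| ^+ j * expR (b * `|x|).
Proof.
move=> sb; rewrite normrM normrX (ger0_norm (expR_ge0 _)); apply: ler_wpM2l.
  exact: exprn_ge0.
rewrite ler_expR; apply: le_trans (ler_norm _) _; rewrite normrM.
exact: ler_wpM2r.
Qed.

Lemma integrable_expm v P j s : subgaussian v P ->
  P.-integrable setT (EFin \o (fun x : M => (x : R) ^+ j * expR (s * (x : R)))).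
Proof.
move=> sg; apply: (dominated_integrable (g := fun x : M => `|x : R| ^+ j * expR (`|s| * `|x : R|))).
- by mfun.
- by move=> x; exact: expm_dom.
- exact: integrable_pow_expR sg.
Qed.

Lemma expm_bound v P j s b : subgaussian v P -> `|s| <= b ->
  `|expm P j s| <= j`!%:R * (2 * expR (v * (b + 1) ^+ 2 / 2)).
Proof.
move=> sg sb; have b0 : 0 <= b by exact: le_trans sb.
have := @norm_Rint_le _ _ _ P (fun x : M => (x : R) ^+ j * expR (s * (x : R)))
  (fun x : M => `|x : R| ^+ j * expR (b * `|x : R|)) _ _ _ _ (moment_expR j b0 sg).
case=> //; [by mfun|by mfun|by move=> x; exact: expm_dom].
Qed.

Lemma is_derive_monexp (x : R) j (s : R) :
  is_derive (s : R) (1 : R) (fun t : R => x ^+ j * expR (t * x)) (x ^+ j.+1 * expR (s * x)).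
Proof. by apply: is_derive_eq; rewrite /GRing.scale /= exprS; ring. Qed.

Lemma is_derive_expm v P j (s : R) : subgaussian v P ->
  is_derive (s : R) (1 : R) (expm P j) (expm P j.+1 s).
Proof.
move=> sg.
pose f (t : R) (x : M) : R := (x : R) ^+ j * expR (t * (x : R)).
have d1 t x : partial1of2 f t x = (x : R) ^+ j.+1 * expR (t * (x : R)).
  by rewrite /partial1of2 derive1E; have h := is_derive_monexp x j t; rewrite derive_val.
pose Gd (x : M) : R := `|x : R| ^+ j.+1 * expR ((`|s| + 1) * `|x : R|).
have Is : [set` `]s - 1, s + 1[] s by rewrite /= in_itv /=; apply/andP; split; lra.
have i1 t : [set` `]s - 1, s + 1[] t -> P.-integrable setT (EFin \o f t).
  by move=> _; exact: integrable_expm sg.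
have i2 t x : [set` `]s - 1, s + 1[] t -> setT x -> derivable (f ^~ x) t 1.
  by move=> _ _; have h := is_derive_monexp x j t; exact: ex_derive.
have G0 x : 0 <= Gd x by rewrite mulr_ge0 ?exprn_ge0 ?expR_ge0.
have iG : P.-integrable setT (EFin \o Gd) by apply: integrable_pow_expR sg; rewrite addr_ge0.
have Gu t x : [set` `]s - 1, s + 1[] t -> setT x -> `|partial1of2 f t x| <= Gd x.
  move=> /=; rewrite in_itv /= => /andP[h1 h2] _; rewrite d1; apply: expm_dom.
  rewrite -[t](subrK s) addrC (le_trans (ler_normD _ _))// lerD2l.
  by rewrite ler_norml; apply/andP; split; lra.
have D := derivable_under_integral measurableT Is i1 i2 G0 iG Gu.
have E := differentiation_under_integral measurableT Is i1 i2 G0 iG Gu.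
apply: DeriveDef; first exact: D.
by rewrite -derive1E E /expm; apply: eq_Rint => x; rewrite d1.
Qed.

(** A syntax closed under differentiation that contains the derivatives of the
    logarithm of the moment generating function M: Mom j stands for its j-th
    derivative and InvM for 1/M.  Working with expressions gives three facts on
    derivatives of every order at once: they exist, they are bounded uniformly
    over subgaussian laws, and their values at 0 depend on finitely many
    moments. *)
Inductive tilt_expr := Mom of nat | InvM | Var | Cst of R
  | Add of tilt_expr & tilt_expr | Mul of tilt_expr & tilt_expr | Opp of tilt_expr.

Fixpoint tilt_eval P e (s : R) : R := match e with
  | Mom j => expm P j s
  | InvM => (expm P 0 s)^-1
  | Var => s
  | Cst c => c
  | Add e1 e2 => tilt_eval P e1 s + tilt_eval P e2 s
  | Mul e1 e2 => tilt_eval P e1 s * tilt_eval P e2 s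
  | Opp e1 => - tilt_eval P e1 s
  end.

Fixpoint tilt_deriv e := match e with
  | Mom j => Mom j.+1
  | InvM => Opp (Mul (Mom 1) (Mul InvM InvM))
  | Var => Cst 1
  | Cst _ => Cst 0
  | Add e1 e2 => Add (tilt_deriv e1) (tilt_deriv e2)
  | Mul e1 e2 => Add (Mul (tilt_deriv e1) e2) (Mul e1 (tilt_deriv e2))
  | Opp e1 => Opp (tilt_deriv e1)
  end.

Fixpoint tilt_order e := match e with
  | Mom j => j
  | InvM | Var | Cst _ => 0%N
  | Add e1 e2 | Mul e1 e2 => maxn (tilt_order e1) (tilt_order e2)
  | Opp e1 => tilt_order e1
  end.

(** Jensen's inequality, from exp(s x) >= 1 + s x. *)
Lemma expm0_ge1 v P s : subgaussian v P -> \int[P]_x (x : R) = 0 -> 1 <= expm P 0 s.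
Proof.
move=> sg mean.
have ii := integrable_id sg.
have i1 : P.-integrable setT (EFin \o (fun x : M => s * (x : R))).
  by have := integrableZl measurableT s ii; apply: eq_integrable.
have i2 : P.-integrable setT (EFin \o (fun x : M => 1 + s * (x : R))).
  have := integrableD measurableT (finite_measure_integrable_cst P 1 measurableT) i1.
  by apply: eq_integrable.
have -> : 1 = \int[P]_x (1 + s * (x : R)).
  rewrite RintegralD//; last exact: finite_measure_integrable_cst.
  by rewrite Rintegral_cst//= probability_setT /= (RintegralZl s measurableT ii) mean mulr0 mulr1 addr0.
apply: le_Rint => //; first exact: integrable_expm sg.
by move=> x; rewrite expr0 mul1r; exact: expR_ge1Dx.
Qed.

Lemma is_derive_tilt v P e (s : R) : subgaussian v P -> \int[P]_x (x : R) = 0 ->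
  is_derive (s : R) (1 : R) (tilt_eval P e) (tilt_eval P (tilt_deriv e) s).
Proof.
move=> sg mean; elim: e => [j||||e1 h1 e2 h2|e1 h1 e2 h2|e1 h1].
- exact: is_derive_expm sg.
- have M0 : expm P 0 s != 0 by rewrite gt_eqF// (lt_le_trans ltr01)// (expm0_ge1 s sg mean).
  have dM := is_derive_expm 0 s sg.
  apply: is_derive_eq => /=; first exact: (is_deriveV M0).
  by rewrite /GRing.scale /=; field.
- exact: is_derive_id.
- move=> c; exact: is_derive_cst.
- exact: is_deriveD.
- have hM := is_deriveM h1 h2.
  suff <- : tilt_eval P e1 s *: tilt_eval P (tilt_deriv e2) s +
      tilt_eval P e2 s *: tilt_eval P (tilt_deriv e1) s =
      tilt_eval P (tilt_deriv (Mul e1 e2)) s by exact: hM.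
  by rewrite /GRing.scale /=; ring.
- exact: is_deriveN.
Qed.

Lemma tilt_bound v e b : exists C, forall P, subgaussian v P -> \int[P]_x (x : R) = 0 ->
  forall s, `|s| <= b -> `|tilt_eval P e s| <= C.
Proof.
elim: e => [j||||e1 [C1 h1] e2 [C2 h2]|e1 [C1 h1] e2 [C2 h2]|e1 [C1 h1]].
- by eexists => P sg _ s sb; exact: expm_bound sg sb.
- exists 1 => P sg mean s _ /=; have h := expm0_ge1 s sg mean.
  have h0 : 0 < expm P 0 s by exact: lt_le_trans h.
  by rewrite ger0_norm ?invr_ge0 ?(ltW h0)// invf_le1.
- by exists b.
- by move=> c; exists `|c|.
- exists (C1 + C2) => P sg mean s sb /=.
  apply: le_trans (ler_normD _ _) _; exact: lerD (h1 P sg mean s sb) (h2 P sg mean s sb).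
- exists (C1 * C2) => P sg mean s sb /=; rewrite normrM.
  exact: ler_pM (h1 P sg mean s sb) (h2 P sg mean s sb).
- by exists C1 => P sg mean s sb /=; rewrite normrN; exact: h1.
Qed.

(** Each differentiation reveals at most one more moment. *)
Lemma tilt_order_deriv e : (tilt_order (tilt_deriv e) <= (tilt_order e).+1)%N.
Proof.
elim: e => //= [e1 h1 e2 h2|e1 h1 e2 h2]; rewrite -maxnSS.
  by rewrite geq_max !leq_max h1 h2 orbT.
by rewrite !geq_max !leq_max h1 h2 !leqnSn /= !orbT.
Qed.

Lemma tilt_eval0 P (Q : probability M R) e m : (tilt_order e <= m)%N ->
  (forall j, (j <= m)%N -> \int[P]_x ((x : R) ^+ j) = \int[Q]_x ((x : R) ^+ j)) ->
  tilt_eval P e 0 = tilt_eval Q e 0.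
Proof.
have E0 P' j : expm P' j 0 = \int[P']_x ((x : R) ^+ j).
  by apply: eq_Rint => x; rewrite mul0r expR0 mulr1.
move=> om H; elim: e om => [j||||e1 h1 e2 h2|e1 h1 e2 h2|e1 h1] //=.
- by move=> jm; rewrite !E0 H.
- by move=> _; rewrite !E0 H.
- by rewrite geq_max => /andP[/h1-> /h2->].
- by rewrite geq_max => /andP[/h1-> /h2->].
- by move=> o1; rewrite h1.
Qed.

End moments.

Section defect.
Context (R : realType).
Local Notation M := (measurableTypeR R).
Local Notation N01 := (normal_prob 0 1 : probability M R).
Implicit Types (P : probability M R).

(** It vanishes identically for the standard normal law, so its Taylor
    coefficients at 0 measure how far the moments are from normal ones. *)
Definition gauss_defect P (s : R) : R := s ^+ 2 / 2 - ln (\int[P]_x expR (s * (x : R))).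

Definition defect_deriv1 : tilt_expr R := Add (Var R) (Opp (Mul (Mom R 1) (InvM R))).

Definition defect_deriv P j : R -> R := match j with
  | 0 => gauss_defect P
  | i.+1 => tilt_eval P (iter i (@tilt_deriv R) defect_deriv1)
  end.

Lemma expm0E P s : expm P 0 s = \int[P]_x expR (s * (x : R)).
Proof. by apply: eq_Rint => x; rewrite expr0 mul1r. Qed.

Lemma gauss_defectE P : gauss_defect P = fun s => s ^+ 2 / 2 - ln (expm P 0 s).
Proof. by apply/funext => s; rewrite expm0E. Qed.

Lemma is_derive_defect P j (s : R) : subgaussian 1 P -> \int[P]_x (x : R) = 0 ->
  is_derive (s : R) (1 : R) (defect_deriv P j) (defect_deriv P j.+1 s).
Proof.
move=> sg mean; case: j => [|j]; last exact: is_derive_tilt sg mean.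
rewrite [defect_deriv P 0]gauss_defectE.
have dM := is_derive_expm 0 s sg.
have M0 : 0 < expm P 0 s by exact: lt_le_trans (expm0_ge1 s sg mean).
have dL := is_derive1_comp (is_derive1_ln M0) dM.
have d2 : is_derive (s : R) (1 : R) (fun s : R => s ^+ 2 / 2) s.
  by apply: is_derive_eq; rewrite /GRing.scale /=; field.
have h := is_deriveB d2 dL; apply: (is_derive_eq h).
by rewrite /= mulrC.
Qed.

Lemma derive1n_defect P j : subgaussian 1 P -> \int[P]_x (x : R) = 0 ->
  derive1n j (gauss_defect P) = defect_deriv P j.
Proof.
move=> sg mean; elim: j => [|j IH]; first by rewrite derive1n0.
rewrite derive1nS IH; apply/funext => s; rewrite derive1E.
by have h := is_derive_defect j s sg mean; rewrite derive_val.
Qed.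

Lemma expm0_normal s : expm N01 0 s = expR (s ^+ 2 / 2).
Proof. by rewrite expm0E /Rintegral normal_mgf. Qed.

(** Read off the derivative of exp(s^2/2) at 0. *)
Lemma mean_normal : \int[N01]_x (x : R) = 0.
Proof.
have d := is_derive_expm 0 0 (@subgaussian_normal R).
have -> : \int[N01]_x (x : R) = expm N01 1 0.
  by apply: eq_Rint => x; rewrite mul0r expR0 mulr1 expr1.
have <- := @derive_val _ _ _ _ _ _ _ d.
have -> : expm N01 0 = fun s => expR (s ^+ 2 / 2).
  by apply/funext => s; exact: expm0_normal.
have d2 : is_derive (0 : R) (1 : R) (fun s : R => expR (s ^+ 2 / 2)) 0.
  by apply: is_derive_eq; rewrite /GRing.scale /=; ring.
by rewrite derive_val.
Qed.

Lemma defect_deriv_normal j s : defect_deriv N01 j s = 0.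
Proof.
rewrite -(derive1n_defect j (@subgaussian_normal R) mean_normal).
have -> : gauss_defect N01 = fun=> 0.
  by apply/funext => t; rewrite gauss_defectE expm0_normal expRK subrr.
elim: j s => [|j IH] s; first by rewrite derive1n0.
rewrite derive1nS (_ : derive1n j _ = fun=> 0); last by apply/funext => t; exact: IH.
by rewrite derive1_cst.
Qed.

Lemma tilt_order_defect i : (tilt_order (iter i (@tilt_deriv R) defect_deriv1) <= i.+1)%N.
Proof.
elim: i => //= i IH; apply: leq_trans (tilt_order_deriv _) _; by rewrite ltnS.
Qed.

(** The j-th derivative at 0 is a function of the first j moments, and that
    function vanishes at the normal moments. *)
Lemma defect_deriv0 P m j : (j < m)%N ->
  (forall i, (i < m)%N -> \int[P]_x ((x : R) ^+ i) = \int[N01]_x ((x : R) ^+ i)) ->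
  defect_deriv P j 0 = 0.
Proof.
case: j => [|j] jm H.
  rewrite /= /gauss_defect expr0n /= mul0r sub0r (_ : \int[P]_x _ = 1) ?ln1 ?oppr0//.
  rewrite (@eq_Rint _ _ _ P _ (fun=> 1)); last by move=> x; rewrite mul0r expR0.
  by rewrite Rintegral_cst//= probability_setT /= mulr1.
transitivity (defect_deriv N01 j.+1 0); last exact: defect_deriv_normal.
apply: (tilt_eval0 (tilt_order_defect j)).
by move=> i ij; apply: H; exact: leq_ltn_trans jm.
Qed.

Lemma is_derive_monomial (c : R) n (x : R) :
  is_derive (x : R) (1 : R) (fun x : R => c * x ^+ n) (c * n%:R * x ^+ n.-1).
Proof.
have h := is_deriveX n (is_derive_id x (1 : R)).
have h' := is_deriveZ c h.
rewrite (_ : c * n%:R * x ^+ n.-1 = c *: ((n%:R * x ^+ n.-1) *: 1)).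
  rewrite (_ : (fun x : R => _) = (c \*: id ^+ n)%R); first exact: h'.
  by apply/funext => y; rewrite /= exprfctE.
by rewrite /GRing.scale /=; ring.
Qed.

(** If the moments are normal below order m, the defect has no terms below
    order m.  Subtracting its term of order m leaves a flat function, and the
    bound on the derivative of order m.+1 is uniform in P. *)
Lemma defect_expansion (m : nat) (b : R) : 0 <= b -> exists2 C, 0 <= C &
  forall P, subgaussian 1 P -> \int[P]_x (x : R) = 0 ->
  (forall i, (i < m)%N -> \int[P]_x ((x : R) ^+ i) = \int[N01]_x ((x : R) ^+ i)) ->
  let c := derive1n m (gauss_defect P) 0 / m`!%:R in
  forall u, `|u| <= b -> `|gauss_defect P u - c * u ^+ m| <= C * `|u| ^+ m.+1.
Proof.
move=> b0.
have [C hC] := tilt_bound 1 (iter m (@tilt_deriv R) defect_deriv1) b.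
exists `|C| => // P sg mean mom c u ub.
pose G j (x : R) := defect_deriv P j x - c * ((m ^_ j)%:R * x ^+ (m - j)).
have -> : gauss_defect P u - c * u ^+ m = G 0 u by rewrite /G ffactn0 mul1r subn0.
apply: (@flat_bound R G m b) => //.
- move=> j jm x.
  have d1 := is_derive_defect j x sg mean.
  have d2 : is_derive (x : R) (1 : R) (fun x : R => c * ((m ^_ j)%:R * x ^+ (m - j))) (c * ((m ^_ j.+1)%:R * x ^+ (m - j.+1))).
    have h := is_derive_monomial (c * (m ^_ j)%:R) (m - j) x.
    rewrite ffactnSr natrM subnS [c * _](_ : _ = c * (m ^_ j)%:R * (m - j)%:R * x ^+ (m - j).-1); last by ring.
    by rewrite (_ : (fun x : R => _) = fun x : R => c * (m ^_ j)%:R * x ^+ (m - j))//; apply/funext => y; rewrite mulrA.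
  exact: is_deriveB d1 d2.
- move=> j; rewrite leq_eqVlt => /orP[/eqP ->|jm].
    rewrite /G subnn expr0 mulr1 ffactnn /c (derive1n_defect m sg mean) divfK ?subrr//.
  by rewrite /G (defect_deriv0 jm mom) expr0n subn_eq0 leqNgt jm /= !mulr0 subrr.
- move=> x xb; rewrite /G ffact_small// mul0r mulr0 subr0.
  by apply: le_trans (hC P sg mean x xb) _; exact: ler_norm.
Qed.

End defect.

(** * Gaussian smoothing *)
Section smoothing.
Context (R : realType).
Local Notation M := (measurableTypeR R).
Local Notation leb := (@lebesgue_measure R).
Variables (m : probability M R) (A kap : R) (f : R -> R).
Hypothesis A0 : 0 < A.

(** A joint weight in which, given s, the variable v is normal with mean
    kap s and variance 1/A.  Its integral over v is proportional to
    exp(A (kap s)^2 / 2), the Curie-Weiss weight in the application, while its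
    integral over s is a moment generating function times a Gaussian. *)
Definition hs_kernel (s v : R) : R := expR (A * (kap * s) * v - A * v ^+ 2 / 2).

Hypothesis mf : measurable_fun setT f.
Hypothesis fE : forall v, (\int[m]_s (hs_kernel s v)%:E = (f v)%:E)%E.

Lemma hs_marginal_ge0 v : 0 <= f v.
Proof.
by rewrite -lee_fin -fE; apply: integral_ge0 => s _; rewrite lee_fin expR_ge0.
Qed.

Lemma measurable_hs_kernel :
  measurable_fun setT (fun p : M * M => hs_kernel p.1 p.2).
Proof. by rewrite /hs_kernel; mfun. Qed.

Lemma hs_int_left (h : R -> R) : measurable_fun setT h -> (forall x, 0 <= h x) ->
  (\int[m]_s \int[leb]_v (hs_kernel s v * h s)%:E =
   \int[m]_s (gnorm A * (expR (A * (kap * (s : R)) ^+ 2 / 2) * h s))%:E)%E.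
Proof.
move=> mh h0; apply: eq_integral => s _.
under eq_integral do rewrite mulrC.
rewrite ge0_intZl//; [|by rewrite /hs_kernel; mfun|by move=> x; exact: expR_ge0].
rewrite gauss_integral// -EFinM; congr (_%:E).
have -> : (A * (kap * s)) ^+ 2 / (2 * A) = A * (kap * s) ^+ 2 / 2.
  by field; rewrite gt_eqF.
by rewrite mulrCA [h s * _]mulrC.
Qed.

Lemma hs_int_right (h : R -> R) : measurable_fun setT h -> (forall x, 0 <= h x) ->
  (\int[m]_s \int[leb]_v (hs_kernel s v * h v)%:E = \int[leb]_v (f v * h v)%:E)%E.
Proof.
move=> mh h0; have mk := measurable_hs_kernel.
have := @ge0_int_swap _ _ M M R m leb (fun p => hs_kernel p.1 p.2 * h p.2).
move=> /= ->; last 2 first.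
- by mfun.
- by move=> p; rewrite mulr_ge0 ?expR_ge0.
apply: eq_integral => v _.
under eq_integral do rewrite mulrC.
rewrite ge0_intZl//; last 2 first.
- by rewrite /hs_kernel; mfun.
- by move=> s; exact: expR_ge0.
by rewrite fE -EFinM mulrC.
Qed.

(** If z separates w and v, then (v - w)^2 >= (v - z)^2 + (w - z)^2. *)
Lemma hs_cross_pointwise (z w v : R) : (w <= z) != (v <= z) ->
  A * w * v - A * v ^+ 2 / 2 <=
  A * w ^+ 2 / 2 - A * (w - z) ^+ 2 / 2 + (A * z * v - A * v ^+ 2 / 2 - A * z ^+ 2 / 2).
Proof.
move=> h; have k : 0 <= (v - z) * (z - w).
  move: h; have [wz|zw] := leP w z; have [vz|zv] := leP v z => // _.
    by rewrite mulr_ge0 ?subr_ge0 ?(ltW zv).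
  by rewrite mulr_le0// subr_le0 ?(ltW zw).
have := mulr_ge0 (ltW A0) k.
rewrite -subr_ge0; move=> h2; rewrite -subr_ge0.
apply: (le_trans h2); rewrite le_eqVlt; apply/orP; left; apply/eqP.
by field.
Qed.

Lemma measurable_separates (b : bool) (z : R) :
  measurable_fun setT (fun v : R => (b != (v <= z))%:R : R).
Proof.
have mv : measurable_fun setT (fun v : R => (v <= z)%R%:R : R).
  exact: (@measurable_indic_le R z _ R id).
case: b; last first.
  have -> // : (fun v : R => (false != (v <= z)%R)%:R) = fun v => (v <= z)%R%:R :> R.
  by apply/funext => v; case: (v <= z).
have -> : (fun v : R => (true != (v <= z)%R)%:R) = fun v => 1 - (v <= z)%R%:R :> R.
  by apply/funext => v; case: (v <= z); rewrite /= ?subrr ?subr0.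
by mfun.
Qed.

Lemma gnorm_three_halves : gnorm A <= 2 * gnorm (3 * A / 2).
Proof.
have p0 : 0 < pi / A :> R by rewrite divr_gt0// pi_gt0.
have e1 : 2 * pi / A = 2 * (pi / A) by rewrite mulrA.
have e2 : 2 * pi / (3 * A / 2) = 4 / 3 * (pi / A) by field; rewrite gt_eqF.
rewrite -ler_sqr ?nnegrE ?mulr_ge0 ?sqrtr_ge0//.
rewrite exprMn /gnorm e1 e2 !sqr_sqrtr; last 2 first.
- by move: p0; move: (pi / A) => x x0; lra.
- by move: p0; move: (pi / A) => x x0; lra.
by move: p0; move: (pi / A) => x x0; rewrite expr2; lra.
Qed.

(** For fixed s both sides are explicit Gaussian integrals, and the exponent on
    the right exceeds the one on the left by A (w - z)^2 / 3 with
    w = kap s. *)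
Lemma hs_cross_int (z s : R) :
  (\int[leb]_v (hs_kernel s v * ((kap * s <= z) != (v <= z))%:R)%:E <=
   \int[leb]_v (hs_kernel s v * (2 * expR (- (A * (v - z) ^+ 2 / 4))))%:E)%E.
Proof.
set w := kap * s.
have mi : measurable_fun setT (fun v : R => ((w <= z) != (v <= z))%:R : R).
  exact: measurable_separates.
pose E1 := expR (A * w ^+ 2 / 2 - A * (w - z) ^+ 2 / 2 - A * z ^+ 2 / 2).
apply: (@le_trans _ _ (\int[leb]_v (E1 * expR (A * z * v - A * v ^+ 2 / 2))%:E)%E).
  apply: ge0_le_int; [by rewrite /hs_kernel; mfun|by mfun|by move=> v; rewrite mulr_ge0 ?expR_ge0|].
  move=> v; case: (boolP (_ != _)) => h /=; last by rewrite mulr0 mulr_ge0 ?expR_ge0.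
  rewrite mulr1 /E1 -expRD ler_expR; apply: le_trans (hs_cross_pointwise h) _.
  rewrite le_eqVlt; apply/orP; left; apply/eqP; by ring.
rewrite ge0_intZl; [|by mfun|exact: expR_ge0|by move=> v; exact: expR_ge0].
rewrite gauss_integral// -EFinM.
have e v : hs_kernel s v * (2 * expR (- (A * (v - z) ^+ 2 / 4))) =
    2 * expR (- (A * z ^+ 2 / 4)) * expR (A * (w + z / 2) * v - 3 * A / 2 * v ^+ 2 / 2).
  rewrite mulrCA -[RHS]mulrA -!expRD; congr (_ * expR _); rewrite -/w.
  by field.
under [leRHS]eq_integral do rewrite e.
have A30 : 0 < 3 * A / 2 by rewrite divr_gt0// mulr_gt0.
rewrite ge0_intZl; [|by mfun|by rewrite mulr_ge0 ?expR_ge0|by move=> v; exact: expR_ge0].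
rewrite gauss_integral// -EFinM lee_fin.
rewrite mulrCA -expRD.
have -> : 2 * expR (- (A * z ^+ 2 / 4)) * (gnorm (3 * A / 2) *
   expR ((A * (w + z / 2)) ^+ 2 / (2 * (3 * A / 2)))) =
   2 * gnorm (3 * A / 2) * expR (- (A * z ^+ 2 / 4) + (A * (w + z / 2)) ^+ 2 / (2 * (3 * A / 2))).
  by rewrite expRD; move: (gnorm _) (expR _) (expR _) => x y t; ring.
apply: ler_pM; [exact: ltW (gnorm_gt0 A0)|exact: expR_ge0|exact: gnorm_three_halves|].
rewrite ler_expR -subr_ge0.
rewrite (_ : _ - _ = A * (w - z) ^+ 2 / 3); last by field; rewrite gt_eqF.
by rewrite divr_ge0// mulr_ge0 ?sqr_ge0// ltW.
Qed.

Hypothesis fi : leb.-integrable setT (EFin \o f).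

Lemma hs_integrableM (g : R -> R) : measurable_fun setT g ->
  (forall v, 0 <= g v <= 1) -> leb.-integrable setT (EFin \o (fun v => f v * g v)).
Proof.
move=> mg gb; apply: (@dominated_integrable _ M R leb _ f) => //; first by mfun.
move=> v; have /andP[g0 g1] := gb v.
by rewrite normrM !ger0_norm ?hs_marginal_ge0// ler_piMr// hs_marginal_ge0.
Qed.

Lemma hs_integrable_expR : m.-integrable setT
  (EFin \o (fun s : M => expR (A * (kap * (s : R)) ^+ 2 / 2))).
Proof.
have g0 := gnorm_gt0 A0.
have m1 : measurable_fun setT (fun s : M => expR (A * (kap * (s : R)) ^+ 2 / 2)) by mfun.
apply: (proj1 (@ge0_Rint_le _ _ _ _ _ ((gnorm A)^-1 * \int[leb]_v f v) m1 (fun=> expR_ge0 _) _)).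
have := hs_int_left (@measurable_cst _ _ _ _ setT (1 : R)) (fun=> ler01).
have := hs_int_right (@measurable_cst _ _ _ _ setT (1 : R)) (fun=> ler01).
move=> -> h; rewrite EFinM EFin_Rint//.
under [X in (_ * X)%E]eq_integral do rewrite -[f _]mulr1.
rewrite h.
under [X in (_ * X)%E]eq_integral do rewrite mulr1.
rewrite ge0_intZl; [|by mfun|exact: ltW|by move=> s; exact: expR_ge0].
by rewrite muleA -EFinM mulVf ?gt_eqF// mul1e.
Qed.

Lemma hs_total : gnorm A * \int[m]_s expR (A * (kap * (s : R)) ^+ 2 / 2) = \int[leb]_v f v.
Proof.
have g0 := gnorm_gt0 A0.
have := hs_int_left (@measurable_cst _ _ _ _ setT (1 : R)) (fun=> ler01).
rewrite (hs_int_right (@measurable_cst _ _ _ _ setT (1 : R)) (fun=> ler01)).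
under eq_integral do rewrite mulr1.
under [RHS]eq_integral do rewrite mulr1.
rewrite ge0_intZl; [|by mfun|exact: ltW|by move=> s; exact: expR_ge0].
move=> h; apply: EFin_inj.
by rewrite EFinM (EFin_Rint fi) (EFin_Rint hs_integrable_expR) h.
Qed.

(** The distribution function of kap s differs from that of v by at most the
    mass of the event that z separates them, which hs_cross_int bounds by the
    mass that the marginal f of v puts near z. *)
Lemma hs_smoothing z :
  `|gnorm A * \int[m]_s (expR (A * (kap * (s : R)) ^+ 2 / 2) * (kap * (s : R) <= z)%R%:R) -
    \int[leb]_v (f v * (v <= z)%R%:R)| <=
  \int[leb]_v (f v * (2 * expR (- (A * (v - z) ^+ 2 / 4)))).
Proof.
have g0 := gnorm_gt0 A0.
have mi : measurable_fun setT (fun v : R => (v <= z)%R%:R : R).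
  exact: (@measurable_indic_le R z _ R id).
have mis : measurable_fun setT (fun s : M => (kap * (s : R) <= z)%R%:R : R).
  by apply: measurable_indic_le; mfun.
have i0 (b : bool) : 0 <= b%:R :> R by [].
pose g v := 2 * expR (- (A * (v - z) ^+ 2 / 4)).
have mg : measurable_fun setT g by rewrite /g; mfun.
have ge0 v : 0 <= g v by rewrite mulr_ge0 ?expR_ge0.
set w := fun s : M => kap * (s : R).
have iI : leb.-integrable setT (EFin \o (fun v => f v * (v <= z)%R%:R)).
  by apply: hs_integrableM => // v; case: (v <= z); rewrite lexx ler01.
have ig : leb.-integrable setT (EFin \o (fun v => f v * g v)).
  have me : measurable_fun setT (fun v : R => expR (- (A * (v - z) ^+ 2 / 4))) by mfun.
  have h : leb.-integrable setT (EFin \o (fun v => f v * expR (- (A * (v - z) ^+ 2 / 4)))).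
    apply: hs_integrableM me _ => v.
    by rewrite expR_ge0 expR_le1 oppr_le0 divr_ge0// mulr_ge0 ?sqr_ge0// ltW.
  have := integrableZl measurableT 2 h; apply: eq_integrable => // v _.
  by rewrite /= -EFinM /g mulrCA.
have m1 : measurable_fun setT (fun s : M => expR (A * w s ^+ 2 / 2) * (w s <= z)%R%:R).
  by rewrite /w; mfun.
have iW : m.-integrable setT (EFin \o (fun s : M => expR (A * w s ^+ 2 / 2) * (w s <= z)%R%:R)).
  apply: (dominated_integrable m1 _ hs_integrable_expR) => s.
  rewrite normrM !ger0_norm ?expR_ge0// ler_piMr ?expR_ge0//.
  by case: (w s <= z).
have mk := measurable_hs_kernel.
have mkl s : measurable_fun setT (fun v : R => hs_kernel s v) by rewrite /hs_kernel; mfun.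
pose X : \bar R := (\int[m]_s \int[leb]_v (hs_kernel s v * (w s <= z)%R%:R)%:E)%E.
pose Y : \bar R := (\int[m]_s \int[leb]_v (hs_kernel s v * (v <= z)%R%:R)%:E)%E.
pose Z : \bar R := (\int[m]_s \int[leb]_v (hs_kernel s v * g v)%:E)%E.
have XE : X = (gnorm A * \int[m]_s (expR (A * w s ^+ 2 / 2) * (w s <= z)%R%:R))%:E.
  rewrite /X hs_int_left//.
  rewrite ge0_intZl; [|by []|exact: ltW|by move=> s; rewrite mulr_ge0 ?expR_ge0].
  by rewrite EFinM EFin_Rint.
have YE : Y = (\int[leb]_v (f v * (v <= z)%R%:R))%:E.
  by rewrite /Y hs_int_right// EFin_Rint.
have ZE : Z = (\int[leb]_v (f v * g v))%:E.
  by rewrite /Z hs_int_right// EFin_Rint.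
have mI (p : M * M -> R) : measurable_fun setT p -> (forall q, 0 <= p q) ->
    measurable_fun setT (fun s : M => \int[leb]_v (p (s, v))%:E)%E.
  move=> mp p0; have h := measurable_fun_fubini_tonelli_F (m2 := leb) (EFin \o p).
  by apply: h; [exact/measurable_EFinP|move=> q; rewrite lee_fin].
have k0 s v : 0 <= hs_kernel s v by exact: expR_ge0.
have cross (p q : R -> R -> R) :
   measurable_fun setT (fun x : M * M => p x.1 x.2) ->
   measurable_fun setT (fun x : M * M => q x.1 x.2) ->
   (forall s v, 0 <= p s v) -> (forall s v, 0 <= q s v) ->
   (forall s v, p s v <= q s v + ((kap * s <= z) != (v <= z))%:R) ->
   (\int[m]_s \int[leb]_v (hs_kernel s v * p s v)%:E <=
    \int[m]_s \int[leb]_v (hs_kernel s v * q s v)%:E + Z)%E.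
  move=> mp mq p0 q0 pq.
  have mKp : measurable_fun setT (fun x : M * M => hs_kernel x.1 x.2 * p x.1 x.2) by mfun.
  have mKq : measurable_fun setT (fun x : M * M => hs_kernel x.1 x.2 * q x.1 x.2) by mfun.
  have mKg : measurable_fun setT (fun x : M * M => hs_kernel x.1 x.2 * g x.2) by mfun.
  have sec (r : R -> R -> R) : measurable_fun setT (fun x : M * M => hs_kernel x.1 x.2 * r x.1 x.2) ->
      forall s, measurable_fun setT (fun v : M => hs_kernel s v * r s v).
    by move=> mr s; exact: measurableT_comp mr (pair1_measurable s).
  have mdv s : measurable_fun setT (fun v : R => ((kap * s <= z) != (v <= z))%:R : R).
    exact: measurable_separates.
  rewrite -ge0_integralD//; last 4 first.
  - by move=> s _; apply: integral_ge0 => v _; rewrite lee_fin mulr_ge0.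
  - apply: (mI (fun x => hs_kernel x.1 x.2 * q x.1 x.2)) => // x; exact: mulr_ge0.
  - by move=> s _; apply: integral_ge0 => v _; rewrite lee_fin mulr_ge0.
  - apply: (mI (fun x => hs_kernel x.1 x.2 * g x.2)) => // x; exact: mulr_ge0.
  apply: ge0_le_integral => //.
  - by move=> s _; apply: integral_ge0 => v _; rewrite lee_fin mulr_ge0.
  - apply: (mI (fun x => hs_kernel x.1 x.2 * p x.1 x.2)) => // x; exact: mulr_ge0.
  - apply: emeasurable_funD.
      apply: (mI (fun x => hs_kernel x.1 x.2 * q x.1 x.2)) => // x; exact: mulr_ge0.
    apply: (mI (fun x => hs_kernel x.1 x.2 * g x.2)) => // x; exact: mulr_ge0.
  move=> s _.
  apply: (@le_trans _ _ (\int[leb]_v (hs_kernel s v * q s v)%:E +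
     \int[leb]_v (hs_kernel s v * ((kap * s <= z) != (v <= z))%:R)%:E)%E); last first.
    by apply: leeD => //; exact: hs_cross_int.
  rewrite -ge0_integralD//; last 4 first.
  - by move=> v _; rewrite lee_fin mulr_ge0.
  - by apply/measurable_EFinP; exact: sec mKq s.
  - by move=> v _; rewrite lee_fin mulr_ge0.
  - by apply/measurable_EFinP; exact: (measurable_funM (mkl s) (mdv s)).
  apply: ge0_le_integral => //.
  - by move=> v _; rewrite lee_fin mulr_ge0.
  - by apply/measurable_EFinP; exact: sec mKp s.
  - apply: emeasurable_funD; apply/measurable_EFinP; first exact: sec mKq s.
    exact: (measurable_funM (mkl s) (mdv s)).
  by move=> v _; rewrite -EFinD lee_fin -mulrDr ler_wpM2l.
have mp : measurable_fun setT (fun x : M * M => (kap * (x.1 : R) <= z)%R%:R : R).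
  by apply: measurable_indic_le; mfun.
have mq : measurable_fun setT (fun x : M * M => ((x.2 : R) <= z)%R%:R : R).
  by apply: measurable_indic_le; mfun.
have b1 (a b : bool) : a%:R <= b%:R + (a != b)%:R :> R.
  by rewrite -natrD ler_nat; case: a; case: b.
have XY : (X <= Y + Z)%E.
  by apply: (cross (fun s _ => (kap * s <= z)%R%:R) (fun _ v => (v <= z)%R%:R)).
have YX : (Y <= X + Z)%E.
  apply: (cross (fun _ v => (v <= z)%R%:R) (fun s _ => (kap * s <= z)%R%:R)) => // s v.
  by rewrite -natrD ler_nat; case: (v <= z); case: (kap * s <= z).
move: XY YX; rewrite XE YE ZE -!EFinD !lee_fin => XY YX.
by rewrite ler_distl; apply/andP; split; [rewrite lerBlDr|].
Qed.

End smoothing.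

(** * Comparison of densities with light tails *)
Section weights.
Context (R : realType) (b : R).
Hypothesis b_gt0 : 0 < b.
Local Notation M := (measurableTypeR R).
Local Notation leb := (@lebesgue_measure R).
Implicit Types (g : R -> R).

Lemma gauss_dominated g K : measurable_fun setT g -> 0 <= K ->
  (forall v, `|g v| <= K * expR (- (b * v ^+ 2 / 2))) ->
  leb.-integrable setT (EFin \o g) /\ `|\int[leb]_v g v| <= K * gnorm b.
Proof.
move=> mg K0 gK.
apply: (@norm_Rint_le _ M R leb g (fun v => K * expR (0 * v - b * v ^+ 2 / 2))) => //.
- by mfun.
- by move=> v; rewrite mul0r sub0r.
rewrite ge0_intZl; [|by mfun|by []|by move=> v; exact: expR_ge0].
by rewrite gauss_integral// expr0n /= mul0r expR0 mulr1.
Qed.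

(** The first factor yields the decay in z of the error, the second one makes
    all integrals Gaussian. *)
Definition tail_wt (v : R) : R := expR (- `|v|) * expR (- (b * v ^+ 2 / 2)).

Lemma tail_wt_le v : tail_wt v <= expR (- (b * v ^+ 2 / 2)).
Proof. by rewrite ler_piMl ?expR_ge0// expR_le1 oppr_le0. Qed.

(** Half of the Gaussian rate pays for the power and for exp(2 |v|). *)
Lemma pow_tail_wt j v :
  `|v| ^+ j * expR (- (b * v ^+ 2)) <= j`!%:R * expR (2 / b) * tail_wt v.
Proof.
apply: (@le_trans _ _ (j`!%:R * expR `|v| * expR (- (b * v ^+ 2)))).
  by rewrite ler_wpM2r ?expR_ge0// pow_le_expR.
rewrite -!mulrA; apply: ler_wpM2l => //.
rewrite /tail_wt -!expRD ler_expR -[v ^+ 2]real_normK ?num_real//.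
move: `|v| (normr_ge0 v) => x x0; rewrite -subr_ge0.
rewrite (_ : _ - _ = b / 2 * (x - 2 / b) ^+ 2); last by field; rewrite gt_eqF.
by apply: mulr_ge0; [rewrite divr_ge0// ltW|exact: sqr_ge0].
Qed.

Lemma ratio_diff (a1 a2 B1 B2 k D W q G : R) : 0 < k -> k <= B1 -> k <= B2 -> 0 <= D ->
  0 <= G ->
  `|a1 - a2| <= D * G * q -> `|a2| <= W * G * q -> `|B1 - B2| <= D * G ->
  `|a1 / B1 - a2 / B2| <= (G / k + W * G ^+ 2 / k ^+ 2) * D * q.
Proof.
move=> k0 k1 k2 D0 G0 h1 h2 h3.
have B10 : 0 < B1 by exact: lt_le_trans k1.
have B20 : 0 < B2 by exact: lt_le_trans k2.
have -> : a1 / B1 - a2 / B2 = (a1 - a2) / B1 + a2 * (B2 - B1) / (B1 * B2).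
  by field; rewrite !gt_eqF.
apply: (le_trans (ler_normD _ _)).
have -> : (G / k + W * G ^+ 2 / k ^+ 2) * D * q = D * G * q / k + W * G * q * (D * G) / (k * k).
  by field; rewrite gt_eqF.
apply: lerD.
  rewrite normrM [`|B1^-1|]ger0_norm ?invr_ge0 ?(ltW B10)//.
  apply: ler_pM => //; first by rewrite invr_ge0 ltW.
  by rewrite lef_pV2.
have BB : 0 < B1 * B2 by exact: mulr_gt0.
rewrite normrM [`|(B1 * B2)^-1|]ger0_norm ?invr_ge0 ?(ltW BB)//.
apply: ler_pM => //; first by rewrite invr_ge0 ltW.
  by rewrite normrM distrC; apply: ler_pM.
rewrite lef_pV2 ?posrE ?mulr_gt0//.
by apply: ler_pM => //; exact: ltW.
Qed.

(** The error at z is that of the masses beyond z, on the side away from 0,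
    where the weight is at most exp(- |z|); for z >= 0 this means comparing
    upper tails. *)
Lemma compare_cdf g1 g2 W D k : measurable_fun setT g1 -> measurable_fun setT g2 ->
  0 <= W -> 0 <= D -> 0 < k ->
  (forall v, `|g1 v| <= W * tail_wt v) -> (forall v, `|g2 v| <= W * tail_wt v) ->
  (forall v, `|g1 v - g2 v| <= D * tail_wt v) ->
  k <= \int[leb]_v g1 v -> k <= \int[leb]_v g2 v -> forall z,
  `|(\int[leb]_v (g1 v * (v <= z)%R%:R)) / (\int[leb]_v g1 v) -
    (\int[leb]_v (g2 v * (v <= z)%R%:R)) / (\int[leb]_v g2 v)| <=
  (gnorm b / k + W * gnorm b ^+ 2 / k ^+ 2) * D * expR (- `|z|).
Proof.
move=> m1 m2 W0 D0 k0 h1 h2 h12 k1 k2 z.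
have dom g K : measurable_fun setT g -> 0 <= K -> (forall v, `|g v| <= K * tail_wt v) ->
    leb.-integrable setT (EFin \o g) /\ `|\int[leb]_v g v| <= K * gnorm b.
  move=> mg K0 hg; apply: gauss_dominated => // v; apply: (le_trans (hg v)).
  by rewrite ler_wpM2l// tail_wt_le.
have mz : measurable_fun setT (fun v : R => (v <= z)%R%:R : R).
  exact: (@measurable_indic_le R z _ R id).
(* indicator of the half-line that starts at z and does not contain 0 *)
pose I (v : R) : R := if 0 <= z then 1 - (v <= z)%R%:R else (v <= z)%R%:R.
have mI : measurable_fun setT I by rewrite /I; case: (0 <= z); mfun.
have Ib v : `|I v| * expR (- `|v|) <= expR (- `|z|).
  rewrite /I; case: ifPn => z0; case: (leP v z) => vz /=;
    rewrite ?subrr ?subr0 ?normr0 ?normr1 ?mul0r ?mul1r ?expR_ge0// ler_expR lerN2.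
  - by rewrite (ger0_norm z0) ger0_norm ?(ltW vz)//; exact: le_trans (ltW vz).
  - by move: z0; rewrite -ltNge => z0; rewrite (ltr0_norm z0) ltr0_norm ?lerN2//; exact: le_lt_trans z0.
have domI g K : measurable_fun setT g -> 0 <= K -> (forall v, `|g v| <= K * tail_wt v) ->
    leb.-integrable setT (EFin \o (fun v => g v * I v)) /\
    `|\int[leb]_v (g v * I v)| <= K * gnorm b * expR (- `|z|).
  move=> mg K0 hg; rewrite -mulrA [gnorm b * _]mulrC mulrA.
  apply: gauss_dominated; [by mfun|by rewrite mulr_ge0 ?expR_ge0|].
  move=> v; rewrite normrM.
  apply: (@le_trans _ _ (K * tail_wt v * `|I v|)); first exact: ler_wpM2r.
  rewrite (_ : K * tail_wt v * `|I v| =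
      K * (`|I v| * expR (- `|v|)) * expR (- (b * v ^+ 2 / 2))); last by rewrite /tail_wt; ring.
  by apply: ler_wpM2r; [exact: expR_ge0|exact: ler_wpM2l].
have [i1 _] := dom g1 W m1 W0 h1.
have [i2 _] := dom g2 W m2 W0 h2.
have m12 : measurable_fun setT (fun v => g1 v - g2 v) by mfun.
have [_ d12] := dom _ D m12 D0 h12.
have [j1 _] := domI g1 W m1 W0 h1.
have [j2 e2] := domI g2 W m2 W0 h2.
have [_ e12] := domI _ D m12 D0 h12.
rewrite RintegralB// in d12.
have {}e12 : `|\int[leb]_v (g1 v * I v) - \int[leb]_v (g2 v * I v)| <= D * gnorm b * expR (- `|z|).
  rewrite -RintegralB//; move: e12; congr (`|_| <= _).
  by apply: eq_Rint => v; rewrite mulrBl.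
have G0 : 0 <= gnorm b by exact: ltW (gnorm_gt0 b_gt0).
have := ratio_diff k0 k1 k2 D0 G0 e12 e2 d12.
rewrite /I; case: (0 <= z) => //.
have comp g : leb.-integrable setT (EFin \o g) -> measurable_fun setT g ->
    k <= \int[leb]_v g v ->
    (\int[leb]_v (g v * (1 - (v <= z)%R%:R))) / (\int[leb]_v g v) =
    1 - (\int[leb]_v (g v * (v <= z)%R%:R)) / (\int[leb]_v g v).
  move=> ig mg kg; have g0 : 0 < \int[leb]_v g v by exact: lt_le_trans kg.
  have ii : leb.-integrable setT (EFin \o (fun v => g v * (v <= z)%R%:R)).
    have := integrable_norm ig => ign.
    apply: (@dominated_integrable _ M R leb _ (fun v => `|g v|)) => //; first by mfun.
    move=> v; rewrite normrM ler_piMr//.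
    by case: (v <= z); rewrite /= ?normr1 ?normr0.
  rewrite (@eq_Rint _ _ _ leb _ (fun v => g v - g v * (v <= z)%R%:R)); last by move=> v; rewrite mulrBr mulr1.
  by rewrite RintegralB// mulrBl divff// gt_eqF.
by rewrite !comp// opprB addrC addrA subrK distrC.
Qed.

Lemma Rint_lower g r kap : leb.-integrable setT (EFin \o g) -> (forall v, 0 <= g v) ->
  0 < r -> (forall v, `|v| <= r -> kap <= g v) -> r * kap <= \int[leb]_v g v.
Proof.
move=> ig g0 r0 hg.
have [k0|k0] := leP kap 0.
  apply: (@le_trans _ _ 0); first by rewrite pmulr_rle0.
  by apply: Rintegral_ge0 => v _.
have e : \int[leb]_v (kap * \1_(`[0, r]%classic) v) = r * kap.
  rewrite /Rintegral; under eq_integral do rewrite EFinM.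
  rewrite ge0_integralZl//; last by rewrite lee_fin ltW.
    rewrite integral_indic//= setIT lebesgue_measure_itv/= lte_fin r0.
    by rewrite -EFinB subr0 mulrC.
  by apply/measurable_EFinP; exact: measurable_indic.
rewrite -e; apply: (@le_Rint _ M R leb) => //.
  apply: (@dominated_integrable _ M R leb _ g) => //.
    by apply: measurable_funM => //; exact: measurable_indic.
  move=> v; rewrite indicE; case: (boolP (_ \in _)) => vi; last by rewrite mulr0 normr0.
  rewrite mulr1 gtr0_norm//; apply: hg; move: vi; rewrite inE /= in_itv /= => /andP[v0 vr].
  by rewrite ger0_norm.
move=> v; rewrite indicE; case: (boolP (_ \in _)) => vi; last by rewrite mulr0.
rewrite mulr1; apply: hg; move: vi; rewrite inE /= in_itv /= => /andP[v0 vr].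
by rewrite ger0_norm.
Qed.

End weights.

(** * The density of the smoothed sum *)
Section scaled_density.
Context (R : realType).
Local Notation leb := (@lebesgue_measure R).

Lemma expRN_lipschitz (m x y : R) : m <= x -> m <= y ->
  `|expR (- x) - expR (- y)| <= `|x - y| * expR (- m).
Proof.
wlog xy : x y / x <= y.
  move=> H mx my; have [xy|/ltW yx] := leP x y; first exact: H.
  by rewrite distrC [`|x - y|]distrC; exact: H.
move=> mx my.
rewrite ger0_norm ?subr_ge0 ?ler_expR ?lerN2//.
rewrite distrC ger0_norm ?subr_ge0//.
apply: (@le_trans _ _ ((y - x) * expR (- x))); last first.
  by apply: ler_wpM2l; rewrite ?subr_ge0// ler_expR lerN2.
have -> : expR (- y) = expR (x - y) * expR (- x) by rewrite -expRD; congr expR; ring.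
have h := expR_ge1Dx (x - y).
rewrite -[X in X - _]mul1r -mulrBl; apply: ler_wpM2r; first exact: expR_ge0.
lra.
Qed.

Lemma even_pow_ge (v : R) k : (0 < k)%N -> v ^+ 2 - 1 <= v ^+ (2 * k).
Proof.
move=> k0; rewrite exprM; have v0 := sqr_ge0 v; move: (v ^+ 2) v0 => x x0.
have [x1|x1] := leP x 1; first by apply: (@le_trans _ _ 0); [rewrite subr_le0|exact: exprn_ge0].
apply: (@le_trans _ _ x); first by rewrite lerBlDr lerDl.
by apply: ler_eXnr => //; exact: ltW.
Qed.

Variables (k : nat) (H : R -> R) (b0 b c C Cu : R).
Hypotheses (k_gt0 : (0 < k)%N) (b0_gt0 : 0 < b0) (b_gt0 : 0 < b) (C_ge0 : 0 <= C).
Hypothesis mH : measurable_fun setT H.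
Hypothesis H_near : forall u, `|u| <= b0 -> b * u ^+ (2 * k) <= H u.
Hypothesis H_far : forall u, b0 < `|u| -> b * u ^+ 2 <= H u.
Hypothesis H_taylor : forall u, `|u| <= b0 ->
  `|H u - c * u ^+ (2 * k)| <= C * `|u| ^+ (2 * k).+1.
Hypotheses (bc : b <= c) (cCu : c <= Cu).

(** With a^(2k) = n this is exp(- n H(v / a)), which tends to limit_dens because
    n H(v / a) tends to c v^(2k). *)
Definition scaled_dens (a v : R) : R := expR (- (a ^+ (2 * k) * H (v / a))).
Definition limit_dens (v : R) : R := expR (- (c * v ^+ (2 * k))).

Lemma measurable_scaled_dens a : measurable_fun setT (scaled_dens a).
Proof. by rewrite /scaled_dens; mfun. Qed.

Lemma measurable_limit_dens : measurable_fun setT limit_dens.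
Proof. by rewrite /limit_dens; mfun. Qed.

Lemma limit_exponent v : b * (v ^+ 2 - 1) <= c * v ^+ (2 * k).
Proof.
apply: (@le_trans _ _ (b * v ^+ (2 * k))); first by rewrite ler_pM2l// even_pow_ge.
by apply: ler_wpM2r => //; rewrite exprM exprn_ge0// sqr_ge0.
Qed.

Section scale.
Variable a : R.
Hypothesis a1 : 1 <= a.
Let a0 : 0 < a. Proof. exact: lt_le_trans a1. Qed.

Let norm_div v : `|v / a| = `|v| / a.
Proof. by rewrite normrM [`|a^-1|]ger0_norm// invr_ge0 ltW. Qed.

Let scale_pow j x v : a ^+ j * (x * (v / a) ^+ j) = x * v ^+ j.
Proof. by rewrite expr_div_n; field; rewrite expf_neq0 ?gt_eqF. Qed.

Lemma scaled_exponent v : b * (v ^+ 2 - 1) <= a ^+ (2 * k) * H (v / a).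
Proof.
have [vb|vb] := leP (`|v / a|) b0.
  apply: (@le_trans _ _ (b * v ^+ (2 * k))); first by rewrite ler_pM2l// even_pow_ge.
  apply: (@le_trans _ _ (a ^+ (2 * k) * (b * (v / a) ^+ (2 * k)))).
    by rewrite scale_pow.
  by rewrite ler_pM2l ?exprn_gt0// H_near.
apply: (@le_trans _ _ (a ^+ (2 * k) * (b * (v / a) ^+ 2))); last first.
  by rewrite ler_pM2l ?exprn_gt0// H_far.
apply: (@le_trans _ _ (b * v ^+ 2)); first by rewrite ler_pM2l// lerBlDr lerDl.
apply: (@le_trans _ _ (a ^+ 2 * (b * (v / a) ^+ 2))).
  by rewrite scale_pow.
apply: ler_wpM2r; first by rewrite mulr_ge0 ?sqr_ge0// ltW.
by rewrite exprM ler_eXnr// -(expr1n _ 2) ler_sqr ?nnegrE// ltW.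
Qed.

(** Where |v| <= b0 a, the Taylor remainder of H at v / a is multiplied by
    a^(2k) and becomes C |v|^(2k+1) / a.  Elsewhere both densities are small
    and 1 <= |v| / (b0 a). *)
Lemma scaled_dens_diff v : `|scaled_dens a v - limit_dens v| <=
  expR b / a * (C * `|v| ^+ (2 * k).+1 + `|v| / b0) * expR (- (b * v ^+ 2)).
Proof.
have eb x : expR (- (b * (x ^+ 2 - 1))) = expR b * expR (- (b * x ^+ 2)).
  by rewrite -expRD; congr expR; ring.
have [vb|vb] := leP (`|v / a|) b0.
  have h := expRN_lipschitz (scaled_exponent v) (limit_exponent v).
  apply: (le_trans h); rewrite eb.
  apply: (@le_trans _ _ (C * `|v| ^+ (2 * k).+1 / a * (expR b * expR (- (b * v ^+ 2))))).
    apply: ler_wpM2r; first by rewrite mulr_ge0 ?expR_ge0.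
    have -> : a ^+ (2 * k) * H (v / a) - c * v ^+ (2 * k) =
        a ^+ (2 * k) * (H (v / a) - c * (v / a) ^+ (2 * k)).
      by rewrite mulrBr scale_pow.
    rewrite normrM ger0_norm ?exprn_ge0 ?(ltW a0)//.
    apply: (@le_trans _ _ (a ^+ (2 * k) * (C * `|v / a| ^+ (2 * k).+1))).
      by rewrite ler_pM2l ?exprn_gt0//; exact: H_taylor.
    rewrite norm_div expr_div_n [a ^+ (2 * k).+1]exprSr.
    rewrite le_eqVlt; apply/orP; left; apply/eqP; field.
    by rewrite gt_eqF//= expf_neq0// gt_eqF.
  have -> : expR b / a * (C * `|v| ^+ (2 * k).+1 + `|v| / b0) * expR (- (b * v ^+ 2)) =
     C * `|v| ^+ (2 * k).+1 / a * (expR b * expR (- (b * v ^+ 2))) +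
     expR b / a * (`|v| / b0) * expR (- (b * v ^+ 2)) by ring.
  rewrite lerDl; apply: mulr_ge0; last exact: expR_ge0.
  by apply: mulr_ge0; apply: divr_ge0 => //; rewrite ?expR_ge0// ltW.
apply: (@le_trans _ _ (expR b * expR (- (b * v ^+ 2)))).
  have h1 : scaled_dens a v <= expR b * expR (- (b * v ^+ 2)).
    by rewrite -eb ler_expR lerN2; exact: scaled_exponent.
  have h2 : limit_dens v <= expR b * expR (- (b * v ^+ 2)).
    by rewrite -eb ler_expR lerN2; exact: limit_exponent.
  have := expR_ge0 (- (a ^+ (2 * k) * H (v / a))); rewrite -/(scaled_dens a v).
  have := expR_ge0 (- (c * v ^+ (2 * k))); rewrite -/(limit_dens v).
  move: h1 h2; move: (scaled_dens a v) (limit_dens v) (_ * _) => x y t.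
  by rewrite ler_norml; move=> *; apply/andP; split; lra.
apply: ler_wpM2r; first exact: expR_ge0.
rewrite -mulrA -[leLHS]mulr1; apply: ler_wpM2l; first exact: expR_ge0.
rewrite mulrDr; apply: (@le_trans _ _ (a^-1 * (`|v| / b0))).
  by rewrite mulrA ler_pdivlMr// mul1r mulrC -norm_div; exact: ltW.
rewrite lerDr; apply: mulr_ge0; first by rewrite invr_ge0 ltW.
by rewrite mulr_ge0 ?exprn_ge0.
Qed.

Definition decay_const : R := expR b * expR (2 / b).
Definition diff_const : R :=
  expR b * (C * (2 * k).+1`!%:R + 1 / b0) * expR (2 / b).

Let gauss_tail v : expR b * expR (- (b * v ^+ 2)) <= decay_const * tail_wt b v.
Proof.
have := pow_tail_wt b_gt0 0 v; rewrite expr0 fact0 !mul1r => h.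
by rewrite /decay_const -mulrA ler_wpM2l ?expR_ge0.
Qed.

Lemma scaled_dens_le v : `|scaled_dens a v| <= decay_const * tail_wt b v.
Proof.
rewrite ger0_norm ?expR_ge0//; apply: le_trans (gauss_tail v).
rewrite -expRD ler_expR; have := scaled_exponent v; move: (_ * H _) => x.
by move: (v ^+ 2) => y h; nra.
Qed.

Lemma limit_dens_le v : `|limit_dens v| <= decay_const * tail_wt b v.
Proof.
rewrite ger0_norm ?expR_ge0//; apply: le_trans (gauss_tail v).
rewrite -expRD ler_expR; have := limit_exponent v; move: (c * _) => x.
by move: (v ^+ 2) => y h; nra.
Qed.

Lemma scaled_dens_diff_le v :
  `|scaled_dens a v - limit_dens v| <= diff_const / a * tail_wt b v.
Proof.
apply: (le_trans (scaled_dens_diff v)).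
have h1 := pow_tail_wt b_gt0 (2 * k).+1 v.
have h2 := pow_tail_wt b_gt0 1 v; rewrite expr1 mul1r in h2.
have -> : expR b / a * (C * `|v| ^+ (2 * k).+1 + `|v| / b0) * expR (- (b * v ^+ 2)) =
  expR b / a * (C * (`|v| ^+ (2 * k).+1 * expR (- (b * v ^+ 2))) +
    b0^-1 * (`|v| * expR (- (b * v ^+ 2)))) by field; rewrite !gt_eqF.
have -> : diff_const / a * tail_wt b v = expR b / a *
   (C * ((2 * k).+1`!%:R * expR (2 / b) * tail_wt b v) + b0^-1 * (expR (2 / b) * tail_wt b v)).
  by rewrite /diff_const; field; rewrite !gt_eqF.
apply: ler_wpM2l; first by rewrite divr_ge0 ?expR_ge0// ltW.
by apply: lerD; apply: ler_wpM2l => //; rewrite invr_ge0 ltW.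
Qed.

Definition mass_const : R :=
  b0 * expR (- (Cu * b0 ^+ (2 * k) + C * b0 ^+ (2 * k).+1)).

Lemma mass_const_gt0 : 0 < mass_const.
Proof. by rewrite mulr_gt0// expR_gt0. Qed.

Let pow_le (j : nat) (v : R) : `|v| <= b0 -> `|v| ^+ j <= b0 ^+ j.
Proof. by move=> vb; apply: lerXn2r; rewrite ?nnegrE// ltW. Qed.

Let even_norm (v : R) : v ^+ (2 * k) = `|v| ^+ (2 * k).
Proof. by rewrite -normrX ger0_norm// exprM exprn_ge0// sqr_ge0. Qed.

Lemma integrable_scaled_dens : leb.-integrable setT (EFin \o scaled_dens a).
Proof.
apply: (proj1 (@gauss_dominated R b b_gt0 (scaled_dens a) decay_const _ _ _)).
- exact: measurable_scaled_dens.
- by rewrite mulr_ge0 ?expR_ge0.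
move=> v; apply: le_trans (scaled_dens_le v) _.
by rewrite ler_wpM2l ?mulr_ge0 ?expR_ge0// tail_wt_le.
Qed.

Lemma integrable_limit_dens : leb.-integrable setT (EFin \o limit_dens).
Proof.
apply: (proj1 (@gauss_dominated R b b_gt0 limit_dens decay_const _ _ _)).
- exact: measurable_limit_dens.
- by rewrite mulr_ge0 ?expR_ge0.
move=> v; apply: le_trans (limit_dens_le v) _.
by rewrite ler_wpM2l ?mulr_ge0 ?expR_ge0// tail_wt_le.
Qed.

Lemma limit_dens_mass : mass_const <= \int[leb]_v limit_dens v.
Proof.
apply: Rint_lower integrable_limit_dens _ b0_gt0 _; first by move=> v; exact: expR_ge0.
move=> v vb; rewrite ler_expR lerN2 even_norm.
apply: (@le_trans _ _ (Cu * b0 ^+ (2 * k))).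
  by apply: ler_pM => //; [exact: ltW (lt_le_trans b_gt0 bc)|exact: pow_le].
by rewrite lerDl mulr_ge0// exprn_ge0// ltW.
Qed.

(** On |v| <= b0 the Taylor expansion bounds the exponent uniformly in a. *)
Lemma scaled_dens_mass : mass_const <= \int[leb]_v scaled_dens a v.
Proof.
apply: Rint_lower integrable_scaled_dens _ b0_gt0 _; first by move=> v; exact: expR_ge0.
move=> v vb; rewrite ler_expR lerN2.
have vab : `|v / a| <= b0.
  by rewrite norm_div ler_pdivrMr// (le_trans vb)// ler_peMr// ltW.
have h := le_trans (ler_norm _) (H_taylor vab).
have {}h : H (v / a) <= c * (v / a) ^+ (2 * k) + C * `|v / a| ^+ (2 * k).+1 by lra.
apply: (@le_trans _ _ (a ^+ (2 * k) * (c * (v / a) ^+ (2 * k) + C * `|v / a| ^+ (2 * k).+1))).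
  by rewrite ler_pM2l// exprn_gt0.
have -> : a ^+ (2 * k) * (c * (v / a) ^+ (2 * k) + C * `|v / a| ^+ (2 * k).+1) =
    c * `|v| ^+ (2 * k) + C * `|v| ^+ (2 * k).+1 / a.
  rewrite mulrDr scale_pow -(even_norm v); congr (_ + _).
  rewrite norm_div expr_div_n [a ^+ (2 * k).+1]exprSr.
  by field; rewrite expf_neq0 ?gt_eqF.
apply: lerD.
  by apply: ler_pM => //; [exact: ltW (lt_le_trans b_gt0 bc)|exact: pow_le].
rewrite ler_pdivrMr//; apply: (@le_trans _ _ (C * b0 ^+ (2 * k).+1)).
  by apply: ler_wpM2l => //; exact: pow_le.
by rewrite ler_peMr// mulr_ge0// exprn_ge0// ltW.
Qed.

End scale.
End scaled_density.

(** * The rate at the critical temperature *)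
Section critical.
Context (R : realType).
Local Notation M := (measurableTypeR R).
Local Notation leb := (@lebesgue_measure R).
Local Notation N01 := (normal_prob 0 1 : probability M R).
Implicit Types (P : probability M R).

Definition critical_coef P k : R := derive1n (2 * k) (gauss_defect P) 0 / (2 * k)`!%:R.

Lemma defect_second P : subgaussian 1 P -> \int[P]_x (x : R) = 0 ->
  derive1n 2 (gauss_defect P) 0 = 1 - \int[P]_x ((x : R) ^+ 2).
Proof.
move=> sg mean; rewrite derive1n_defect//=.
have E0 j : expm P j 0 = \int[P]_x ((x : R) ^+ j).
  by apply: eq_Rint => x; rewrite mul0r expR0 mulr1.
rewrite !E0 (_ : \int[P]_x (x : R) ^+ 1 = 0); last first.
  by rewrite -[RHS]mean; apply: eq_Rint => x; rewrite expr1.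
rewrite (_ : \int[P]_x (x : R) ^+ 0 = 1); last first.
  rewrite (@eq_Rint _ _ _ P _ (fun=> 1)); last by move=> x; rewrite expr0.
  by rewrite Rintegral_cst//= probability_setT /= mulr1.
by rewrite invr1 mulr1 mul0r addr0.
Qed.

Lemma mgf_defect P t : subgaussian 1 P -> \int[P]_x (x : R) = 0 ->
  (\int[P]_x (expR (t * (x : R)))%:E = (expR (t ^+ 2 / 2 - gauss_defect P t))%:E)%E.
Proof.
move=> sg mean.
have i : P.-integrable setT (EFin \o (fun x : M => expR (t * (x : R)))).
  have := integrable_expm 0 t sg; apply: eq_integrable => // x _.
  by rewrite /= expr0 mul1r.
rewrite -EFin_Rint// /gauss_defect opprB addrC subrK lnK// posrE -expm0E.
exact: lt_le_trans (expm0_ge1 t sg mean).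
Qed.

Lemma defect_le P t : subgaussian 1 P -> \int[P]_x (x : R) = 0 ->
  gauss_defect P t <= t ^+ 2 / 2.
Proof.
move=> sg mean; rewrite gauss_defectE lerBlDr lerDl ln_ge0//.
exact: expm0_ge1 sg mean.
Qed.

Definition critical_mgf (k : nat) (b0 b1 b2 : R) P := forall t : R,
  (\int[P]_x (expR (t * (x : R)))%:E <=
    (if (`|t| <= b0)%R then expR (t ^+ 2 / 2 - b1 * t ^+ (2 * k))
     else expR (t ^+ 2 / (2 * b2)))%:E)%E.

Variables (k : nat) (b0 b1 b2 : R).
Hypotheses (k_gt0 : (0 < k)%N) (b00 : 0 < b0) (b10 : 0 < b1) (b21 : 1 < b2).

Let b20 : 0 < b2. Proof. exact: lt_trans b21. Qed.

Let even_ge0 (t : R) : 0 <= t ^+ (2 * k).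
Proof. by rewrite exprM exprn_ge0// sqr_ge0. Qed.

Lemma critical_subgaussian P : critical_mgf k b0 b1 b2 P -> subgaussian 1 P.
Proof.
move=> h t; apply: (le_trans (h t)); rewrite lee_fin mul1r; case: ifP => _; rewrite ler_expR.
  by rewrite lerBlDr lerDl mulr_ge0// ltW.
apply: ler_wpM2l; first exact: sqr_ge0.
by rewrite lef_pV2 ?posrE ?mulr_gt0// ler_peMr// ltW.
Qed.

Definition critical_rate_const : R := Num.min b1 ((1 - b2^-1) / 2).
Local Notation bb := critical_rate_const.

Lemma critical_rate_const_gt0 : 0 < bb.
Proof.
by rewrite /critical_rate_const lt_min b10 divr_gt0// subr_gt0 invf_lt1.
Qed.

Lemma defect_near P u : critical_mgf k b0 b1 b2 P -> \int[P]_x (x : R) = 0 ->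
  `|u| <= b0 -> b1 * u ^+ (2 * k) <= gauss_defect P u.
Proof.
move=> h mean ub; have := h u; rewrite ub mgf_defect//; last exact: critical_subgaussian.
by rewrite lee_fin ler_expR lerD2l lerN2.
Qed.

Lemma defect_far P u : critical_mgf k b0 b1 b2 P -> \int[P]_x (x : R) = 0 ->
  b0 < `|u| -> bb * u ^+ 2 <= gauss_defect P u.
Proof.
move=> h mean ub; have := h u; rewrite [(`|u| <= b0)%R]leNgt ub /= mgf_defect//; last exact: critical_subgaussian.
rewrite lee_fin ler_expR => {}h.
apply: (@le_trans _ _ ((1 - b2^-1) / 2 * u ^+ 2)).
  by apply: ler_wpM2r; [exact: sqr_ge0|rewrite ge_min lexx orbT].
have -> : (1 - b2^-1) / 2 * u ^+ 2 = u ^+ 2 / 2 - u ^+ 2 / (2 * b2) by field; rewrite gt_eqF.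
by move: (u ^+ 2 / 2) (u ^+ 2 / _) h => x y; lra.
Qed.

(** Lower bound: divide b1 u^(2k) <= H u by u^(2k) and let u tend to 0.  Upper
    bound: H u <= u^2 / 2 at u = b0. *)
Lemma critical_coef_bounds P C : 0 <= C -> critical_mgf k b0 b1 b2 P ->
  \int[P]_x (x : R) = 0 ->
  (forall u, `|u| <= b0 -> `|gauss_defect P u - critical_coef P k * u ^+ (2 * k)| <=
     C * `|u| ^+ (2 * k).+1) ->
  b1 <= critical_coef P k <= (b0 ^+ 2 / 2 + C * b0 ^+ (2 * k).+1) / b0 ^+ (2 * k).
Proof.
move=> C0 h mean exp; set c := critical_coef P k in exp *.
apply/andP; split; last first.
  have b0b : `|b0| <= b0 by rewrite ger0_norm// ltW.
  rewrite ler_pdivlMr ?exprn_gt0//.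
  have h1 := defect_le b0 (critical_subgaussian h) mean.
  have := exp b0 b0b; rewrite (ger0_norm (ltW b00)) => /ler_normlP[h2 _].
  move: h1 h2; move: (gauss_defect P b0) (c * _) (C * _) (b0 ^+ 2 / 2) => x y z t; lra.
rewrite leNgt; apply/negP => cb.
have d0 : 0 < (b1 - c) / (2 * (C + 1)).
  by rewrite divr_gt0 ?subr_gt0// mulr_gt0// ltr_wpDl.
pose u := Num.min b0 ((b1 - c) / (2 * (C + 1))).
have u0 : 0 < u by rewrite lt_min b00.
have ub : `|u| <= b0 by rewrite gtr0_norm// ge_min lexx.
have h1 := defect_near h mean ub.
have := exp u ub; rewrite (gtr0_norm u0) => /ler_normlP[_ h2].
have up : 0 < u ^+ (2 * k) by rewrite exprn_gt0.
have h3 : b1 * u ^+ (2 * k) <= (c + C * u) * u ^+ (2 * k).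
  rewrite (_ : (c + C * u) * _ = c * u ^+ (2 * k) + C * u ^+ (2 * k).+1); last by rewrite exprS; ring.
  by move: h1 h2; move: (gauss_defect P u) => x; move: (b1 * _) (c * _) (C * _) => y z t; lra.
rewrite ler_pM2r// in h3.
have h4 : u * (2 * (C + 1)) <= b1 - c.
  by rewrite -ler_pdivlMr ?mulr_gt0 ?ltr_wpDl// ge_min lexx orbT.
by move: h3 h4 u0 cb; clear -C0 R; move=> h3 h4 u0 cb; nra.
Qed.

(** The smoothing parameters are chosen to make A (kap s)^2 / 2 equal to
    s^2 / 2n and kap s equal to the rescaled sum. *)
Lemma scaled_dens_mgf P n a v : critical_mgf k b0 b1 b2 P -> \int[P]_x (x : R) = 0 ->
  0 < a -> a ^+ (2 * k) = n%:R ->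
  (\int[sum_law P n]_s (hs_kernel (n%:R / a ^+ 2) (a / n%:R) s v)%:E =
   (scaled_dens k (gauss_defect P) a v)%:E)%E.
Proof.
move=> h mean a0 an; have sg := critical_subgaussian h.
have n0 : 0 < n%:R :> R by rewrite -an exprn_gt0.
have e (s : R) : hs_kernel (n%:R / a ^+ 2) (a / n%:R) s v =
    expR (- (n%:R * (v / a) ^+ 2 / 2)) * expR (v / a * s).
  rewrite /hs_kernel -expRD; congr expR; field.
  by rewrite !gt_eqF.
under eq_integral do rewrite e.
rewrite ge0_intZl; [|by mfun|exact: expR_ge0|by move=> s; exact: expR_ge0].
rewrite sum_law_mgf (mgf_defect _ sg mean) -EFin_expe -expRM_natl -EFinM -expRD.
congr (expR _)%:E; rewrite an; ring.
Qed.

(** The mass near z of a density with light tails: exp(- |v|) is at most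
    exp(- |z|) exp(|v - z|), half of the Gaussian absorbs the last factor, and
    the other half integrates to a multiple of 1 / sqrt A. *)
Lemma smoothing_error (g : R -> R) (b W A a z : R) : 0 < b -> 0 <= W ->
  measurable_fun setT g -> (forall v, `|g v| <= W * tail_wt b v) ->
  1 <= a -> a ^+ 2 <= A ->
  \int[leb]_v (g v * (2 * expR (- (A * (v - z) ^+ 2 / 4)))) <=
  2 * W * expR 2 * Num.sqrt (8 * pi) / a * expR (- `|z|).
Proof.
move=> bp W0 mg gW a1 aA.
have a0 : 0 < a by exact: lt_le_trans a1.
have A1 : 1 <= A by apply: le_trans aA; rewrite -(expr1n _ 2) ler_sqr ?nnegrE// ltW.
have A0 : 0 < A by exact: lt_le_trans A1.
have A40 : 0 < A / 4 by rewrite divr_gt0.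
pose K := 2 * W * expR 2 * expR (- `|z|) * expR (- (A * z ^+ 2 / 8)).
have K0 : 0 <= K by rewrite !mulr_ge0 ?expR_ge0.
have dom v : `|g v * (2 * expR (- (A * (v - z) ^+ 2 / 4)))| <=
    K * expR (A / 4 * z * v - A / 4 * v ^+ 2 / 2).
  rewrite normrM [`|2 * _|]ger0_norm ?mulr_ge0 ?expR_ge0//.
  apply: (@le_trans _ _ (W * expR (- `|v|) * (2 * expR (- (A * (v - z) ^+ 2 / 4))))).
    apply: ler_wpM2r; first by rewrite mulr_ge0 ?expR_ge0.
    apply: (le_trans (gW v)); apply: ler_wpM2l => //.
    by rewrite ler_piMr ?expR_ge0// expR_le1 oppr_le0 divr_ge0// mulr_ge0 ?sqr_ge0// ltW.
  have -> : K * expR (A / 4 * z * v - A / 4 * v ^+ 2 / 2) = 2 * W *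
      expR (2 - `|z| - A * z ^+ 2 / 8 + (A / 4 * z * v - A / 4 * v ^+ 2 / 2)).
    by rewrite /K !expRD; ring.
  have -> : W * expR (- `|v|) * (2 * expR (- (A * (v - z) ^+ 2 / 4))) =
      2 * W * expR (- `|v| - A * (v - z) ^+ 2 / 4) by rewrite expRD; ring.
  apply: ler_wpM2l; first by rewrite mulr_ge0.
  rewrite ler_expR.
  have hz : `|z| - `|v| <= `|v - z| by rewrite distrC lerB_dist.
  have hx : `|v - z| <= 2 + A * (v - z) ^+ 2 / 8.
    rewrite -[(v - z) ^+ 2]real_normK ?num_real//.
    move: `|v - z| (normr_ge0 (v - z)) => x x0.
    have h2 : 2 / A <= 2 by rewrite ler_pdivrMr// ler_peMr.
    rewrite -subr_ge0; apply: (@le_trans _ _ (A / 8 * (x - 4 / A) ^+ 2)).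
      by rewrite mulr_ge0 ?sqr_ge0// divr_ge0// ltW.
    have -> : A / 8 * (x - 4 / A) ^+ 2 = 2 / A + A * x ^+ 2 / 8 - x by field; rewrite gt_eqF.
    by rewrite lerD2r lerD2r.
  rewrite (_ : 2 - _ - _ + _ = (2 + A * (v - z) ^+ 2 / 8) - `|z| - A * (v - z) ^+ 2 / 4); last by field.
  by move: (_ / 4) (_ / 8) hx hz => p q; lra.
have mgA : measurable_fun setT (fun v : R => g v * (2 * expR (- (A * (v - z) ^+ 2 / 4)))) by mfun.
have mdm : measurable_fun setT (fun v : R => K * expR (A / 4 * z * v - A / 4 * v ^+ 2 / 2)) by mfun.
have tot : (\int[leb]_v (K * expR (A / 4 * z * v - A / 4 * v ^+ 2 / 2))%:E <=
    (2 * W * expR 2 * Num.sqrt (8 * pi) / a * expR (- `|z|))%:E)%E.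
  rewrite ge0_intZl; [|by mfun|by []|by move=> v; exact: expR_ge0].
  rewrite gauss_integral// -EFinM lee_fin.
  have ge : gnorm (A / 4) <= Num.sqrt (8 * pi) / a.
    have p0 : 0 <= 8 * pi :> R by rewrite mulr_ge0// pi_ge0.
    rewrite -ler_sqr ?nnegrE ?divr_ge0 ?sqrtr_ge0 ?(ltW a0)//.
    have e1 : 2 * pi / (A / 4) = 8 * pi / A by field; rewrite gt_eqF.
    rewrite expr_div_n /gnorm e1 !sqr_sqrtr//; last by rewrite divr_ge0// ltW.
    by apply: ler_wpM2l => //; rewrite lef_pV2 ?posrE// exprn_gt0.
  have -> : (A / 4 * z) ^+ 2 / (2 * (A / 4)) = A * z ^+ 2 / 8 by field; rewrite gt_eqF.
  have -> : K * (gnorm (A / 4) * expR (A * z ^+ 2 / 8)) =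
     2 * W * expR 2 * gnorm (A / 4) * expR (- `|z|) * (expR (A * z ^+ 2 / 8) * expR (- (A * z ^+ 2 / 8))).
    by rewrite /K; ring.
  rewrite expRxMexpNx_1 mulr1; apply: ler_wpM2r; first exact: expR_ge0.
  by rewrite -[leRHS]mulrA; apply: ler_wpM2l => //; rewrite !mulr_ge0 ?expR_ge0.
have [_ h] := @norm_Rint_le _ M R leb _ _ _ mgA mdm dom tot.
exact: le_trans (ler_norm _) h.
Qed.

End critical.

Section critical_rate.
Context (R : realType).
Local Notation M := (measurableTypeR R).
Local Notation leb := (@lebesgue_measure R).
Local Notation N01 := (normal_prob 0 1 : probability M R).
Implicit Types (P : probability M R).
Variables (k : nat) (b0 b1 b2 : R).
Hypotheses (k_gt1 : (1 < k)%N) (b00 : 0 < b0) (b10 : 0 < b1) (b21 : 1 < b2).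

Let k_gt0 : (0 < k)%N. Proof. exact: ltnW. Qed.

Definition critical_class P := [/\ critical_mgf k b0 b1 b2 P, \int[P]_x (x : R) = 0 &
  forall i, (i < 2 * k)%N -> \int[P]_x ((x : R) ^+ i) = \int[N01]_x ((x : R) ^+ i)].

(** Two errors of order 1/a: smoothing, whose Gaussian has standard deviation
    1 / sqrt A <= 1/a because k >= 2, and the difference between scaled_dens
    and limit_dens. *)
Lemma critical_rate : exists C c1 : R, [/\ 0 <= C, 0 <= c1 & forall P, critical_class P ->
  0 <= critical_coef P k <= c1 /\
  forall n a, 1 <= a -> a ^+ (2 * k) = n%:R -> forall z,
  let m := sum_law P n in
  let psi := fun s : M => expR ((s : R) ^+ 2 / (2 * n%:R)) in
  let W := fun s : M => a / n%:R * (s : R) in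
  let f := limit_dens k (critical_coef P k) in
  [/\ leb.-integrable setT (EFin \o f), m.-integrable setT (EFin \o psi),
      m.-integrable setT (EFin \o (fun s => psi s * (W s <= z)%R%:R)) &
  `|(\int[m]_s psi s)^-1 * \int[m]_s (psi s * (W s <= z)%R%:R) -
    (\int[leb]_v f v)^-1 * \int[leb]_v (f v * (v <= z)%R%:R)| <= C * expR (- `|z|) / a]].
Proof.
have [C C0 hC] := @defect_expansion R (2 * k) b0 (ltW b00).
pose bb := critical_rate_const b1 b2.
have bb0 : 0 < bb by exact: critical_rate_const_gt0.
pose Cu := (b0 ^+ 2 / 2 + C * b0 ^+ (2 * k).+1) / b0 ^+ (2 * k).
have Cu0 : 0 <= Cu.
  by rewrite divr_ge0 ?exprn_ge0 ?(ltW b00)// addr_ge0 ?divr_ge0 ?sqr_ge0// mulr_ge0// exprn_ge0// ltW.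
pose mk := mass_const k b0 C Cu.
have mk0 : 0 < mk by exact: mass_const_gt0.
pose Wc := decay_const bb.
pose Dc := diff_const k b0 bb C.
have Wc0 : 0 <= Wc by rewrite mulr_ge0 ?expR_ge0.
have Dc0 : 0 <= Dc.
  rewrite !mulr_ge0 ?expR_ge0// addr_ge0 ?mulr_ge0// invr_ge0 ltW//.
pose C1 := 2 * Wc * expR 2 * Num.sqrt (8 * pi) / mk.
pose C2 := (gnorm bb / mk + Wc * gnorm bb ^+ 2 / mk ^+ 2) * Dc.
exists (C1 + C2), Cu; split => //.
  have g0 : 0 <= gnorm bb by exact: sqrtr_ge0.
  have s0 : 0 <= Num.sqrt (8 * pi) :> R by exact: sqrtr_ge0.
  have mi0 : 0 <= mk^-1 by rewrite invr_ge0 ltW.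
  apply: addr_ge0.
    by rewrite !mulr_ge0 ?expR_ge0.
  by rewrite mulr_ge0// addr_ge0 ?mulr_ge0 ?exprn_ge0// invr_ge0 exprn_ge0 ?(ltW mk0).
move=> P [cm mean mom]; have sg := critical_subgaussian b10 b21 cm.
have exp := hC P sg mean mom; rewrite -/(critical_coef P k) in exp.
have /andP[cl cu] := critical_coef_bounds b00 b10 b21 C0 cm mean exp.
split; first by rewrite cu andbT (le_trans _ cl)// ltW.
move=> n a a1 an z m psi W f.
have a0 : 0 < a by exact: lt_le_trans a1.
have n0 : 0 < n%:R :> R by rewrite -an exprn_gt0.
pose A : R := n%:R / a ^+ 2.
have A0 : 0 < A by rewrite divr_gt0// exprn_gt0.
have aA : a ^+ 2 <= A.
  rewrite ler_pdivlMr ?exprn_gt0// -an -exprD.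
  by apply: ler_weXn2l => //; rewrite (leq_mul2l 2 2 k).
pose F := scaled_dens k (gauss_defect P) a.
have near u : `|u| <= b0 -> bb * u ^+ (2 * k) <= gauss_defect P u.
  move=> ub; apply: le_trans (defect_near b10 b21 cm mean ub).
  apply: ler_wpM2r; first by rewrite exprM exprn_ge0// sqr_ge0.
  by rewrite ge_min lexx.
have far u : b0 < `|u| -> bb * u ^+ 2 <= gauss_defect P u by exact: defect_far.
have bc : bb <= critical_coef P k by apply: le_trans cl; rewrite ge_min lexx.
have mH : measurable_fun setT (gauss_defect P).
  by apply: measurable_of_is_derive (fun x => is_derive_defect 0 x sg mean).
have mF : measurable_fun setT F by exact: measurable_scaled_dens.
have mf : measurable_fun setT f by exact: measurable_limit_dens.
have FE v : (\int[m]_s (hs_kernel A (a / n%:R) s v)%:E = (F v)%:E)%E.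
  exact: (scaled_dens_mgf b10 b21 v cm mean a0 an).
have iF : leb.-integrable setT (EFin \o F) by exact: (integrable_scaled_dens k_gt0 bb0 mH near far a1).
have FW v : `|F v| <= Wc * tail_wt bb v by exact: (scaled_dens_le k_gt0 bb0 near far a1 v).
have fW v : `|f v| <= Wc * tail_wt bb v by exact: limit_dens_le.
have FfD v : `|F v - f v| <= Dc / a * tail_wt bb v.
  exact: (scaled_dens_diff_le k_gt0 b00 bb0 C0 near far exp bc a1 v).
have Fm : mk <= \int[leb]_v F v by exact: (scaled_dens_mass k_gt0 b00 bb0 C0 mH near far exp bc cu a1).
have fm : mk <= \int[leb]_v f v by exact: (limit_dens_mass k_gt0 b00 bb0 C0 bc cu).
have Da0 : 0 <= Dc / a by rewrite divr_ge0// ltW.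
have cmp := compare_cdf bb0 mF mf Wc0 Da0 mk0 FW fW FfD Fm fm z.
have err := smoothing_error z bb0 Wc0 mF FW a1 aA.
have smo := hs_smoothing A0 mF FE iF z.
have tot := hs_total A0 FE iF.
have psiE (s : M) : expR (A * (a / n%:R * (s : R)) ^+ 2 / 2) = psi s.
  by rewrite /psi /A; congr expR; field; rewrite !gt_eqF.
have ipsi : m.-integrable setT (EFin \o psi).
  by have := hs_integrable_expR A0 FE iF; apply: eq_integrable => // s _; rewrite /= psiE.
rewrite (eq_Rint m psiE) in tot.
rewrite (@eq_Rint _ _ _ m _ (fun s => psi s * (W s <= z)%R%:R)) in smo; last first.
  by move=> s; rewrite psiE.
have mpsi : measurable_fun setT psi by rewrite /psi; mfun.
have mW : measurable_fun setT (fun s : M => (W s <= z)%R%:R : R).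
  by apply: measurable_indic_le; rewrite /W; mfun.
split => //; first exact: (integrable_limit_dens k_gt0 bb0 bc).
  apply: (dominated_integrable _ _ ipsi); first by mfun.
  move=> s; rewrite normrM (ger0_norm (expR_ge0 _)) ler_piMr ?expR_ge0//.
  by case: (W s <= z); rewrite /= ?normr1 ?normr0.
set K := \int[m]_s psi s in tot *.
set I1 := \int[m]_s (psi s * _) in smo *.
have F0 : 0 < \int[leb]_v F v by exact: lt_le_trans Fm.
have g0 : 0 < gnorm A by exact: gnorm_gt0.
have KE : K^-1 * I1 = (gnorm A * I1) / \int[leb]_v F v.
  have K0 : K != 0 by apply/eqP => K0; move: F0; rewrite -tot K0 mulr0 ltxx.
  by rewrite -tot; field; rewrite K0 gt_eqF.
rewrite KE [(\int[leb]_v f v)^-1 * _]mulrC.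
set G1 := \int[leb]_v (F v * _) in smo cmp.
have -> : gnorm A * I1 / \int[leb]_v F v - (\int[leb]_v (f v * (v <= z)%R%:R)) / \int[leb]_v f v =
  (gnorm A * I1 - G1) / \int[leb]_v F v + (G1 / \int[leb]_v F v -
    (\int[leb]_v (f v * (v <= z)%R%:R)) / \int[leb]_v f v) by ring.
apply: (le_trans (ler_normD _ _)).
have -> : (C1 + C2) * expR (- `|z|) / a = C1 * expR (- `|z|) / a + C2 * expR (- `|z|) / a by ring.
apply: lerD; last first.
  apply: (le_trans cmp); rewrite /C2.
  by rewrite le_eqVlt; apply/orP; left; apply/eqP; ring.
rewrite normrM [`|(\int[leb]_v F v)^-1|]ger0_norm ?invr_ge0 ?(ltW F0)//.
have -> : C1 * expR (- `|z|) / a = 2 * Wc * expR 2 * Num.sqrt (8 * pi) / a * expR (- `|z|) * mk^-1.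
  by rewrite /C1; ring.
apply: ler_pM => //; first by rewrite invr_ge0 ltW.
  exact: le_trans smo err.
by rewrite lef_pV2.
Qed.

End critical_rate.

Section part_two.
Context (R : realType).
Local Notation M := (measurableTypeR R).
Local Notation leb := (@lebesgue_measure R).
Local Notation N01 := (normal_prob 0 1 : probability M R).

Lemma type_moments (L : distribution_function R) k lam :
  subgaussian 1 (dmeas L) -> is_type L k lam ->
  forall i, (i < 2 * k)%N ->
    \int[dmeas L]_x ((x : R) ^+ i) = \int[N01]_x ((x : R) ^+ i).
Proof.
move=> sg [ty _] [|i] ik.
  have e (P : probability M R) : \int[P]_x ((x : R) ^+ 0) = 1.
    rewrite (@eq_Rint _ _ _ P _ (fun=> 1)); last by move=> x; rewrite expr0.
    by rewrite Rintegral_cst//= probability_setT /= mulr1.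
  by rewrite !e.
have h : (1 <= i.+1 <= 2 * k - 1)%N by rewrite /= -ltnS subn1 prednK ?(leq_ltn_trans _ ik).
have := ty _ h.
rewrite -(EFin_Rint (integrable_pow i.+1 sg)).
rewrite -(EFin_Rint (integrable_pow i.+1 (@subgaussian_normal R))) -EFinB.
by move=> h2; apply/esym/eqP; rewrite -subr_eq0; apply/eqP; exact: EFin_inj.
Qed.

Lemma cw_limit_cdfE (L : distribution_function R) k z :
  leb.-integrable setT (EFin \o limit_dens k (cw_c2 L k)) ->
  cw_limit_cdf L k z =
  ((\int[leb]_v limit_dens k (cw_c2 L k) v)^-1 *
    \int[leb]_v (limit_dens k (cw_c2 L k) v * (v <= z)%R%:R))%:E.
Proof.
move=> i; rewrite /cw_limit_cdf /cw_density.
rewrite integral_mkcond.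
set f := limit_dens k _ in i *.
have f0 v : 0 <= f v by exact: expR_ge0.
have mz : measurable_fun setT (fun v : R => (v <= z)%R%:R : R).
  exact: (@measurable_indic_le R z _ R id).
have mf : measurable_fun setT f by exact: measurable_limit_dens.
have mfz : measurable_fun setT (fun v : R => f v * (v <= z)%R%:R) by mfun.
have ifz : leb.-integrable setT (EFin \o (fun v => f v * (v <= z)%R%:R)).
  apply: (@dominated_integrable _ M R leb _ f) => // v.
  rewrite normrM (ger0_norm (f0 v)) ler_piMr//.
  by case: (v <= z); rewrite /= ?normr1 ?normr0.
rewrite EFinM (EFin_Rint ifz) -ge0_intZl//; last 2 first.
- by rewrite invr_ge0; apply: Rintegral_ge0 => v _.
- by move=> v; rewrite mulr_ge0.
apply: eq_integral => v _; rewrite patchE mem_setE in_itv /=.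
by case: (v <= z); rewrite ?mulr1 // !mulr0.
Qed.

Lemma root_scale (n k : nat) : (0 < n)%N -> (0 < k)%N ->
  let a := n%:R `^ (1 / (2 * k)%:R) :> R in
  [/\ 1 <= a, a ^+ (2 * k) = n%:R & n%:R `^ (1 - 1 / (2 * k)%:R) = n%:R / a].
Proof.
move=> n0 k0 a.
have nR : 0 < n%:R :> R by rewrite ltr0n.
have kR : 0 < (2 * k)%:R :> R by rewrite ltr0n muln_gt0.
split.
- rewrite -(powRr0 (n%:R : R)); apply: ler_powR; first by rewrite ler1n.
  by rewrite divr_ge0// ltW.
- by rewrite -powR_mulrn ?powR_ge0// /a -powRrM divfK ?gt_eqF// powRr1// ltW.
- by rewrite /a powRB ?powRr1 ?(ltW nR)// (gt_eqF nR) implybT.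
Qed.

(** Exponential decay is stronger than the polynomial decay that is wanted, and
    the bound c1 on c makes the constant uniform. *)
Lemma critical_envelope (k : nat) (c c1 z : R) : (0 < k)%N -> 0 <= c <= c1 ->
  expR (- `|z|) <= (1 + (2 * k)%:R * c1 * (2 * k - 1)`!%:R) /
    (1 + (2 * k)%:R * c * `|z| ^+ (2 * k - 1)).
Proof.
move=> k0 /andP[c0 cc].
have d0 : 0 < 1 + (2 * k)%:R * c * `|z| ^+ (2 * k - 1).
  by rewrite ltr_pwDl// mulr_ge0 ?exprn_ge0// mulr_ge0.
rewrite ler_pdivlMr// expRN mulrC ler_pdivrMr ?expR_gt0// mulrDl mul1r.
apply: lerD; first by rewrite -[leLHS]expR0 ler_expR.
rewrite -!mulrA; apply: ler_wpM2l => //.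
by apply: ler_pM => //; exact: pow_le_expR.
Qed.

(** For k = 1 unit variance makes the second derivative of the defect vanish at
    0, which is incompatible with the lower bound b1 u^2. *)
Lemma no_type_one (b0 b1 b2 : R) (P : probability M R) : 0 < b0 -> 0 < b1 -> 1 < b2 ->
  critical_mgf 1 b0 b1 b2 P -> \int[P]_x (x : R) = 0 -> \int[P]_x ((x : R) ^+ 2) = 1 ->
  (forall i, (i < 2)%N -> \int[P]_x ((x : R) ^+ i) = \int[N01]_x ((x : R) ^+ i)) -> False.
Proof.
move=> b00 b10 b21 cm mean var mom.
have sg := critical_subgaussian b10 b21 cm.
have [C C0 hC] := @defect_expansion R 2 b0 (ltW b00).
have /andP[] := critical_coef_bounds b00 b10 b21 C0 cm mean (hC P sg mean mom).
rewrite /critical_coef muln1 (defect_second sg mean) var subrr mul0r => h _.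
by have := lt_le_trans b10 h; rewrite ltxx.
Qed.

Lemma cw_critical (k : nat) (b0 b1 b2 : R) : (1 <= k)%N -> 0 < b0 -> 0 < b1 -> 1 < b2 ->
  exists C : R, forall L : distribution_function R,
    critical_mgf k b0 b1 b2 (dmeas L) -> standard 1 (dmeas L) ->
    forall lam, is_type L k lam ->
    forall n : nat, (1 <= n)%N ->
    forall (d : measure_display) (Omega : measurableType d)
      (P : probability Omega R) (X : 'I_n -> {RV P >-> R}),
    has_cw_law L 1 X -> forall z : R,
    (`| P [set w | ((\sum_(i < n) X i w) / n%:R `^ (1 - 1 / (2 * k)%:R) <= z)%R]
        - cw_limit_cdf L k z |
     <= (C / (1 + (2 * k)%:R * cw_c2 L k * `|z| ^+ (2 * k - 1))
           * (1 / n%:R `^ (1 / (2 * k)%:R)))%:E)%E.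
Proof.
move=> k0 b00 b10 b21; have [k1|k1] := ltnP 1 k; last first.
  have {}k1 : k = 1 by apply/eqP; rewrite eqn_leq k1.
  exists 0 => L; rewrite k1 => cm [sg mean var] lam /(type_moments sg) mom.
  by have := no_type_one b00 b10 b21 cm mean var mom.
have [C [c1 [C0 c10 H]]] := critical_rate k1 b00 b10 b21.
exists (C * (1 + (2 * k)%:R * c1 * (2 * k - 1)`!%:R)).
move=> L cm [sg mean var] lam ty n n0 d Omega P X cw z.
have [cb HL] := H (dmeas L) (And3 cm mean (type_moments sg ty)).
have [a1 an aW] := root_scale n0 k0.
set a := n%:R `^ _ in a1 an aW *; rewrite aW.
have a0 : 0 < a by exact: lt_le_trans a1.
have nR : 0 < n%:R :> R by rewrite ltr0n.
have [il i1 i2 hz] := HL n a a1 an z.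
set m := sum_law (dmeas L) n in i1 i2 hz *.
pose B : set M := [set s : M | (s : R) / (n%:R / a) <= z].
have mB : measurable B.
  have mf : measurable_fun setT (fun s : M => (s : R) / (n%:R / a)) by mfun.
  have := mf measurableT _ (measurable_itv `]-oo, z]); rewrite setTI.
  by congr measurable; apply/seteqP; split=> s /=; rewrite in_itv.
have := cw_law_sum cw mB.
under eq_integral do rewrite mul1r.
under [X in (_ * X)%E]eq_integral do rewrite mul1r.
have -> : (fun s : M => (expR ((s : R) ^+ 2 / (2 * n%:R)) * \1_B s)%:E) =
    (fun s : M => (expR ((s : R) ^+ 2 / (2 * n%:R)) * (a / n%:R * (s : R) <= z)%R%:R)%:E).
  apply/funext => s; rewrite (_ : a / n%:R * (s : R) = (s : R) / (n%:R / a)); last first.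
    by field; rewrite !gt_eqF.
  by rewrite indicE mem_setE.
rewrite -/m -(EFin_Rint i1) -(EFin_Rint i2) -EFinM /= => ->.
rewrite cw_limit_cdfE// -EFinB lee_fin; apply: (le_trans hz).
rewrite mul1r; apply: ler_wpM2r; first by rewrite invr_ge0 ltW.
by rewrite -mulrA; apply: ler_wpM2l => //; exact: critical_envelope.
Qed.

End part_two.

Theorem theorem4p2 (R : realType) :
  (forall beta b : R, 0 < beta < 1 -> beta < b ->
   exists C : R,
   forall L : distribution_function R,
   (\int[dmeas L]_x (x : R)%:E = 0)%E ->
   (\int[dmeas L]_x ((x : R) ^+ 2)%:E = 1)%E ->
   forall (d0 : measure_display) (Omega0 : measurableType d0)
     (P0 : probability Omega0 R) (xi : {RV P0 >-> R}),
   (forall x : R, cdf xi x = (L x)%:E) ->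
   (forall t : R, ('E_P0[fun w => expR (t * xi w)]
                     <= (expR (t ^+ 2 / (2 * b)))%:E)%E) ->
   forall n : nat, (1 <= n)%N ->
   forall (d : measure_display) (Omega : measurableType d)
     (P : probability Omega R) (X : 'I_n -> {RV P >-> R}),
   has_cw_law L beta X ->
   let S := fun w => \sum_(i < n) X i w in
   let W := fun w => S w / Num.sqrt n%:R in
   forall z : R,
   (`| P [set w | (W w <= z)%R] - normal_limit_cdf beta z |
     <= (C / (1 + (1 - beta) * `|z|) * (1 / Num.sqrt n%:R))%:E)%E)
  /\
  (forall (k : nat) (b0 b1 b2 : R), (1 <= k)%N -> 0 < b0 -> 0 < b1 -> 1 < b2 ->
   exists C : R,
   forall L : distribution_function R,
   (\int[dmeas L]_x (x : R)%:E = 0)%E ->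
   (\int[dmeas L]_x ((x : R) ^+ 2)%:E = 1)%E ->
   forall lambda_rho : R, is_type L k lambda_rho ->
   forall (d0 : measure_display) (Omega0 : measurableType d0)
     (P0 : probability Omega0 R) (xi : {RV P0 >-> R}),
   (forall x : R, cdf xi x = (L x)%:E) ->
   (forall t : R, ('E_P0[fun w => expR (t * xi w)]
      <= (if (`|t| <= b0)%R then expR (t ^+ 2 / 2 - b1 * t ^+ (2 * k))
          else expR (t ^+ 2 / (2 * b2)))%:E)%E) ->
   forall n : nat, (1 <= n)%N ->
   forall (d : measure_display) (Omega : measurableType d)
     (P : probability Omega R) (X : 'I_n -> {RV P >-> R}),
   has_cw_law L 1 X ->
   let S := fun w => \sum_(i < n) X i w in
   let W := fun w => S w / n%:R `^ (1 - 1 / (2 * k)%:R) in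
   forall z : R,
   (`| P [set w | (W w <= z)%R] - cw_limit_cdf L k z |
     <= (C / (1 + (2 * k)%:R * cw_c2 L k * `|z| ^+ (2 * k - 1))
           * (1 / n%:R `^ (1 / (2 * k)%:R)))%:E)%E).
Proof.
split.
  move=> beta b bt bb; have [C HC] := cw_subcritical bt bb.
  have b0 : 0 < b by case/andP: bt => b0 _; exact: lt_trans bb.
  exists C => L mean var d0 Omega0 P0 xi cL mgf n n0 d Omega P X cw S W z.
  have sg : subgaussian b^-1 (dmeas L).
    move=> t; rewrite (mgf_dmeas t cL).
    have -> : b^-1 * t ^+ 2 / 2 = t ^+ 2 / (2 * b) by field; rewrite gt_eqF.
    exact: mgf.
  exact: (HC L (standard_dmeas sg mean var) n n0 d Omega P X cw z).
move=> k b0 b1 b2 k0 b00 b10 b21.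
have [C HC] := cw_critical k0 b00 b10 b21.
exists C => L mean var lam ty d0 Omega0 P0 xi cL mgf n n0 d Omega P X cw S W z.
have cm : critical_mgf k b0 b1 b2 (dmeas L).
  by move=> t; rewrite (mgf_dmeas t cL); exact: mgf.
have sg : subgaussian 1 (dmeas L) := critical_subgaussian b10 b21 cm.
exact: (HC L cm (standard_dmeas sg mean var) lam ty n n0 d Omega P X cw z).
Qed.
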